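(* Let $K$ be a knot in $S^3$ and let $X$ be a simply connected 4-manifold with boundary $S^3$. Then $g_s^X(K)\le g_s^{D^4}(K)$.
   Context: Conventions: all manifolds are oriented, compact, connected and topological, and all embeddings are locally flat. For a manifold $Y$ with boundary, $DY$ denotes the double of $Y$. A surface $S$ (properly) embedded in a 4-manifold $Y$ is a $\mathbb{Z}$-surface if $\pi_1(Y\smallsetminus S)\cong\mathbb{Z}$. For a simply connected 4-manifold $X$ with boundary $S^3$, the $X$-superslice genus of $K$ is $g_s^X(K)=\min\{\operatorname{genus}(F)\mid DF\text{ is a }\mathbb{Z}\text{-surface in }DX\}$, where $F$ runs over all properly embedded surfaces in $X$ with $\partial F=K$, and $DF\subset DX$ is the double of $F$. $g_s^{D^4}(K)$ is the case $X=D^4$. *)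

(* Defs.v *)
From HB Require Import structures.
From mathcomp Require Import all_boot all_order all_algebra generic_quotient.
From mathcomp Require Import all_classical all_reals all_analysis.
Set Implicit Arguments.
Unset Strict Implicit.
Unset Printing Implicit Defensive.
Import Order.TTheory GRing.Theory Num.Theory.
Import numFieldNormedType.Exports.
Local Open Scope classical_set_scope.
Local Open Scope ring_scope.
Local Open Scope quotient_scope.

Section EuclideanModels.
Variables (R : realType) (n : nat).

(* The norm of the library on row vectors is the sup norm, so the round
   sphere and ball are written with the sum of squares. *)
Definition sphere : set 'rV[R]_n := [set v | \sum_i v ord0 i ^+ 2 = 1].
Definition disk : set 'rV[R]_n := [set v | \sum_i v ord0 i ^+ 2 <= 1].

Lemma sphere_sub_disk : sphere `<=` disk.
Proof. by move=> v; rewrite /sphere /disk /= => ->. Qed.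

Definition sphere_in_disk : sphere -> disk := subfun sphere_sub_disk.

End EuclideanModels.

Arguments sphere : clear implicits.
Arguments disk : clear implicits.
Arguments sphere_in_disk : clear implicits.

Section Manifolds.
Variable R : realType.

Definition halfspace n : set 'rV[R]_n :=
  [set v | forall i : 'I_n, i = 0%N :> nat -> 0 <= v ord0 i].
Definition bounding_hyperplane n : set 'rV[R]_n :=
  [set v | forall i : 'I_n, i = 0%N :> nat -> v ord0 i = 0].
(* R^m x 0 inside R^n. For 0 < m it is transverse to the bounding
   hyperplane of the half-space. *)
Definition coordinate_plane m n : set 'rV[R]_n :=
  [set v | forall i : 'I_n, (m <= i)%N -> v ord0 i = 0].

Arguments halfspace : clear implicits.
Arguments bounding_hyperplane : clear implicits.
Arguments coordinate_plane : clear implicits.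

(* A chart of T adapted to bd: a homeomorphism from the open set [dom] onto the
   relatively open subset [cod] `&` halfspace of the half-space, matching bd
   with the bounding hyperplane. The values of [to] outside [dom], and of [from]
   outside [cod] `&` halfspace, are irrelevant. *)
Record chart (T : topologicalType) (bd : set T) (n : nat) := Chart {
  dom : set T;
  cod : set 'rV[R]_n;
  to : T -> 'rV[R]_n;
  from : 'rV[R]_n -> T;
  dom_open : open dom;
  cod_open : open cod;
  to_cod : to @` dom `<=` cod `&` halfspace n;
  from_dom : from @` (cod `&` halfspace n) `<=` dom;
  toK : {in dom, cancel to from};
  fromK : {in cod `&` halfspace n, cancel from to};
  to_continuous : {within dom, continuous to};
  from_continuous : {within cod `&` halfspace n, continuous from};
  to_bd : to @` (dom `&` bd) = cod `&` bounding_hyperplane n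
}.

(* The boundary bd is a parameter matched by the charts; by invariance of domain
   it is determined by T. Compactness and connectedness are part of the notion. *)
Definition manifold (T : topologicalType) (bd : set T) (n : nat) : Prop :=
  [/\ hausdorff_space T, @second_countable T, compact [set: T],
      connected [set: T] & forall x : T, exists c : chart bd n, dom c x].

(* F is a locally flat, proper m-dimensional submanifold of the n-manifold T
   with boundary bd; its boundary is then F `&` bd. *)
Definition locally_flat (T : topologicalType) (bd : set T) (n m : nat)
    (F : set T) : Prop :=
  forall x, F x -> exists c : chart bd n,
    dom c x /\ to c @` (dom c `&` F) =
               cod c `&` halfspace n `&` coordinate_plane m n.

Definition circle (t : R) : 'rV[R]_2 :=
  \row_i (if i == ord0 then cos (2 * pi * t) else sin (2 * pi * t)).

Definition simple_closed_curve (T : topologicalType)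
    (c : sphere R 2 -> T) : Prop := continuous c /\ injective c.

Definition is_knot (K : set (sphere R 4)) : Prop :=
  (exists2 c, simple_closed_curve c & range c = K) /\
  @locally_flat (sphere R 4) set0 3 1 K.

Definition I01 : set R := `[0, 1]%classic.

Definition loop (T : topologicalType) (x : T) (g : R -> T) : Prop :=
  [/\ {within I01, continuous g}, g 0 = x & g 1 = x].

Definition homotopic (T : topologicalType) (x : T) (g h : R -> T) : Prop :=
  exists H : R * R -> T,
    [/\ {within I01 `*` I01, continuous H},
        forall t, I01 t -> H (0, t) = g t,
        forall t, I01 t -> H (1, t) = h t &
        forall s, I01 s -> H (s, 0) = x /\ H (s, 1) = x].

Definition loop_concat (T : Type) (g h : R -> T) (t : R) : T :=
  if t <= 2^-1 then g (2 * t) else h (2 * t - 1).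

(* The elements of the fundamental group are the homotopy classes of loops, as
   sets of loops; [pi1_mul] is the product of classes. *)
Definition pi1_class (T : topologicalType) (x : T) (g : R -> T) :
  set (R -> T) := [set h | loop x h /\ homotopic x g h].

Definition pi1 (T : topologicalType) (x : T) : set (set (R -> T)) :=
  [set pi1_class x g | g in loop x].

Definition pi1_mul (T : topologicalType) (x : T) (a b : set (R -> T)) :
    set (R -> T) :=
  \bigcup_(g in a) \bigcup_(h in b) pi1_class x (loop_concat g h).

Definition pi1_iso_int (T : topologicalType) (x : T) : Prop :=
  exists phi : set (R -> T) -> int,
    set_bij (pi1 x) [set: int] phi /\
    forall a b, pi1 x a -> pi1 x b -> phi (pi1_mul x a b) = phi a + phi b.

Definition path_connected (T : topologicalType) : Prop :=
  [set: T] !=set0 /\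
  forall x y : T, exists g : R -> T,
    [/\ {within I01, continuous g}, g 0 = x & g 1 = y].

Definition simply_connected (T : topologicalType) : Prop :=
  path_connected T /\
  forall (x : T) (g : R -> T), loop x g -> homotopic x g (cst x).

(* Z-surface: no base point is mentioned in "the fundamental group of the
   complement is Z", so the complement is path connected and any base point
   will do. *)
Definition Zsurface (Y : topologicalType) (S : set Y) : Prop :=
  path_connected (~` S : set Y) /\
  forall y : (~` S : set Y), pi1_iso_int y.

(* f, an embedding of a neighbourhood W of p in the plane, has local degree +1
   at p: it sends a small positively oriented circle around p to a loop freely
   homotopic, in the complement of f p, to a positively oriented circle around
   f p. *)
Definition orientation_preserving_at (W : set 'rV[R]_2)
    (f : 'rV[R]_2 -> 'rV[R]_2) (p : 'rV[R]_2) : Prop :=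
  exists r : R,
    [/\ 0 < r, forall v, disk R 2 v -> W (p + r *: v) &
    exists H : R * R -> 'rV[R]_2,
    [/\ {within I01 `*` I01, continuous H},
        forall s t, I01 s -> I01 t -> H (s, t) != f p,
        forall t, I01 t -> H (0, t) = f (p + r *: circle t),
        forall t, I01 t -> H (1, t) = f p + circle t &
        forall s, I01 s -> H (s, 0) = H (s, 1)]].

(* A surface is orientable if it has an atlas whose transition maps preserve
   the orientation (tested at interior points). *)
Definition orientable_surface (T : topologicalType) (bd : set T) : Prop :=
  exists atlas : set (chart bd 2),
    (forall x : T, exists2 c, atlas c & dom c x) /\
    forall c d x, atlas c -> atlas d -> dom c x -> dom d x -> ~ bd x ->
      orientation_preserving_at (to c @` (dom c `&` dom d))
        (to d \o from c) (to c x).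

(* The maximal number of pairwise disjoint simple closed curves in the interior
   whose union does not disconnect the surface. *)
Definition genus (T : topologicalType) (bd : set T) : \bar R :=
  ereal_sup [set (k%:R)%:E | k in [set k : nat |
    exists c : 'I_k -> sphere R 2 -> T,
      [/\ forall i, simple_closed_curve (c i),
          forall i, range (c i) `<=` ~` bd,
          trivIset [set: 'I_k] (fun i => range (c i)) &
          connected (~` \bigcup_i range (c i))]]].

End Manifolds.

Section Double.
Variables (X : topologicalType) (bd : set X).

Definition double_rel (p q : X * bool) : bool :=
  `[< p.1 = q.1 /\ (p.2 = q.2 \/ bd p.1) >].

Lemma double_rel_refl : reflexive double_rel.
Proof. by move=> p; apply/asboolP; split=> //; left. Qed.

Lemma double_rel_sym : symmetric double_rel.
Proof.
by move=> p q; apply: asbool_equiv_eq;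
   split=> -[-> [->|b]]; split=> //; by [left|right].
Qed.

Lemma double_rel_trans : transitive double_rel.
Proof.
move=> q p r /asboolP[pq [e|b]] /asboolP[qr [e'|b']]; apply/asboolP; split;
  rewrite ?pq ?e //; by [left|right; rewrite -?pq|right].
Qed.

Canonical double_equiv :=
  EquivRel double_rel double_rel_refl double_rel_sym double_rel_trans.

Definition double_space : topologicalType :=
  quotient_topology {eq_quot double_equiv}.

Definition double_subset (F : set X) : set double_space :=
  [set \pi_double_space p | p in F `*` [set: bool]].

End Double.

Section SupersliceGenus.
Variable R : realType.

(* The boundary of F is K because charts of X at points of bd restrict to
   half-plane charts of F. An orientation of F induces one of K, and K has only
   two, so orientability of F suffices. *)
Definition spanning_surface (X : topologicalType) (bd K F : set X) : Prop :=
  [/\ compact F, connected F, locally_flat R bd 4 2 F, F `&` bd = K &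
      orientable_surface R (set_val @^-1` bd : set (F : Type))].

(* The boundary of X is identified with the 3-sphere by h. The minimum of a set
   of natural numbers is taken as an infimum in \bar R (it is +oo when the set
   is empty). *)
Definition superslice_genus (X : topologicalType) (h : sphere R 4 -> X)
    (K : set (sphere R 4)) : \bar R :=
  ereal_inf [set genus R (set_val @^-1` range h : set (F : Type)) |
    F in [set F : set X |
      spanning_surface (range h) (h @` K) F /\
      Zsurface R (@double_subset X (range h) F)]].

End SupersliceGenus.

(* Main.v *)
(* Let F be a surface in D^4 and p an interior point of D^4 off F. Since the
   boundary of X has a collar, X collapses onto D^4 by a map k which is a
   homeomorphism away from p, is the identity on the boundary sphere, and
   whose fibre over p is the complement of an open collar, a copy of X. The
   preimage F' of F is homeomorphic to F and spans K in X. Doubling k gives a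
   map from the complement of DF' to that of DF which is one-to-one away from
   the two copies of p, around which it has simply connected preimages. Such
   a map is an isomorphism on fundamental groups: paths and homotopies are
   lifted cell by cell along a fine grid, exactly where they avoid the copies
   of p, and by filling in the simply connected preimages elsewhere. This
   replaces the usual appeal to van Kampen's theorem. Collars are built as in
   Connelly's proof of Brown's theorem, by adding outer collars of variable
   height one chart at a time. *)
Require Import Defs.
From mathcomp Require Import all_boot all_order all_algebra generic_quotient.
From mathcomp Require Import all_classical all_reals all_analysis.
From mathcomp Require Import ring lra.
Import numFieldNormedType.Exports.
Local Open Scope classical_set_scope.
Local Open Scope ring_scope.
Set Implicit Arguments.
Unset Strict Implicit.
Unset Printing Implicit Defensive.
Import Order.TTheory GRing.Theory Num.Theory.

(** * Continuity on subsets, pasting, and quotients of compact sets *)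

Section TopologicalPreliminaries.
Implicit Types S T U : topologicalType.

(** The collapse has no continuous section: over [p] a section is a free choice, and off [p] its
    continuity comes from compactness. Paths and homotopies cannot in general be lifted exactly, so
    the lifting argument records only what survives the choices ([lifts_on]): a lift follows the
    section where the map avoids the bad points, and lies over the patch that contains the map. This
    weak condition still gives surjectivity on fundamental groups. If [g] is such a lift of a loop
    [f], then [q \o g] and [f] may differ, but both are weak lifts of [f] along the identity, which
    is itself a collapse with the same patches; the same grid argument along the identity produces a
    homotopy between them. A patch is the disk scaled towards [p] by a ratio [a] small enough to
    miss [F]. It is 1-connected by convexity, and its preimage is a copy of [X], obtained by
    multiplying collar heights by [a]; this is where the simple connectivity of [X] enters. *)

Lemma within_continuous_compW S T U (A : set S) (B : set T)
    (f : S -> T) (g : T -> U) :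
  {within A, continuous f} -> {within B, continuous g} ->
  (forall x, A x -> B (f x)) -> {within A, continuous (g \o f)}.
Proof.
move=> /subspace_continuousP fc /subspace_continuousP gc AB.
apply/subspace_continuousP => x Ax.
apply: cvg_comp (gc _ (AB _ Ax)) => O /= nO.
have := fc _ Ax _ nO; rewrite /nbhs /= /within /=.
by apply: filter_app; near=> y => + Ay; apply => //; exact: AB.
Unshelve. all: by end_near. Qed.

Lemma within_continuousT_comp S T U (A : set S) (f : S -> T) (g : T -> U) :
  {within A, continuous f} -> continuous g -> {within A, continuous (g \o f)}.
Proof. by move=> fc gc; apply: within_continuous_comp fc => x _; exact: gc. Qed.

Lemma within_continuous_eq S T (A : set S) (f g : S -> T) :
  (forall x, A x -> f x = g x) ->
  {within A, continuous f} -> {within A, continuous g}.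
Proof.
by move=> fg; apply: subspace_eq_continuous => x /set_mem /fg.
Qed.

Lemma within_continuous_pair S T U (A : set S) (f : S -> T) (g : S -> U) :
  {within A, continuous f} -> {within A, continuous g} ->
  {within A, continuous (fun x => (f x, g x))}.
Proof. by move=> fc gc x; apply: cvg_pair; [exact: fc|exact: gc]. Qed.

Lemma continuous_pair S T U (f : S -> T) (g : S -> U) :
  continuous f -> continuous g -> continuous (fun x => (f x, g x)).
Proof. by move=> fc gc x; apply: cvg_pair; [exact: fc|exact: gc]. Qed.

Lemma continuousT_comp S T U (f : S -> T) (g : T -> U) :
  continuous f -> continuous g -> continuous (g \o f).
Proof. by move=> fc gc x; apply: continuous_comp; [exact: fc|exact: gc]. Qed.

Lemma fst_continuous S T : continuous (@fst S T).
Proof. by move=> x; exact: cvg_fst. Qed.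

Lemma snd_continuous S T : continuous (@snd S T).
Proof. by move=> x; exact: cvg_snd. Qed.

Lemma within_bigcup_continuous S T (I : finType) (C : I -> set S) (f : S -> T) :
  (forall i, closed (C i)) -> (forall i, {within C i, continuous f}) ->
  {within \bigcup_i C i, continuous f}.
Proof.
move=> clC fc.
have [_ ct] : closed (\big[setU/set0]_(i : I) C i) /\
    {within \big[setU/set0]_(i : I) C i, continuous f}.
  elim/big_ind : _ => //.
  - by split; [exact: closed0|exact: continuous_subspace0].
  - move=> A B [cA fA] [cB fB].
    by split; [exact: closedU|exact: withinU_continuous].
apply: (@continuous_subspaceW _ _ _ _ _ _ ct) => x [i _ Cx].
by rewrite (bigD1 i)//=; by left.
Qed.

Lemma within_cover_continuous S T (I : finType) (A : set S) (C : I -> set S)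
    (f : S -> T) (g : I -> S -> T) :
  (forall i, closed (C i)) -> A `<=` \bigcup_i C i ->
  (forall i, {within C i, continuous g i}) ->
  (forall i x, C i x -> f x = g i x) ->
  {within A, continuous f}.
Proof.
move=> clC sAC gc fg; apply: (@continuous_subspaceW _ _ _ _ _ sAC).
apply: within_bigcup_continuous => // i.
by apply: within_continuous_eq (gc i) => x /fg.
Qed.

(* Compactness of K makes f a quotient map onto its image. Only the fibre over
   d has to be respected by h; over the other points g may be a choice. *)
Lemma compact_quotient_at S T U (K : set S) (f : S -> T) (h : S -> U)
    (g : T -> U) (d : T) :
  hausdorff_space T -> compact K ->
  {within K, continuous f} -> {within K, continuous h} ->
  (forall z, K z -> f z = d -> h z = g d) ->
  (forall d', (f @` K) d' -> exists z, [/\ K z, f z = d' & h z = g d']) ->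
  g @ within (f @` K) (nbhs d) --> g d.
Proof.
move=> hT cK fc hc fib sel O nO.
have /compact_near_coveringP/near_covering_withinP cov := cK.
suff : \forall d' \near d, K `<=` (fun z => f z = d' -> O (h z)).
  rewrite /nbhs /= /within /=; apply: filterS => d' Pd' Kd'.
  by have [z [Kz ez <-]] := sel _ Kd'; exact: (Pd' z Kz ez).
apply: cov => z Kz.
have [e|/eqP ne] := pselect (f z = d).
  move/subspace_continuousP : hc => /(_ _ Kz) /= hz.
    have nOz : nbhs (h z) O by rewrite (fib _ Kz e).
    have := hz _ nOz; rewrite /nbhs /= /within /= => nz.
    exists ([set z | K z -> O (h z)], setT) => /=.
      by split => //; exact: filterT.
    by case=> z' d' /= [Oz' _] Kz' _; exact: Oz'.
  move: hT; rewrite open_hausdorff => /(_ _ _ ne) [[P Q] /= [/set_mem Pf /set_mem Qd] [oP oQ PQ]].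
  move/subspace_continuousP : fc => /(_ _ Kz) /= fz.
  have := fz _ (open_nbhs_nbhs (conj oP Pf)).
  rewrite /nbhs /= /within /= => nz.
  exists ([set z | K z -> P (f z)], Q) => /=.
    by split => //; exact: open_nbhs_nbhs.
  case=> z' d' /= [Pz' Qd'] Kz' e.
  have : (P `&` Q) d' by split => //; rewrite -e; exact: Pz'.
  by rewrite (eqP PQ).
Qed.

Lemma compact_quotient_continuous S T U (K : set S) (f : S -> T) (h : S -> U)
    (g : T -> U) :
  hausdorff_space T -> compact K ->
  {within K, continuous f} -> {within K, continuous h} ->
  (forall z, K z -> g (f z) = h z) ->
  {within f @` K, continuous g}.
Proof.
move=> hT cK fc hc gfh; apply/subspace_continuousP => d Kd.
apply: (compact_quotient_at hT cK fc hc) => [z Kz e|d' [z Kz e]].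
  by rewrite -e; exact/esym/gfh.
by exists z; split => //; rewrite -e; exact/esym/gfh.
Qed.

(** The quotient argument with [h := id]: only the fibre over [d] has to be a point, so [e] may be a
    discontinuous choice elsewhere. The sections of the collapse and of its double get their
    continuity from here. *)
Lemma section_continuous_at S T (f : S -> T) (e : T -> S) (d : T) :
  hausdorff_space T -> compact [set: S] -> continuous f ->
  (forall d', f (e d') = d') -> (forall x, f x = d -> x = e d) ->
  {for d, continuous e}.
Proof.
move=> hT cS fc fe fib.
have cfT : {within setT, continuous f} by exact: continuous_subspaceT.
have cid : {within [set: S], continuous id}.
  by apply: continuous_subspaceT => x; exact: cvg_id.
have H : (f @` [set: S]) = setT.
  by apply/seteqP; split => // y _; exists (e y).
have := @compact_quotient_at S T S setT f id e d hT cS cfT cid (fun z _ => fib z).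
rewrite H => /(_ _) cv.
have {}cv : e @ within [set: T] (nbhs d) --> e d.
  by apply: cv => d' _; exists (e d'); split => //=.
by move=> O /cv; rewrite /nbhs /= /within /=; apply: filterS => y /=; exact.
Qed.

Lemma left_inverse_continuous S T (K : set S) (f : S -> T) (e : T -> S) :
  hausdorff_space T -> compact K -> {within K, continuous f} ->
  (forall x, K x -> e (f x) = x) -> {within f @` K, continuous e}.
Proof.
move=> hT cK fc ef; apply: (compact_quotient_continuous (h := id)) => //.
by apply: continuous_subspaceT => x; exact: cvg_id.
Qed.

Lemma injective_hausdorff S T (f : S -> T) :
  continuous f -> injective f -> hausdorff_space T -> hausdorff_space S.
Proof.
move=> fc fi; rewrite !open_hausdorff => hT x y xy.
have /hT [[P Q] /= [/set_mem Px /set_mem Qy] [oP oQ PQ]] : f x != f y.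
  by apply: contra_neq xy => /fi.
exists (f @^-1` P, f @^-1` Q) => /=; first by rewrite !inE.
split; [by move/continuousP: fc; apply|by move/continuousP: fc; apply|].
by rewrite -preimage_setI (eqP PQ) ?preimage_set0.
Qed.

End TopologicalPreliminaries.

Section ContinuousArithmetic.
Variables (R : realType) (S : topologicalType) (V : normedModType R).
Implicit Types (f g : S -> V) (k l : S -> R).

Lemma continuous_funD f g : continuous f -> continuous g ->
  continuous (fun x => f x + g x).
Proof. by move=> fc gc x; apply: cvgD; [exact: fc|exact: gc]. Qed.

Lemma continuous_funB f g : continuous f -> continuous g ->
  continuous (fun x => f x - g x).
Proof. by move=> fc gc x; apply: cvgB; [exact: fc|exact: gc]. Qed.

Lemma continuous_funN f : continuous f -> continuous (fun x => - f x).
Proof. by move=> fc x; apply: cvgN; exact: fc. Qed.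

Lemma continuous_funZ k f : continuous k -> continuous f ->
  continuous (fun x => k x *: f x).
Proof. by move=> kc fc x; apply: cvgZ; [exact: kc|exact: fc]. Qed.

Lemma continuous_funM k l : continuous k -> continuous l ->
  continuous (fun x => k x * l x).
Proof. by move=> kc lc x; apply: cvgM; [exact: kc|exact: lc]. Qed.

Lemma continuous_fun_norm f : continuous f -> continuous (fun x => `|f x|).
Proof. by move=> fc x; apply: cvg_norm; exact: fc. Qed.

End ContinuousArithmetic.

Lemma continuous_cst (S T : topologicalType) (a : T) :
  continuous (fun _ : S => a).
Proof. by move=> x; exact: cvg_cst. Qed.

Lemma continuous_idfun (S : topologicalType) : continuous (fun x : S => x).
Proof. by move=> x; exact: cvg_id. Qed.

Lemma glue_exists (S T : topologicalType) (I : finType) (A : set S)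
    (C : I -> set S) (g : I -> S -> T) (dflt : S -> T) :
  (forall i, closed (C i)) -> A `<=` \bigcup_i C i ->
  (forall i, {within C i, continuous g i}) ->
  (forall i j x, C i x -> C j x -> g i x = g j x) ->
  exists f, {within A, continuous f} /\ forall i x, C i x -> f x = g i x.
Proof.
move=> clC AsC gc gg.
pose f x := if pselect (exists i, C i x) is left w then g (sval (cid w)) x
            else dflt x.
have fg i x : C i x -> f x = g i x.
  move=> Cx; rewrite /f; case: pselect => [w|[]]; last by exists i.
  by case: cid => j /= Cj; exact: gg.
by exists f; split => //; apply: within_cover_continuous fg.
Qed.

Lemma continuous_affine_within (R : realType) (S : topologicalType) (A : set S)
  (f : S -> R) (a b : R) : {within A, continuous f} ->
  {within A, continuous (fun x => a * f x + b)}.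
Proof.
move=> fc x; apply: cvgD; last exact: cvg_cst.
by apply: cvgM; [exact: cvg_cst|exact: fc].
Qed.

(** * Squares, grids and the mesh of a map of the square *)

Section Squares.
Variable R : realType.

Local Notation I := (@I01 R).

Definition square : set (R * R) := I `*` I.
Definition square_boundary : set (R * R) :=
  [set p | square p /\ [\/ p.1 = 0, p.1 = 1, p.2 = 0 | p.2 = 1]].

(** The filling may leave [W]: it becomes one cell of a homotopy in [T], of which only the boundary
    values matter later. *)
Definition fillable (T : topologicalType) (W : set T) : Prop :=
  forall g : R * R -> T, {within square_boundary, continuous g} ->
    (forall p, square_boundary p -> W (g p)) ->
  exists G : R * R -> T, {within square, continuous G} /\
    forall p, square_boundary p -> G p = g p.

(** In contrast with a filling, the path has to stay in [W], since it becomes an edge of cells whose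
    whole boundary must lie in [W]. *)
Definition path_joined (T : topologicalType) (W : set T) : Prop :=
  forall x y, W x -> W y -> exists g : R -> T,
    [/\ {within I, continuous g}, g 0 = x, g 1 = y & forall t, I t -> W (g t)].

Lemma I01P (t : R) : I t <-> 0 <= t <= 1.
Proof. by rewrite /I01 /= in_itv. Qed.

Lemma closed_itv_cc (a b : R) : closed `[a, b]%classic.
Proof. exact: interval_closed. Qed.

Lemma closed_setX (S T : topologicalType) (A : set S) (B : set T) :
  closed A -> closed B -> closed (A `*` B).
Proof.
move=> cA cB; rewrite (_ : A `*` B = fst @^-1` A `&` snd @^-1` B); last first.
  by apply/seteqP; split.
apply: closedI.
  by apply: closed_comp => // -[x y] _; exact: cvg_fst.
by apply: closed_comp => // -[x y] _; exact: cvg_snd.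
Qed.

Lemma compact_square : compact square.
Proof. by apply: compact_setX; exact: segment_compact. Qed.

Lemma fillable_rect (T : topologicalType) (W : set T) (a c d : R)
    (g : R * R -> T) (Q := `[a, a + d] `*` `[c, c + d])
    (dQ := [set p | Q p /\ [\/ p.1 = a, p.1 = a + d, p.2 = c | p.2 = c + d]]) :
  0 < d -> fillable W -> {within dQ, continuous g} ->
  (forall p, dQ p -> W (g p)) ->
  exists G : R * R -> T, {within Q, continuous G} /\
    forall p, dQ p -> G p = g p.
Proof.
move=> d0 fW gc gW.
pose u (p : R * R) := (d * p.1 + a, d * p.2 + c).
pose v (p : R * R) := (d^-1 * p.1 + - (d^-1 * a), d^-1 * p.2 + - (d^-1 * c)).
have dn0 : d != 0 by rewrite gt_eqF.
have uv p : u (v p) = p.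
  by case: p => s t; rewrite /u /v /=; congr pair; field.
have c1 (A : set (R * R)) : {within A, continuous (@fst R R)}.
  by apply: continuous_subspaceT => -[x y]; exact: cvg_fst.
have c2 (A : set (R * R)) : {within A, continuous (@snd R R)}.
  by apply: continuous_subspaceT => -[x y]; exact: cvg_snd.
have uc (A : set (R * R)) : {within A, continuous u}.
  by apply: within_continuous_pair; apply: continuous_affine_within.
have vc (A : set (R * R)) : {within A, continuous v}.
  by apply: within_continuous_pair; apply: continuous_affine_within.
have vI (x y : R) : a <= x <= a + d -> 0 <= d^-1 * x + - (d^-1 * a) <= 1.
  move=> /andP[h1 h2]; rewrite -mulrN -mulrDr mulrC ler_pdivlMr// ler_pdivrMr//.
  by apply/andP; split; lra.
have vI' (x y : R) : c <= x <= c + d -> 0 <= d^-1 * x + - (d^-1 * c) <= 1.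
  move=> /andP[h1 h2]; rewrite -mulrN -mulrDr mulrC ler_pdivlMr// ler_pdivrMr//.
  by apply/andP; split; lra.
have vsq p : Q p -> square (v p).
  case: p => s t; rewrite /Q /= !in_itv /= => -[h1 h2].
  by split; apply/I01P => /=; [apply: vI|apply: vI'].
have vbd p : dQ p -> square_boundary (v p).
  move=> [Qp h]; split; first exact: vsq.
  case: p h {Qp} => s t /= h; case: h => ->.
  - by apply: Or41; ring.
  - by apply: Or42; field.
  - by apply: Or43; ring.
  - by apply: Or44; field.
have ubd p : square_boundary p -> dQ (u p).
  case: p => s t [[/I01P /= /andP[s0 s1] /I01P /= /andP[t0 t1]] h]; split.
    by rewrite /Q /u /= !in_itv /=; split; apply/andP; split; nra.
  case: h => /= ->; [apply: Or41|apply: Or42|apply: Or43|apply: Or44] => /=; ring.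
have [|p bp|G [Gc Gg]] := fW (g \o u).
- by apply: within_continuous_compW gc ubd.
- exact/gW/ubd.
exists (G \o v); split.
  by apply: within_continuous_compW Gc vsq.
by move=> p dp /=; rewrite Gg; [rewrite /= uv|exact: vbd].
Qed.

Definition grid (N i : nat) : R := i%:R / N%:R.

Lemma grid0 N : grid N 0 = 0. Proof. by rewrite /grid mul0r. Qed.
Lemma gridN N : (0 < N)%N -> grid N N = 1.
Proof. by move=> N0; rewrite /grid divff// pnatr_eq0 -lt0n. Qed.
Lemma gridS N i : (0 < N)%N -> grid N i.+1 = grid N i + N%:R^-1.
Proof. by move=> N0; rewrite /grid -natr1 mulrDl mul1r. Qed.
Lemma ler_grid N i j : (0 < N)%N -> (grid N i <= grid N j) = (i <= j)%N.
Proof. by move=> N0; rewrite /grid ler_pM2r ?ler_nat// invr_gt0 ltr0n. Qed.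
Lemma grid_inj N i j : (0 < N)%N -> grid N i = grid N j -> i = j.
Proof.
move=> N0 e; apply/eqP; rewrite eqn_leq -!(ler_grid _ _ N0) e lexx.
by rewrite andbT.
Qed.

Definition gridcell (N i : nat) : set R := `[grid N i, grid N i.+1].

Lemma gridcellP N i t : gridcell N i t <-> grid N i <= t <= grid N i.+1.
Proof. by rewrite /gridcell /= in_itv. Qed.

Lemma gridcell_sub N i : (i < N)%N -> gridcell N i `<=` I.
Proof.
move=> iN t /gridcellP /andP[h1 h2];
  apply/I01P; have N0 : (0 < N)%N by case: N iN {h1 h2}.
rewrite -(grid0 N) -(gridN N0); apply/andP; split.
  by apply: le_trans h1; rewrite ler_grid.
by apply: (le_trans h2); rewrite ler_grid.
Qed.

Lemma grid_in N i : (0 < N)%N -> (i <= N)%N -> I (grid N i).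
Proof. by move=> N0 iN; apply/I01P; rewrite -(grid0 N) -(gridN N0) !ler_grid. Qed.

Lemma gridcell_cover N : (0 < N)%N -> I `<=` \bigcup_(i : 'I_N) gridcell N i.
Proof.
move=> N0 t /I01P /andP[t0 t1].
have ex : exists i : nat, t <= grid N i.+1.
  by exists N.-1; rewrite prednK// gridN.
case: (ex_minnP ex) => i ti mi.
have iN : (i < N)%N.
  by have := mi N.-1; rewrite prednK// gridN// => /(_ t1); case: N N0 {ex ti mi t1}.
exists (Ordinal iN) => //; apply/gridcellP; rewrite /= ti andbT.
case: i mi {ti iN} => [|i mi]; first by rewrite grid0.
by rewrite leNgt; apply/negP => /ltW /mi; rewrite ltnn.
Qed.

(** Pieces defined on the cells of a grid are compatible once they agree at grid points; the
    matching of neighbouring pieces is always reduced to this. *)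
Lemma gridcell_meet N i j t : (0 < N)%N -> gridcell N i t -> gridcell N j t ->
  i = j \/ exists k, [/\ t = grid N k, k = i \/ k = i.+1 & k = j \/ k = j.+1].
Proof.
move=> N0; wlog ij : i j / (i <= j)%N.
  move=> H; have [ij|/ltnW ji] := leqP i j; first exact: H.
  move=> h1 h2; case: (H _ _ ji h2 h1) => [->|[k [-> ? ?]]]; first by left.
  by right; exists k.
move=> /gridcellP /andP[h1 h2] /gridcellP /andP[h3 h4].
move: ij; rewrite leq_eqVlt => /orP[/eqP ->|ij]; [by left|right].
have e : j = i.+1.
  apply/eqP; rewrite eqn_leq ij andbT -(ler_grid _ _ N0).
  exact: le_trans h3 h2.
exists i.+1; split; [|by right|by left].
by apply/eqP; rewrite eq_le h2 -e h3.
Qed.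

Lemma gridcell_closed N i : closed (gridcell N i).
Proof. exact: closed_itv_cc. Qed.

Lemma gridcell_ends N i k : (0 < N)%N -> k = i \/ k = i.+1 ->
  gridcell N i (grid N k).
Proof.
by move=> N0 h; apply/gridcellP; rewrite !ler_grid//; case: h => ->; rewrite leqnn ?leqnSn.
Qed.

(** Lebesgue number argument: every point of the square has a ball whose image misses [P] or lies in
    one patch, and compactness makes the radius uniform. *)
Lemma mesh_exists (A : topologicalType) (J : Type) (P : set A) (V : J -> set A)
    (f : R * R -> A) :
  (forall a : A, (\forall a' \near nbhs a, ~ P a') \/
     exists k, \forall a' \near nbhs a, V k a') ->
  {within square, continuous f} ->
  exists2 N, (0 < N)%N & forall i j, (i < N)%N -> (j < N)%N ->
    (forall p, (gridcell N i `*` gridcell N j) p -> ~ P (f p)) \/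
    exists k, forall p, (gridcell N i `*` gridcell N j) p -> V k (f p).
Proof.
move=> cov fc.
have /compact_near_coveringP/near_covering_withinP K := compact_square.
pose good (d : R) p :=
  (forall p', square p' -> ball p d p' -> ~ P (f p')) \/
  exists k, forall p', square p' -> ball p d p' -> V k (f p').
have /K : forall p, square p ->
    \forall p' \near p & d \near 0^'+, square p' -> good d p'.
  move=> p sp; move/subspace_continuousP : fc => /(_ _ sp) fp.
  have ballgood (G : set A) : nbhs (f p) G -> exists2 e : R, 0 < e &
      forall p' d p'', ball p e p' -> d < e -> square p'' -> ball p' d p'' ->
        G (f p'').
    move=> nG; have : nbhs p [set x | square x -> G (f x)] by exact: (fp _ nG).
    move=> /nbhs_ballP[e /= e0 eG].
    exists (e / 2) => [|p' d p'' b1 de sp'' b2]; first by rewrite divr_gt0.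
    apply: eG => //; rewrite (splitr e); apply: ball_triangle b1 _.
    exact: le_ball (ltW de) _ b2.
  case: (cov (f p)) => [nP|[k nV]].
    have [e e0 H] := ballgood _ nP.
    exists (ball p e, [set d | d < e]) => /=.
      split; first exact: nbhsx_ballx.
      by apply: nbhs_right_lt.
    by case=> p' d /= [b1 de] _; left => p'' sp'' b2; exact: H b1 de sp'' b2.
  have [e e0 H] := ballgood _ nV.
  exists (ball p e, [set d | d < e]) => /=.
    split; first exact: nbhsx_ballx.
    by apply: nbhs_right_lt.
  by case=> p' d /= [b1 de] _; right; exists k => p'' sp'' b2; exact: H b1 de sp'' b2.
move=> nd.
have [d [d0 gd]] : exists d : R, 0 < d /\ forall p, square p -> good d p.
  have : \forall d \near 0^'+, 0 < d /\ forall p, square p -> good d p.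
    near=> d; split; first by near: d; exact: nbhs_right_gt.
    by near: d; apply: filterS nd => d gd p; exact: gd.
  by move=> /filter_ex.
(* With mesh [1 / N] below [d], every cell lies in the ball of radius [d] about its lower left
   corner. *)
pose N := (Num.trunc d^-1).+1.
have Nd : N%:R^-1 < d :> R.
  by rewrite invf_plt ?posrE// /N; exact: truncnS_gt.
exists N => // i j iN jN.
have inball p : (gridcell N i `*` gridcell N j) p -> ball (grid N i, grid N j) d p.
  case: p => s t /= [/gridcellP /andP[h1 h2] /gridcellP /andP[h3 h4]].
  move: h2 h4; rewrite !gridS// => h2 h4.
  by split; rewrite /= /ball /= ltr_norml; apply/andP; split; lra.
have insq p : (gridcell N i `*` gridcell N j) p -> square p.
  by case: p => s t /= [h1 h2]; split; [apply: gridcell_sub h1|apply: gridcell_sub h2].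
have sg : square (grid N i, grid N j).
  by split; apply: grid_in => //; exact: ltnW.
case: (gd _ sg) => [h|[k h]].
  by left => p cp; apply: h; [exact: insq|exact: inball].
by right; exists k => p cp; apply: h; [exact: insq|exact: inball].
Unshelve. all: by end_near. Qed.

End Squares.

Arguments grid {R} N i.

(** * Lifting along a collapse *)

(* The patches V k surround P and have 1-connected preimages, so q cannot be
   distinguished from a homeomorphism on fundamental groups. *)
Record collapse (R : realType) (B A : topologicalType) (J : Type)
    (q : B -> A) (e : A -> B) (P : set A) (V : J -> set A) : Prop := Collapse {
  collapse_cont : continuous q;
  collapse_sec : cancel e q;
  collapse_inj : forall b, ~ P (q b) -> e (q b) = b;
  collapse_sec_cont : forall a, ~ P a -> {for a, continuous e};
  collapse_disj : forall k l a, V k a -> V l a -> k = l;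
  collapse_cov : forall a : A, (\forall a' \near nbhs a, ~ P a') \/
     exists k, \forall a' \near nbhs a, V k a';
  collapse_joined : forall k, path_joined R (q @^-1` V k);
  collapse_fill : forall k, fillable R (q @^-1` V k)
}.

Arguments collapse_joined {R B A J q e P V} _ k.
Arguments collapse_fill {R B A J q e P V} _ k.

Section Lifting.
Variables (R : realType) (B A : topologicalType) (J : Type).
Variables (q : B -> A) (e : A -> B) (P : set A) (V : J -> set A).
Hypothesis col : collapse R q e P V.

Local Notation I := (@I01 R).

(* The part of the condition q o g = f on E that does not depend on the choices
   made inside the patches. *)
Definition lifts_on (S : Type) (E : set S) (f : S -> A) (g : S -> B) : Prop :=
  ((forall x, E x -> ~ P (f x)) -> forall x, E x -> g x = e (f x)) /\
  (forall k, (forall x, E x -> V k (f x)) -> forall x, E x -> V k (q (g x))).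

Definition small_on (S : Type) (E : set S) (f : S -> A) : Prop :=
  (forall x, E x -> ~ P (f x)) \/ exists k, forall x, E x -> V k (f x).

Lemma lift_lifts_on (S : Type) (E : set S) (f : S -> A) (g : S -> B) :
  (forall x, E x -> q (g x) = f x) -> lifts_on E f g.
Proof.
move=> qg; split=> [nP x Ex|k Vk x Ex]; last by rewrite qg//; exact: Vk.
by rewrite -qg// (collapse_inj col)// qg//; exact: nP.
Qed.

Lemma section_within_continuous (S : topologicalType) (E : set S) (f : S -> A) :
  {within E, continuous f} -> (forall x, E x -> ~ P (f x)) ->
  {within E, continuous (e \o f)}.
Proof.
move=> fc nP; apply: within_continuous_comp fc => a /set_mem [x Ex <-].
by apply: (collapse_sec_cont col); exact: nP.
Qed.

(** Off [P] the section itself lifts the edge and has the right ends, since the hypotheses at [a]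
    and [b] force [x] and [y] to be its values. Otherwise the edge lies in a patch, over which both
    ends can be joined. *)
Lemma edge_lift (a b : R) (f : R -> A) (x y : B) :
  a < b -> {within `[a, b], continuous f} -> small_on `[a, b] f ->
  lifts_on [set a] f (cst x) -> lifts_on [set b] f (cst y) ->
  exists g, [/\ {within `[a, b], continuous g}, g a = x, g b = y &
    lifts_on `[a, b] f g].
Proof.
move=> ab fc sm [xa Va] [yb Vb].
have aI : `[a, b]%classic a by rewrite /= in_itv /= lexx ltW.
have bI : `[a, b]%classic b by rewrite /= in_itv /= lexx ltW.
(* An edge that avoids [P] must follow the section even when it also lies in a patch, so this is
   tested before [small_on]. *)
have [nP|] := pselect (forall x, `[a, b]%classic x -> ~ P (f x)).
  exists (e \o f); split.
  - exact: section_within_continuous.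
  - by rewrite /= -(xa _ a)// => _ ->; exact: nP.
  - by rewrite /= -(yb _ b)// => _ ->; exact: nP.
  - by split=> // k Vk t tab; rewrite /= (collapse_sec col); exact: Vk.
case: sm => [h /(_ h) //|[k Vk] nnP].
have [||g [gc g0 g1 gV]] := collapse_joined col k x y.
- by apply: (Va k _ a) => // _ ->; exact: Vk.
- by apply: (Vb k _ b) => // _ ->; exact: Vk.
have ba : b - a != 0 by rewrite subr_eq0 gt_eqF.
pose u t := (b - a)^-1 * t + - ((b - a)^-1 * a).
have ua : u a = 0 by rewrite /u; ring.
have ub : u b = 1 by rewrite /u; field.
have uI t : `[a, b]%classic t -> I (u t).
  rewrite /= in_itv /= => /andP[h1 h2]; apply/I01P; rewrite /u -mulrN -mulrDr mulrC.
  by rewrite ler_pdivlMr ?ler_pdivrMr ?subr_gt0//; apply/andP; split; lra.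
exists (g \o u); split; rewrite /= ?ua ?ub//.
  apply: within_continuous_compW gc uI; apply: continuous_affine_within.
  by apply: continuous_subspaceT => z; exact: cvg_id.
split=> [nP|l Vl t tab]; first by [].
(* A second patch containing the edge shares the point [f a] with [V k], hence is [V k]. *)
by rewrite -(collapse_disj col (Vk _ aI) (Vl _ aI)); exact/gV/uI.
Qed.

(** The values at the grid points are fixed beforehand, so the edges can be lifted independently and
    still match. *)
Lemma path_lift (N : nat) (f : R -> A) (v : nat -> B) :
  (0 < N)%N -> {within I, continuous f} ->
  (forall i, (i < N)%N -> small_on (gridcell N i) f) ->
  (forall i, (i <= N)%N -> lifts_on [set grid N i] f (cst (v i))) ->
  exists g, [/\ {within I, continuous g},
    forall i, (i <= N)%N -> g (grid N i) = v i &
    forall i, (i < N)%N -> lifts_on (gridcell N i) f g].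
Proof.
move=> N0 fc sm vl.
have /choice [h hP] : forall i : 'I_N, exists g,
    [/\ {within gridcell N i, continuous g}, g (grid N i) = v i,
      g (grid N i.+1) = v i.+1 & lifts_on (gridcell N i) f g].
  move=> i; apply: edge_lift.
  - by rewrite gridS// ltrDl invr_gt0 ltr0n.
  - exact: continuous_subspaceW (gridcell_sub (ltn_ord i)) _.
  - exact: sm.
  - by apply: vl; exact: ltnW.
  - exact: vl.
have hgrid (i : 'I_N) k : k = i :> nat \/ k = i.+1 -> h i (grid N k) = v k.
  by have [_ h0 h1 _] := hP i => -[->|->].
have [i0] : exists i : 'I_N, True by exists (Ordinal N0).
move=> _; have [||||g [gc gh]] := @glue_exists _ _ _ I
  (fun i : 'I_N => gridcell N i) h (h i0).
- by move=> i; exact: gridcell_closed.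
- exact: gridcell_cover.
- by move=> i; have [] := hP i.
- move=> i j t ti tj; have [ij|[k [-> ki kj]]] := gridcell_meet N0 ti tj.
    by congr (h _ _); apply: val_inj.
  by rewrite !hgrid.
exists g; split => //.
- move=> i; rewrite leq_eqVlt => /orP[/eqP ->|iN]; last first.
    rewrite (gh (Ordinal iN)) ?hgrid//=; first by left.
    by apply: gridcell_ends => //; left.
  have lN : (N.-1 < N)%N by rewrite prednK.
  have eN : N = N.-1.+1 by rewrite prednK.
  rewrite (gh (Ordinal lN)) ?hgrid//=; first by right.
  by apply: gridcell_ends => //; right.
- move=> i iN; have [_ _ _ [l1 l2]] := hP (Ordinal iN).
  split=> [nP t ti|k Vk t ti]; rewrite (gh (Ordinal iN))//; first exact: l1.
  exact: l2.
Qed.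

(** Over a cell off [P] each side already is [e \o f], which extends over the cell. Over a cell
    inside a patch the four sides lie in the preimage of the patch, which is fillable. *)
Lemma cell_lift (a c d : R) (f : R * R -> A) (g : R * R -> B)
    (Q := `[a, a + d] `*` `[c, c + d])
    (dQ := [set p | Q p /\ [\/ p.1 = a, p.1 = a + d, p.2 = c | p.2 = c + d]]) :
  0 < d -> {within Q, continuous f} -> small_on Q f ->
  {within dQ, continuous g} ->
  lifts_on ([set a] `*` `[c, c + d]) f g ->
  lifts_on ([set a + d] `*` `[c, c + d]) f g ->
  lifts_on (`[a, a + d] `*` [set c]) f g ->
  lifts_on (`[a, a + d] `*` [set c + d]) f g ->
  exists G : R * R -> B, {within Q, continuous G} /\
    forall p, dQ p -> G p = g p.
Proof.
move=> d0 fc sm gc [w1 V1] [w2 V2] [w3 V3] [w4 V4].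
have s1 : [set a] `*` `[c, c + d] `<=` Q.
  by case=> s t /= [-> h]; split => //=; rewrite in_itv /= lexx lerDl ltW.
have s2 : [set a + d] `*` `[c, c + d] `<=` Q.
  by case=> s t /= [-> h]; split => //=; rewrite in_itv /= lexx lerDl ltW.
have s3 : `[a, a + d] `*` [set c] `<=` Q.
  by case=> s t /= [h ->]; split => //=; rewrite in_itv /= lexx lerDl ltW.
have s4 : `[a, a + d] `*` [set c + d] `<=` Q.
  by case=> s t /= [h ->]; split => //=; rewrite in_itv /= lexx lerDl ltW.
case: sm => [nP|[k Vk]].
  exists (e \o f); split; first exact: section_within_continuous.
  case=> s t [] /[dup] Qp [/= h1 h2] [] /= est; apply/esym.
  - by apply: w1 => [p /s1|]; [exact: nP|].
  - by apply: w2 => [p /s2|]; [exact: nP|].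
  - by apply: w3 => [p /s3|]; [exact: nP|].
  - by apply: w4 => [p /s4|]; [exact: nP|].
apply: (fillable_rect d0 (collapse_fill col k) gc).
case=> s t [] /[dup] Qp [/= h1 h2] [] /= est.
- by apply: V1 => [p /s1|]; [exact: Vk|].
- by apply: V2 => [p /s2|]; [exact: Vk|].
- by apply: V3 => [p /s3|]; [exact: Vk|].
- by apply: V4 => [p /s4|]; [exact: Vk|].
Qed.

Lemma lifts_on_vertical (a : R) (E : set R) (f : R * R -> A) (g : R * R -> B)
    (l : R -> B) :
  (forall t, E t -> g (a, t) = l t) -> lifts_on E (fun t => f (a, t)) l ->
  lifts_on ([set a] `*` E) f g.
Proof.
move=> gl [h1 h2]; split=> [nP|k Vk] [s t] /= [-> Et]; rewrite gl//.
  by apply: h1 => // t' Et'; exact: nP.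
by apply: h2 => // t' Et'; exact: Vk.
Qed.

Lemma lifts_on_horizontal (a : R) (E : set R) (f : R * R -> A)
    (g : R * R -> B) (l : R -> B) :
  (forall s, E s -> g (s, a) = l s) -> lifts_on E (fun s => f (s, a)) l ->
  lifts_on (E `*` [set a]) f g.
Proof.
move=> gl [h1 h2]; split=> [nP|k Vk] [s t] /= [Es ->]; rewrite gl//.
  by apply: h1 => // t' Et'; exact: nP.
by apply: h2 => // t' Et'; exact: Vk.
Qed.

(** The proposition [bnd] marks the outer grid lines, on which the prescribed boundary map must be
    kept; a new lift is chosen only on inner lines. *)
Lemma gridline_lift (N : nat) (bnd : Prop) (f : R -> A) (g : R -> B)
    (v : nat -> B) :
  (0 < N)%N -> {within I, continuous f} ->
  (forall i, (i < N)%N -> small_on (gridcell N i) f) ->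
  (forall i, (i <= N)%N -> lifts_on [set grid N i] f (cst (v i))) ->
  (bnd -> [/\ {within I, continuous g},
    forall i, (i <= N)%N -> g (grid N i) = v i &
    forall i, (i < N)%N -> lifts_on (gridcell N i) f g]) ->
  exists l, [/\ {within I, continuous l},
    forall i, (i <= N)%N -> l (grid N i) = v i,
    forall i, (i < N)%N -> lifts_on (gridcell N i) f l &
    bnd -> l = g].
Proof.
move=> N0 fc sm vl gb; have [b|nb] := pselect bnd.
  by have [h1 h2 h3] := gb b; exists g; split.
by have [l [h1 h2 h3]] := path_lift N0 fc sm vl; exists l; split.
Qed.

Lemma grid_index (N i : nat) : (0 < N)%N -> (i <= N)%N ->
  exists i', [/\ (i' < N)%N & (i = i' \/ i = i'.+1)].
Proof.
move=> N0; rewrite leq_eqVlt => /orP[/eqP ->|iN]; last by exists i; split => //; left.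
by exists N.-1; rewrite prednK//; split => //; right.
Qed.

(** Skeleton by skeleton: vertices, grid lines, cells. On the boundary only the weak condition
    [lifts_on] is imposed instead of [q \o g = f]; surjectivity on fundamental groups depends on
    this weakening. *)
Lemma square_lift (N : nat) (f : R * R -> A) (g : R * R -> B) :
  (0 < N)%N -> {within @square R, continuous f} ->
  (forall i j, (i < N)%N -> (j < N)%N ->
    small_on (gridcell N i `*` gridcell N j) f) ->
  {within @square_boundary R, continuous g} ->
  (forall i j, @square_boundary R (grid N i, grid N j) ->
    lifts_on [set (grid N i, grid N j)] f g) ->
  (forall k i, k = 0%N \/ k = N -> (i < N)%N ->
    lifts_on (gridcell N i) (fun t => f (grid N k, t)) (fun t => g (grid N k, t)) /\
    lifts_on (gridcell N i) (fun s => f (s, grid N k)) (fun s => g (s, grid N k))) ->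
  exists G : R * R -> B, {within @square R, continuous G} /\
    forall p, @square_boundary R p -> G p = g p.
Proof.
move=> N0 fc sm gc gv gl.
have bnd1 k t : k = 0%N \/ k = N -> I t -> square_boundary (grid N k, t).
  move=> h It; split; first by split => //; apply: grid_in => //; case: h => ->.
  by case: h => ->; [apply: Or41; rewrite /= grid0|apply: Or42; rewrite /= gridN].
have bnd2 k t : k = 0%N \/ k = N -> I t -> square_boundary (t, grid N k).
  move=> h It; split; first by split => //; apply: grid_in => //; case: h => ->.
  by case: h => ->; [apply: Or43; rewrite /= grid0|apply: Or44; rewrite /= gridN].
(* Boundary vertices keep the value of [g]; inner ones are lifted by the section. *)
pose v i j := if pselect (@square_boundary R (grid N i, grid N j))
  then g (grid N i, grid N j) else e (f (grid N i, grid N j)).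
have vP i j : lifts_on [set (grid N i, grid N j)] f (cst (v i j)).
  rewrite /v; case: pselect => /= [b|_].
    have [h1 h2] := gv _ _ b.
    by split=> [nP|k Vk] _ ->; [exact: (h1 nP)|exact: (h2 _ Vk)].
  by apply: lift_lifts_on => _ ->; rewrite (collapse_sec col).
have pairc1 (a : R) : {within I, continuous (fun t : R => (a, t))}.
  by apply: within_continuous_pair; apply: continuous_subspaceT => z;
    [exact: cvg_cst|exact: cvg_id].
have pairc2 (a : R) : {within I, continuous (fun s : R => (s, a))}.
  by apply: within_continuous_pair; apply: continuous_subspaceT => z;
    [exact: cvg_id|exact: cvg_cst].
have /choice [lv lvP] : forall i : 'I_N.+1, exists l,
  [/\ {within I, continuous l},
    forall j, (j <= N)%N -> l (grid N j) = v i j,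
    forall j, (j < N)%N -> lifts_on (gridcell N j) (fun t => f (grid N i, t)) l &
    (i = 0%N :> nat \/ i = N :> nat) -> l = fun t => g (grid N i, t)].
  move=> i; apply: gridline_lift => //.
  - apply: (within_continuous_compW (pairc1 (grid N i)) fc) => t It.
    by split => //; apply: grid_in => //; rewrite -ltnS.
  - move=> j jN; have [i' [iN ei]] := grid_index N0 (ltn_ord i : (i <= N)%N).
    case: (sm _ _ iN jN) => [h|[k h]]; [left|right; exists k] => t ct;
      by apply: h; split => //; exact: gridcell_ends.
  - move=> j jN; have [h1 h2] := vP i j.
    by split=> [nP|k Vk] _ ->; [apply: h1|apply: h2] => // _ ->; [exact: nP|exact: Vk].
  - move=> h; split.
    + by apply: (within_continuous_compW (pairc1 (grid N i)) gc) => t; exact: bnd1.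
    + by move=> j jN; rewrite /v; case: pselect => //= -[]; apply: bnd1 => //; exact: grid_in.
    + by move=> j jN; have [] := gl _ _ h jN.
have /choice [lh lhP] : forall j : 'I_N.+1, exists l,
  [/\ {within I, continuous l},
    forall i, (i <= N)%N -> l (grid N i) = v i j,
    forall i, (i < N)%N -> lifts_on (gridcell N i) (fun s => f (s, grid N j)) l &
    (j = 0%N :> nat \/ j = N :> nat) -> l = fun s => g (s, grid N j)].
  move=> j; apply: (gridline_lift (v := v^~ j)) => //.
  - apply: (within_continuous_compW (pairc2 (grid N j)) fc) => t It.
    by split => //; apply: grid_in => //; rewrite -ltnS.
  - move=> i iN; have [j' [jN ej]] := grid_index N0 (ltn_ord j : (j <= N)%N).
    case: (sm _ _ iN jN) => [h|[k h]]; [left|right; exists k] => t ct;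
      by apply: h; split => //; exact: gridcell_ends.
  - move=> i iN; have [h1 h2] := vP i j.
    by split=> [nP|k Vk] _ ->; [apply: h1|apply: h2] => // _ ->; [exact: nP|exact: Vk].
  - move=> h; split.
    + by apply: (within_continuous_compW (pairc2 (grid N j)) gc) => t; exact: bnd2.
    + by move=> i iN; rewrite /v; case: pselect => //= -[]; apply: bnd2 => //; exact: grid_in.
    + by move=> i iN; have [] := gl _ _ h iN.
have /choice [G GP] : forall ij : 'I_N * 'I_N, exists G : R * R -> B,
  [/\ {within gridcell N ij.1 `*` gridcell N ij.2, continuous G},
    forall (k : 'I_N.+1) t, k = ij.1 :> nat \/ k = ij.1.+1 :> nat ->
      gridcell N ij.2 t -> G (grid N k, t) = lv k t &
    forall (k : 'I_N.+1) s, k = ij.2 :> nat \/ k = ij.2.+1 :> nat ->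
      gridcell N ij.1 s -> G (s, grid N k) = lh k s].
  case=> i j /=.
  pose i0 : 'I_N.+1 := inord i; pose i1 : 'I_N.+1 := inord i.+1.
  pose j0 : 'I_N.+1 := inord j; pose j1 : 'I_N.+1 := inord j.+1.
  have ei0 : i0 = i :> nat by rewrite inordK// ltnS ltnW.
  have ei1 : i1 = i.+1 :> nat by rewrite inordK// ltnS.
  have ej0 : j0 = j :> nat by rewrite inordK// ltnS ltnW.
  have ej1 : j1 = j.+1 :> nat by rewrite inordK// ltnS.
  have VH (k l : 'I_N.+1) : lv k (grid N l) = lh l (grid N k).
    have [_ h _ _] := lvP k; have [_ h' _ _] := lhP l.
    by rewrite h ?h'// -ltnS.
  have neq (k : nat) : grid N k = grid N k.+1 :> R -> False.
    by move=> /(grid_inj N0) /n_Sn.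
  (* The four sides of the cell: [b.1] tells the vertical sides from the horizontal ones, [b.2] the
     lower index from the upper one. *)
  pose w (b : bool * bool) : R * R -> B :=
    if b.1 then lv (if b.2 then i0 else i1) \o snd
    else lh (if b.2 then j0 else j1) \o fst.
  pose C (b : bool * bool) : set (R * R) :=
    if b.1 then [set grid N (if b.2 then i0 else i1)] `*` gridcell N j
    else gridcell N i `*` [set grid N (if b.2 then j0 else j1)].
  have c1 (A' : set (R * R)) : {within A', continuous (@fst R R)}.
    by apply: continuous_subspaceT => -[x y]; exact: cvg_fst.
  have c2 (A' : set (R * R)) : {within A', continuous (@snd R R)}.
    by apply: continuous_subspaceT => -[x y]; exact: cvg_snd.
  pose d : R := N%:R^-1.
  have d0 : 0 < d by rewrite invr_gt0 ltr0n.
  pose Q : set (R * R) :=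
    `[grid N i, grid N i + d] `*` `[grid N j, grid N j + d].
  pose dQ := [set p | Q p /\ [\/ p.1 = grid N i, p.1 = grid N i + d,
    p.2 = grid N j | p.2 = grid N j + d]].
  have QE : Q = gridcell N i `*` gridcell N j by rewrite /Q /d -!gridS.
  have clC b : closed (C b).
    rewrite /C; case: b.1; apply: closed_setX; try exact: gridcell_closed;
      exact/accessible_closed_set1/hausdorff_accessible/Rhausdorff.
  have dQC : dQ `<=` \bigcup_b C b.
    case=> s t []; rewrite QE => -[/= h1 h2]; rewrite /d -!gridS// => -[] /= est.
    - by exists (true, true) => //; split => //=; rewrite ei0.
    - by exists (true, false) => //; split => //=; rewrite ei1.
    - by exists (false, true) => //; split => //=; rewrite ej0.
    - by exists (false, false) => //; split => //=; rewrite ej1.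
  have wc b : {within C b, continuous (w b)}.
    rewrite /C /w; case: b => -[] b /=.
      have [lc _ _ _] := lvP (if b then i0 else i1).
      apply: (within_continuous_compW (c2 _) lc) => -[s t] /= [_].
      exact: gridcell_sub.
    have [lc _ _ _] := lhP (if b then j0 else j1).
    apply: (within_continuous_compW (c1 _) lc) => -[s t] /= [+ _].
    exact: gridcell_sub.
  have ww b b' p : C b p -> C b' p -> w b p = w b' p.
    rewrite /C /w; case: b => -[] b; case: b' => -[] b'; case: p => s t /=.
    - move=> [-> _] [+ _].
      by case: b; case: b' => //; rewrite ei0 ei1 => E; case: (neq i).
    - by move=> [-> _] [_ ->]; rewrite VH.
    - by move=> [_ ->] [-> _]; rewrite VH.
    - move=> [_ ->] [_ +].
      by case: b; case: b' => //; rewrite ej0 ej1 => E; case: (neq j).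
  have [g' [g'c g'w]] := glue_exists g clC dQC wc ww.
  have g'v (b : bool) t : gridcell N j t ->
      g' (grid N (if b then i0 else i1), t) = lv (if b then i0 else i1) t.
    by move=> ct; rewrite (g'w (true, b)).
  have g'h (b : bool) s : gridcell N i s ->
      g' (s, grid N (if b then j0 else j1)) = lh (if b then j0 else j1) s.
    by move=> cs; rewrite (g'w (false, b)).
  have [|||||||G [Gc Gg]] := @cell_lift (grid N i) (grid N j) d f g' d0.
  - rewrite -/Q QE; apply: continuous_subspaceW fc => -[s t] /= [h1 h2].
    by split; [apply: gridcell_sub h1|apply: gridcell_sub h2].
  - by rewrite -/Q QE; exact: sm.
  - exact: g'c.
  - rewrite /d -gridS// -ei0; apply: (lifts_on_vertical (g'v true)).
    by have [_ _ + _] := lvP i0; exact.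
  - rewrite /d -!gridS// -ei1; apply: (lifts_on_vertical (g'v false)).
    by have [_ _ + _] := lvP i1; exact.
  - rewrite /d -gridS// -ej0; apply: (lifts_on_horizontal (g'h true)).
    by have [_ _ + _] := lhP j0; exact.
  - rewrite /d -!gridS// -ej1; apply: (lifts_on_horizontal (g'h false)).
    by have [_ _ + _] := lhP j1; exact.
  exists G; split.
  - by rewrite -QE.
  - move=> k t kij ct; have [kb|kb] : k = i0 \/ k = i1.
      by case: kij => kE; [left|right]; apply: val_inj; rewrite /= kE.
    + rewrite kb -(g'v true)//; apply: Gg; split; last by apply: Or41; rewrite /= ei0.
      by rewrite -/Q QE; split => //=; rewrite ei0; apply: gridcell_ends; [|left].
    + rewrite kb -(g'v false)//; apply: Gg; split;
      last by apply: Or42; rewrite /= ei1 gridS.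
      by rewrite -/Q QE; split => //=; rewrite ei1; apply: gridcell_ends; [|right].
  - move=> k s kij cs; have [kb|kb] : k = j0 \/ k = j1.
      by case: kij => kE; [left|right]; apply: val_inj; rewrite /= kE.
    + rewrite kb -(g'h true)//; apply: Gg; split; last by apply: Or43; rewrite /= ej0.
      by rewrite -/Q QE; split => //=; rewrite ej0; apply: gridcell_ends; [|left].
    + rewrite kb -(g'h false)//; apply: Gg; split;
      last by apply: Or44; rewrite /= ej1 gridS.
      by rewrite -/Q QE; split => //=; rewrite ej1; apply: gridcell_ends; [|right].
have [||||H [Hc HG]] := @glue_exists _ _ _ (@square R)
  (fun ij : 'I_N * 'I_N => gridcell N ij.1 `*` gridcell N ij.2) G g.
- by move=> ij; apply: closed_setX; exact: gridcell_closed.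
- case=> s t [/= /(gridcell_cover N0) [i _ si] /(gridcell_cover N0) [j _ tj]].
  by exists (i, j).
- by move=> ij; have [] := GP ij.
(* A point common to two distinct cells lies on a grid line, where both fillings equal the lift
   chosen for that line. *)
- move=> [i j] [i' j'] [s t] /= [si tj] [si' tj'].
  have [_ h1 h2] := GP (i, j); have [_ h1' h2'] := GP (i', j').
  have [ii|[k [sk ki ki']]] := gridcell_meet N0 si si'; last first.
    have kN : (k < N.+1)%N by rewrite ltnS; case: ki => ->; [exact: ltnW|].
    by rewrite sk (h1 (Ordinal kN))// (h1' (Ordinal kN)).
  have [jj|[k [tk kj kj']]] := gridcell_meet N0 tj tj'; last first.
    have kN : (k < N.+1)%N by rewrite ltnS; case: kj => ->; [exact: ltnW|].
    by rewrite tk (h2 (Ordinal kN))// (h2' (Ordinal kN)).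
  by congr (G (_, _) _); exact: val_inj.
exists H; split => // -[s t] [[/= Is It] h].
have side1 k : k = 0%N \/ k = N -> H (grid N k, t) = g (grid N k, t).
  move=> k0N; have kN : (k < N.+1)%N by case: k0N => ->.
  have [i [iN ki]] := grid_index N0 (kN : (k <= N)%N).
  have [j _ tj] := gridcell_cover N0 It.
  rewrite (HG (Ordinal iN, j)) /=; last by split => //; exact: gridcell_ends.
  have [_ h1 _] := GP (Ordinal iN, j); rewrite (h1 (Ordinal kN))//.
  by have [_ _ _ ->] := lvP (Ordinal kN).
have side2 k : k = 0%N \/ k = N -> H (s, grid N k) = g (s, grid N k).
  move=> k0N; have kN : (k < N.+1)%N by case: k0N => ->.
  have [j [jN kj]] := grid_index N0 (kN : (k <= N)%N).
  have [i _ si] := gridcell_cover N0 Is.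
  rewrite (HG (i, Ordinal jN)) /=; last by split => //; exact: gridcell_ends.
  have [_ _ h2] := GP (i, Ordinal jN); rewrite (h2 (Ordinal kN))//.
  by have [_ _ _ ->] := lhP (Ordinal kN).
case: h => /= ->.
- by rewrite -(grid0 R N) side1//; left.
- by rewrite -(gridN R N0) side1//; right.
- by rewrite -(grid0 R N) side2//; left.
- by rewrite -(gridN R N0) side2//; right.
Qed.

End Lifting.

(** * Fundamental groups *)

Lemma compact_quotient_exists (S T U : topologicalType) (K : set S)
    (f : S -> T) (h : S -> U) (dflt : T -> U) :
  hausdorff_space T -> compact K ->
  {within K, continuous f} -> {within K, continuous h} ->
  (forall z z', K z -> K z' -> f z = f z' -> h z = h z') ->
  exists g, {within f @` K, continuous g} /\ forall z, K z -> g (f z) = h z.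
Proof.
move=> hT cK fc hc fib.
pose g x := if pselect (exists z, K z /\ f z = x) is left w then h (sval (cid w))
            else dflt x.
have gfh z : K z -> g (f z) = h z.
  move=> Kz; rewrite /g; case: pselect => [w|[]]; last by exists z.
  by case: cid => z' /= [Kz' e]; exact: fib.
by exists g; split => //; exact: compact_quotient_continuous gfh.
Qed.

Section Filling.
Variable R : realType.
Local Notation I := (@I01 R).
Local Notation square := (@square R).
Local Notation square_boundary := (@square_boundary R).

(** The nearest-point retraction of the line onto the unit interval, written with absolute values so
    that continuity is immediate. *)
Definition clamp (u : R) : R := (`|u| - `|u - 1| + 1) / 2.

Lemma clamp_le0 u : u <= 0 -> clamp u = 0.
Proof. by move=> u0; rewrite /clamp !ler0_norm ?subr_le0; lra. Qed.
Lemma clamp_id u : 0 <= u <= 1 -> clamp u = u.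
Proof.
by move=> /andP[u0 u1]; rewrite /clamp ger0_norm// ler0_norm ?subr_le0//; lra.
Qed.
Lemma clamp_ge1 u : 1 <= u -> clamp u = 1.
Proof. by move=> u1; rewrite /clamp !ger0_norm ?subr_ge0//; lra. Qed.

Lemma clamp_in u : 0 <= clamp u <= 1.
Proof.
have [h|/ltW h] := leP u 0; first by rewrite clamp_le0// lexx ler01.
have [h1|/ltW h1] := leP u 1; first by rewrite clamp_id ?h.
by rewrite clamp_ge1// lexx ler01.
Qed.

Lemma clamp_continuous : continuous clamp.
Proof.
move=> u; apply: cvgM; last exact: cvg_cst.
apply: cvgD; last exact: cvg_cst.
apply: cvgB; first by apply: cvg_norm; exact: cvg_id.
by apply: cvg_norm; apply: cvgB; [exact: cvg_id|exact: cvg_cst].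
Qed.

(* Runs once around the boundary of the unit square, starting at the origin. *)
Definition perimeter (t : R) : R * R :=
  (clamp (4 * t) - clamp (4 * t - 2), clamp (4 * t - 1) - clamp (4 * t - 3)).

Lemma perimeter_continuous : continuous perimeter.
Proof.
have cc a b : continuous (fun t : R => clamp (a * t - b)).
  move=> t; apply: (@continuous_comp _ _ _ (fun t : R => a * t - b) clamp);
    last exact: clamp_continuous.
  apply: cvgB; last exact: cvg_cst.
  by apply: cvgM; [exact: cvg_cst|exact: cvg_id].
have c0 : continuous (fun t : R => clamp (4 * t)).
  by have := cc 4 0; under eq_fun do rewrite subr0.
by apply: continuous_pair => t; apply: cvgB; [exact: c0|exact: cc|exact: cc|exact: cc].
Qed.

Variant perimeter_spec (t : R) : R * R -> Prop :=
| Perimeter1 of 0 <= t <= 1/4 : perimeter_spec t (4 * t, 0)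
| Perimeter2 of 1/4 <= t <= 1/2 : perimeter_spec t (1, 4 * t - 1)
| Perimeter3 of 1/2 <= t <= 3/4 : perimeter_spec t (3 - 4 * t, 1)
| Perimeter4 of 3/4 <= t <= 1 : perimeter_spec t (0, 4 - 4 * t).

Lemma perimeterP t : I t -> perimeter_spec t (perimeter t).
Proof.
move=> /I01P /andP[t0 t1]; rewrite /perimeter.
have [h1|h1] := leP t (1/4).
  rewrite clamp_id; last by apply/andP; split; lra.
  rewrite (@clamp_le0 (4 * t - 2)); last by lra.
  rewrite (@clamp_le0 (4 * t - 1)); last by lra.
  rewrite (@clamp_le0 (4 * t - 3)); last by lra.
  by rewrite !subr0; apply: Perimeter1; rewrite t0.
have [h2|h2] := leP t (1/2).
  rewrite clamp_ge1; last by lra.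
  rewrite (@clamp_le0 (4 * t - 2)); last by lra.
  rewrite (@clamp_id (4 * t - 1)); last by apply/andP; split; lra.
  rewrite (@clamp_le0 (4 * t - 3)); last by lra.
  by rewrite !subr0; apply: Perimeter2; rewrite h2 ltW.
have [h3|h3] := leP t (3/4).
  rewrite clamp_ge1; last by lra.
  rewrite (@clamp_id (4 * t - 2)); last by apply/andP; split; lra.
  rewrite (@clamp_ge1 (4 * t - 1)); last by lra.
  rewrite (@clamp_le0 (4 * t - 3)); last by lra.
  have -> : 1 - (4 * t - 2) = 3 - 4 * t by lra.
  by rewrite subr0; apply: Perimeter3; rewrite h3 ltW.
rewrite clamp_ge1; last by lra.
rewrite (@clamp_ge1 (4 * t - 2)); last by lra.
rewrite (@clamp_ge1 (4 * t - 1)); last by lra.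
rewrite (@clamp_id (4 * t - 3)); last by apply/andP; split; lra.
have -> : 1 - (4 * t - 3) = 4 - 4 * t by lra.
by rewrite subrr; apply: Perimeter4; rewrite t1 ltW.
Qed.

Lemma perimeter0 : perimeter 0 = (0, 0).
Proof. by rewrite /perimeter !clamp_le0 ?subrr//; lra. Qed.

Lemma perimeter1 : perimeter 1 = (0, 0).
Proof. by rewrite /perimeter !clamp_ge1 ?subrr//; lra. Qed.

Lemma perimeter_in t : I t -> square_boundary (perimeter t).
Proof.
move=> /perimeterP[] /andP[h1 h2];
  (split; first by split; apply/I01P => /=; apply/andP; split; lra).
- by apply: Or43.
- by apply: Or42.
- by apply: Or44.
- by apply: Or41.
Qed.

Lemma perimeter_surj p : square_boundary p -> exists2 t, I t & perimeter t = p.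
Proof.
case: p => x y [[/I01P /= /andP[x0 x1] /I01P /= /andP[y0 y1]]] /= h.
have ex t : I t -> (forall q, perimeter_spec t q -> q = (x, y)) ->
    exists2 t, I t & perimeter t = (x, y).
  by move=> It H; exists t => //; exact/H/perimeterP.
case: h => e.
- apply: (ex (1 - y / 4)); first by apply/I01P/andP; split; lra.
  by move=> q [] /andP[h1 h2]; congr pair; lra.
- apply: (ex ((1 + y) / 4)); first by apply/I01P/andP; split; lra.
  by move=> q [] /andP[h1 h2]; congr pair; lra.
- apply: (ex (x / 4)); first by apply/I01P/andP; split; lra.
  by move=> q [] /andP[h1 h2]; congr pair; lra.
- apply: (ex ((3 - x) / 4)); first by apply/I01P/andP; split; lra.
  by move=> q [] /andP[h1 h2]; congr pair; lra.
Qed.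

Lemma perimeter_inj t t' : I t -> I t' -> perimeter t = perimeter t' ->
  t = t' \/ (t = 0 \/ t = 1) /\ (t' = 0 \/ t' = 1).
Proof.
move=> It It'; case: (perimeterP It) => /andP[h1 h2];
  case: (perimeterP It') => /andP[h3 h4] [] *; try (by left; lra).
- by right; split; [left|right]; lra.
- by right; split; [right|left]; lra.
Qed.

(** Polar coordinates on the square about its centre: [p.2] runs round the perimeter, and [p.1] goes
    from 0 on the boundary to 1 at the centre. They turn a null-homotopy of the perimeter loop into
    a filling. *)
Definition cone (p : R * R) : R * R :=
  (1/2 + (1 - p.1) * ((perimeter p.2).1 - 1/2),
   1/2 + (1 - p.1) * ((perimeter p.2).2 - 1/2)).

Lemma cone_continuous : continuous cone.
Proof.
have pc : continuous (fun p : R * R => perimeter p.2).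
  move=> p; apply: (@continuous_comp _ _ _ snd perimeter); first exact: cvg_snd.
  exact: perimeter_continuous.
have c1 : continuous (fun p : R * R => (perimeter p.2).1).
  by move=> p; apply: (@continuous_comp _ _ _ (fun p : R * R => perimeter p.2) fst);
    [exact: pc|exact: cvg_fst].
have c2 : continuous (fun p : R * R => (perimeter p.2).2).
  by move=> p; apply: (@continuous_comp _ _ _ (fun p : R * R => perimeter p.2) snd);
    [exact: pc|exact: cvg_snd].
apply: continuous_pair => p; apply: cvgD; try exact: cvg_cst; apply: cvgM.
- by apply: cvgB; [exact: cvg_cst|exact: cvg_fst].
- by apply: cvgB; [exact: c1|exact: cvg_cst].
- by apply: cvgB; [exact: cvg_cst|exact: cvg_fst].
- by apply: cvgB; [exact: c2|exact: cvg_cst].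
Qed.

(** A boundary point has sup-norm distance exactly 1/2 from the centre, so the factor [1 - p.1] can
    be read off the image and, when nonzero, cancelled. *)
Lemma cone_fibre p p' : square p -> square p' -> cone p = cone p' ->
  p.1 = p'.1 /\ (p.1 = 1 \/ perimeter p.2 = perimeter p'.2).
Proof.
case: p p' => [s t] [s' t'] [/= /I01P /andP[s0 s1] It] [/= /I01P /andP[s0' s1'] It'].
rewrite /cone /= => -[/addrI e1 /addrI e2].
have half (a : R) (u : R) : 0 <= a -> I u ->
    [/\ - (a / 2) <= a * ((perimeter u).1 - 1/2) <= a / 2,
        - (a / 2) <= a * ((perimeter u).2 - 1/2) <= a / 2 &
        [\/ a * ((perimeter u).1 - 1/2) = a / 2,
            a * ((perimeter u).1 - 1/2) = - (a / 2),
            a * ((perimeter u).2 - 1/2) = a / 2 |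
            a * ((perimeter u).2 - 1/2) = - (a / 2)]].
  move=> a0 Iu; case: (perimeterP Iu) => /andP[h1 h2] /=; split;
    try (by apply/andP; split; nra).
  - by apply: Or44; lra.
  - by apply: Or41; lra.
  - by apply: Or43; lra.
  - by apply: Or42; lra.
have es : s = s'.
  have [|/andP[k1 k2] /andP[k3 k4] h] := @half (1 - s) t _ It; first by rewrite subr_ge0.
  have [|/andP[k1' k2'] /andP[k3' k4'] h'] := @half (1 - s') t' _ It';
    first by rewrite subr_ge0.
  rewrite e1 in h k1 k2; rewrite e2 in h k3 k4.
  move: h h' k1 k2 k3 k4 k1' k2' k3' k4'.
  set b1 := (1 - s') * _; set b2 := (1 - s') * _.
  move=> h h' k1 k2 k3 k4 k1' k2' k3' k4'.
  have : (1 - s) / 2 = (1 - s') / 2.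
    by case: h => E; case: h' => E'; lra.
  by lra.
split => //; have [->|ns] := eqVneq s 1; first by left.
right; rewrite -es in e1 e2; have sn : 1 - s != 0 by rewrite subr_eq0 eq_sym.
by apply: injective_projections; [move: e1|move: e2] => /(mulfI sn)/addIr.
Qed.

Lemma cone_surj p : square p -> exists2 z, square z & cone z = p.
Proof.
case: p => x y [/= /I01P /andP[x0 x1] /I01P /andP[y0 y1]].
have key (r : R) (b : R * R) : 0 <= r <= 1 -> square_boundary b ->
    x = 1/2 + r * (b.1 - 1/2) -> y = 1/2 + r * (b.2 - 1/2) ->
    exists2 z, square z & cone z = (x, y).
  move=> /andP[r0 r1] /perimeter_surj[t It <-] -> ->; exists (1 - r, t).
    by split => //; apply/I01P => /=; apply/andP; split; lra.
  by rewrite /cone /= subKr.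
have [r0|rn0] := eqVneq (Num.max `|x - 1/2| `|y - 1/2|) 0.
  have [] : `|x - 1/2| <= 0 /\ `|y - 1/2| <= 0 by rewrite -!r0 !le_max !lexx orbT.
  rewrite !normr_le0 => /eqP ex /eqP ey.
  apply: (key 0 (0, 0)); [by rewrite lexx ler01| |rewrite /=; lra|rewrite /=; lra].
  by rewrite -perimeter0; apply: perimeter_in; apply/I01P; rewrite lexx ler01.
set r := Num.max _ _ in rn0.
have rpos : 0 < r by rewrite lt_neqAle eq_sym rn0 le_max normr_ge0.
have [xr yr] : `|x - 1/2| <= r /\ `|y - 1/2| <= r by rewrite /r !le_max !lexx orbT.
have r2 : r <= 1/2 by rewrite /r ge_max !ler_norml; apply/andP; split; apply/andP; split; lra.
have rE : `|x - 1/2| = r \/ `|y - 1/2| = r.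
  by rewrite /r; case: (leP `|x - 1/2| `|y - 1/2|) => _; [right|left].
(* As [r] is the sup-norm distance to the centre, the radial projection of the point has a
   coordinate equal to 0 or 1, and [2 * r] is the factor that scales it back. *)
apply: (key (2 * r) (1/2 + (x - 1/2) / (2 * r), 1/2 + (y - 1/2) / (2 * r))).
- by apply/andP; split; lra.
- have bd (z : R) : `|z - 1/2| <= r -> I (1/2 + (z - 1/2) / (2 * r)).
    rewrite ler_norml => /andP[z0 z1]; apply/I01P.
    have h1 : (z - 1/2) / (2 * r) <= 1/2 by rewrite ler_pdivrMr; lra.
    have h2 : - (1/2) <= (z - 1/2) / (2 * r) by rewrite ler_pdivlMr; lra.
    by apply/andP; split; lra.
  split; first by split; exact: bd.
  have bE (z : R) : `|z - 1/2| = r ->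
      1/2 + (z - 1/2) / (2 * r) = 0 \/ 1/2 + (z - 1/2) / (2 * r) = 1.
    case: (leP 0 (z - 1/2)) => hz; rewrite ?(ger0_norm hz) ?(ltr0_norm hz) => E.
      by right; rewrite E; field; rewrite rn0.
    by left; rewrite -[z - 1/2]opprK E; field; rewrite rn0.
  by case: rE => /bE[] e; [apply: Or41|apply: Or42|apply: Or43|apply: Or44].
- by rewrite /=; field; rewrite rn0.
- by rewrite /=; field; rewrite rn0.
Qed.

End Filling.

Section FundamentalGroup.
Variable R : realType.
Local Notation I := (@I01 R).
Local Notation square := (@square R).
Local Notation square_boundary := (@square_boundary R).
Local Notation perimeter := (@perimeter R).
Local Notation cone := (@cone R).

(** A based null-homotopy of the perimeter loop is constant on the fibres of [cone], so it descends
    along this quotient map to the square. *)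
Lemma simply_connected_fillable (T : topologicalType) :
  simply_connected R T -> fillable R [set: T].
Proof.
move=> [_ sc] g gc _.
have pc : {within I, continuous perimeter}.
  by apply: continuous_subspaceT; exact: perimeter_continuous.
have I0 : I 0 by apply/I01P; rewrite lexx ler01.
have I1 : I 1 by apply/I01P; rewrite lexx ler01.
have lg : loop (g (0, 0)) (g \o perimeter).
  split; rewrite /= ?perimeter0 ?perimeter1//.
  by apply: (within_continuous_compW pc gc) => t; exact: perimeter_in.
have [H [Hc H0 H1 Hs]] := sc _ _ lg.
have cc : {within square, continuous cone}.
  by apply: continuous_subspaceT; exact: cone_continuous.
have hR2 : hausdorff_space (R * R)%type by exact: norm_hausdorff.
have [|G [Gc GH]] := compact_quotient_exists g hR2 (@compact_square R) cc Hc.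
  move=> [s t] [s' t'] sp sp' E; have [/= es] := cone_fibre sp sp' E; subst s'.
  case: sp => /= _ It; case: sp' => /= Is It'.
  case=> [->|/(perimeter_inj It It')]; first by rewrite !H1.
  case=> [->//|[tt tt']]; have [h0 h1] := Hs _ Is.
  by case: tt => ->; case: tt' => ->; rewrite ?h0 ?h1.
exists G; split.
  apply: (@continuous_subspaceW _ _ _ _ _ _ Gc) => p /cone_surj[z sz <-].
  by exists z.
move=> p /perimeter_surj[t It <-].
have e : cone (0, t) = perimeter t.
  by rewrite [RHS]surjective_pairing /cone; congr pair; rewrite /=; ring.
by rewrite -{1}e GH ?H0//; split.
Qed.

Lemma simply_connected_image (T B : topologicalType) (th : T -> B)
    (rho : B -> T) :
  simply_connected R T -> continuous th -> {within range th, continuous rho} ->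
  cancel th rho -> path_joined R (range th) /\ fillable R (range th).
Proof.
move=> scT thc rhoc thK; split.
  move=> _ _ [x _ <-] [y _ <-]; have [g [gc g0 g1]] := scT.1.2 x y.
  exists (th \o g); split; rewrite /= ?g0 ?g1//.
    apply: (within_continuous_compW (B := setT) gc) => //.
    exact: continuous_subspaceT.
  by move=> t _; exists (g t).
move=> g gc gW.
have [||G [Gc Gg]] := simply_connected_fillable scT (g := rho \o g).
- exact: within_continuous_compW gc rhoc gW.
- by [].
exists (th \o G); split.
  apply: (within_continuous_compW (B := setT) Gc) => //.
  exact: continuous_subspaceT.
move=> p bp; rewrite /= Gg//=; have [x _ <-] := gW _ bp.
by rewrite thK.
Qed.

Section Homotopies.
Variables (T : topologicalType) (x : T).
Implicit Types g h k : R -> T.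

Lemma I01_0 : I 0. Proof. by apply/I01P; rewrite lexx ler01. Qed.
Lemma I01_1 : I 1. Proof. by apply/I01P; rewrite lexx ler01. Qed.

Lemma fst_within (A : set (R * R)) : {within A, continuous (@fst R R)}.
Proof. by apply: continuous_subspaceT => -[a b]; exact: cvg_fst. Qed.

Lemma snd_within (A : set (R * R)) : {within A, continuous (@snd R R)}.
Proof. by apply: continuous_subspaceT => -[a b]; exact: cvg_snd. Qed.

Lemma loop_homotopic_refl g : loop x g -> homotopic x g g.
Proof.
move=> [gc g0 g1]; exists (g \o snd); split => //.
by apply: (within_continuous_compW (@snd_within _) gc) => p [].
Qed.

Lemma homotopic_sym g h : homotopic x g h -> homotopic x h g.
Proof.
move=> [H [Hc H0 H1 Hs]].
pose r (p : R * R) := (-1 * p.1 + 1, p.2).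
exists (H \o r); split => /=.
- apply: (within_continuous_compW _ Hc) => [|p [/I01P /andP[a b] I2]].
    apply: within_continuous_pair; last exact: snd_within.
    exact/continuous_affine_within/fst_within.
  by split => //; apply/I01P => /=; apply/andP; split; lra.
- by move=> t It; rewrite /r /= mulr0 add0r H1.
- by move=> t It; rewrite /r /= mulr1 addNr H0.
- move=> s /I01P /andP[a b]; apply: Hs; apply/I01P => /=.
  by apply/andP; split; lra.
Qed.

Lemma homotopic_trans g h k :
  homotopic x g h -> homotopic x h k -> homotopic x g k.
Proof.
move=> [H [Hc H0 H1 Hs]] [K [Kc K0 K1 Ks]].
pose u (p : R * R) := (2 * p.1 + 0, p.2).
pose v (p : R * R) := (2 * p.1 + -1, p.2).
pose L (p : R * R) := if p.1 <= 2^-1 then H (u p) else K (v p).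
pose C (b : bool) : set (R * R) :=
  (if b then `[0, 2^-1]%classic else `[2^-1, 1]%classic) `*` I.
have Cu p : C true p -> square (u p).
  case: p => s t; rewrite /C /= in_itv /= => -[/andP[a b] It]; split => //.
  by apply/I01P => /=; apply/andP; split; lra.
have Cv p : C false p -> square (v p).
  case: p => s t; rewrite /C /= in_itv /= => -[/andP[a b] It]; split => //.
  by apply/I01P => /=; apply/andP; split; lra.
have uc A : {within A, continuous u}.
  apply: within_continuous_pair; last exact: snd_within.
  exact/continuous_affine_within/fst_within.
have vc A : {within A, continuous v}.
  apply: within_continuous_pair; last exact: snd_within.
  exact/continuous_affine_within/fst_within.
exists L; split => /=.
- apply: (within_cover_continuous (C := C)
    (g := fun b => if b then H \o u else K \o v)).
  + by move=> b; apply: closed_setX; [case: b; exact: closed_itv_cc|exact: closed_itv_cc].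
  + case=> s t [/= /I01P /andP[a b] It].
    by case: (leP s 2^-1) => hs; [exists true|exists false] => //; split => //=;
      rewrite in_itv /= ?a ?hs ?(ltW hs).
  + by case; [exact: within_continuous_compW Hc Cu|exact: within_continuous_compW Kc Cv].
  + case=> -[s t]; rewrite /L /C /= in_itv /= => -[/andP[a b] It].
      by rewrite b.
    case: leP => // h_s; have -> : s = 2^-1 by apply/eqP; rewrite eq_le h_s.
    rewrite /u /v /= mulfV// addr0 subrr H1// K0//.
- by move=> t It; rewrite /L /u /= mulr0 addr0 invr_ge0 ler0n H0.
- move=> t It; rewrite /L /v /= ifF; last by apply/negbTE; rewrite -ltNge; lra.
  by rewrite mulr1 -K1//; congr (K (_, _)); lra.
- move=> s /I01P /andP[a b]; rewrite /L /u /v /=.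
  by case: leP => hs; [apply: Hs|apply: Ks]; apply/I01P; apply/andP; split; lra.
Qed.

Lemma loop_concat_loop g h : loop x g -> loop x h -> loop x (loop_concat g h).
Proof.
move=> [gc g0 g1] [hc h0 h1]; rewrite /loop_concat; split; last first.
- rewrite ifF; last by apply/negbTE; rewrite -ltNge; lra.
  by rewrite -h1; congr (h _); lra.
- by rewrite invr_ge0 ler0n mulr0.
pose u (t : R) := 2 * t + 0.
pose v (t : R) := 2 * t + -1.
pose C (b : bool) : set R := if b then `[0, 2^-1]%classic else `[2^-1, 1]%classic.
have Cu t : C true t -> I (u t).
  rewrite /C /= in_itv /= => /andP[a b].
  by apply/I01P => /=; apply/andP; split; rewrite /u; lra.
have Cv t : C false t -> I (v t).
  rewrite /C /= in_itv /= => /andP[a b].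
  by apply/I01P => /=; apply/andP; split; rewrite /v; lra.
have uc A : {within A, continuous u}.
  by apply: continuous_affine_within; apply: continuous_subspaceT => z; exact: cvg_id.
have vc A : {within A, continuous v}.
  by apply: continuous_affine_within; apply: continuous_subspaceT => z; exact: cvg_id.
apply: (within_cover_continuous (C := C)
    (g := fun b => if b then g \o u else h \o v)).
- by case; exact: closed_itv_cc.
- move=> s /= /I01P /andP[a b].
  by case: (leP s 2^-1) => h'; [exists true|exists false] => //=;
      rewrite in_itv /= ?a ?h' ?(ltW h').
- by case; [exact: within_continuous_compW gc Cu|exact: within_continuous_compW hc Cv].
- case=> s; rewrite /C /= in_itv /= => /andP[a b].
    by rewrite b /u addr0.
  rewrite /u /v; case: leP => // h'; have -> : s = 2^-1 by apply/eqP; rewrite eq_le h'.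
  by rewrite mulfV// subrr g1 h0.
Qed.

Lemma homotopic_concat g g' h h' :
  homotopic x g g' -> homotopic x h h' ->
  homotopic x (loop_concat g h) (loop_concat g' h').
Proof.
move=> [H [Hc H0 H1 Hs]] [K [Kc K0 K1 Ks]].
pose u (p : R * R) := (p.1, 2 * p.2 + 0).
pose v (p : R * R) := (p.1, 2 * p.2 + -1).
pose L (p : R * R) := if p.2 <= 2^-1 then H (u p) else K (v p).
pose C (b : bool) : set (R * R) :=
  I `*` (if b then `[0, 2^-1]%classic else `[2^-1, 1]%classic).
have Cu p : C true p -> square (u p).
  case: p => s t; rewrite /C /= in_itv /= => -[It /andP[a b]]; split => //.
  by apply/I01P => /=; apply/andP; split; lra.
have Cv p : C false p -> square (v p).
  case: p => s t; rewrite /C /= in_itv /= => -[It /andP[a b]]; split => //.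
  by apply/I01P => /=; apply/andP; split; lra.
have uc A : {within A, continuous u}.
  apply: within_continuous_pair; first exact: fst_within.
  exact/continuous_affine_within/snd_within.
have vc A : {within A, continuous v}.
  apply: within_continuous_pair; first exact: fst_within.
  exact/continuous_affine_within/snd_within.
exists L; split => /=.
- apply: (within_cover_continuous (C := C)
    (g := fun b => if b then H \o u else K \o v)).
  + by move=> b; apply: closed_setX; [exact: closed_itv_cc|case: b; exact: closed_itv_cc].
  + case=> s t [/= It /I01P /andP[a b]].
    by case: (leP t 2^-1) => h0; [exists true|exists false] => //; split => //=;
      rewrite in_itv /= ?a ?h0 ?(ltW h0).
  + by case; [exact: within_continuous_compW Hc Cu|exact: within_continuous_compW Kc Cv].
  + case=> -[s t]; rewrite /L /C /= in_itv /= => -[It /andP[a b]].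
      by rewrite b.
    case: leP => // h0; have -> : t = 2^-1 by apply/eqP; rewrite eq_le h0.
    rewrite /u /v /= mulfV// addr0 subrr.
    by have [_ ->] := Hs _ It; have [-> _] := Ks _ It.
- move=> t /I01P /andP[a b]; rewrite /L /u /v /loop_concat /=.
  by case: leP => h0; rewrite ?addr0;
    [apply: H0|apply: K0]; apply/I01P; apply/andP; split; lra.
- move=> t /I01P /andP[a b]; rewrite /L /u /v /loop_concat /=.
  by case: leP => h0; rewrite ?addr0;
    [apply: H1|apply: K1]; apply/I01P; apply/andP; split; lra.
- move=> s Is; rewrite /L /u /v /= mulr0 addr0 invr_ge0 ler0n; split.
    by have [] := Hs _ Is.
  rewrite ifF; last by apply/negbTE; rewrite -ltNge; lra.
  by have [_ <-] := Ks _ Is; congr (K (_, _)); lra.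
Qed.

Lemma pi1_class_eq g h : homotopic x g h -> pi1_class x g = pi1_class x h.
Proof.
move=> gh; apply/seteqP; split=> k [lk hk]; split => //.
  exact: homotopic_trans (homotopic_sym gh) hk.
exact: homotopic_trans gh hk.
Qed.

Lemma pi1_class_inj g h : loop x h -> pi1_class x g = pi1_class x h ->
  homotopic x g h.
Proof.
move=> lh E; have : pi1_class x h h by split => //; exact: loop_homotopic_refl.
by rewrite -E => -[].
Qed.

Lemma pi1_mul_class g h : loop x g -> loop x h ->
  pi1_mul x (pi1_class x g) (pi1_class x h) = pi1_class x (loop_concat g h).
Proof.
move=> lg lh; apply/seteqP; split.
  move=> k [g' [lg' gg'] [h' [lh' hh']]].
  by rewrite -(pi1_class_eq (homotopic_concat gg' hh')).
move=> k kc; exists g; first by split => //; exact: loop_homotopic_refl.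
by exists h => //; split => //; exact: loop_homotopic_refl.
Qed.

End Homotopies.

End FundamentalGroup.

(** Lifting along this identity collapse is what produces homotopies in [A]; for that the patches
    themselves, and not only their preimages, have to be 1-connected. *)
Lemma collapse_id (R : realType) (B A : topologicalType) (J : Type)
    (q : B -> A) (e : A -> B) (P : set A) (V : J -> set A) :
  collapse R q e P V ->
  (forall k, path_joined R (V k) /\ fillable R (V k)) ->
  collapse R (@id A) id P V.
Proof.
move=> col VP; split => //.
- by move=> a; exact: cvg_id.
- by move=> a _; exact: cvg_id.
- exact: (collapse_disj col).
- exact: (collapse_cov col).
- by move=> k; have [] := VP k.
- by move=> k; have [] := VP k.
Qed.

Section CollapseFundamentalGroup.
Variables (R : realType) (B A : topologicalType) (J : Type).
Variables (q : B -> A) (e : A -> B) (P : set A) (V : J -> set A).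
Hypothesis col : collapse R q e P V.
Hypothesis colA : collapse R (@id A) id P V.

Local Notation I := (@I01 R).
Local Notation square := (@square R).
Local Notation square_boundary := (@square_boundary R).

(** An exact lift on the boundary is in particular a weak one, so the grid argument applies. Inside
    the square [q \o G] and [f] may differ. *)
Lemma homotopy_lift (f : R * R -> A) (g : R * R -> B) :
  {within square, continuous f} -> {within square_boundary, continuous g} ->
  (forall p, square_boundary p -> q (g p) = f p) ->
  exists G : R * R -> B, {within square, continuous G} /\
    forall p, square_boundary p -> G p = g p.
Proof.
move=> fc gc qg; have [N N0 sm] := mesh_exists (collapse_cov col) fc.
apply: (square_lift col N0 fc sm gc) => [i j b|k i k0N iN].
  by apply: (lift_lifts_on col) => _ ->; exact: qg.
have gI : I (grid N k) by apply: grid_in => //; case: k0N => ->.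
split; apply: (lift_lifts_on col) => t ct; apply: qg;
  (split; first by split => //; exact: gridcell_sub ct);
  case: k0N => ->; rewrite /= ?grid0 ?gridN//.
- exact: Or41.
- exact: Or42.
- exact: Or43.
- exact: Or44.
Qed.

(** The path is viewed as a homotopy constant in the first variable, to which the mesh of the square
    applies. *)
Lemma path_mesh (f : R -> A) : {within I, continuous f} ->
  exists2 N, (0 < N)%N & forall i, (i < N)%N -> small_on P V (gridcell N i) f.
Proof.
move=> fc.
have fc2 : {within square, continuous (f \o snd)}.
  by apply: (within_continuous_compW (@snd_within R _) fc) => p [].
have [N N0 sm] := mesh_exists (collapse_cov col) fc2.
exists N => // i iN; have c0 : gridcell N 0 (grid N 0 : R).
  by apply: gridcell_ends => //; left.
case: (sm 0%N i N0 iN) => [h|[k h]]; [left|right; exists k] => t ct;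
  exact: (h (grid N 0, t)).
Qed.

Lemma path_lift_ends (f : R -> A) (x y : B) :
  {within I, continuous f} -> q x = f 0 -> q y = f 1 ->
  exists N g, [/\ (0 < N)%N /\ (forall i, (i < N)%N -> small_on P V (gridcell N i) f),
    {within I, continuous g}, g 0 = x /\ g 1 = y,
    forall i, (i <= N)%N -> q (g (grid N i)) = f (grid N i) &
    forall i, (i < N)%N -> lifts_on q e P V (gridcell N i) f g].
Proof.
move=> fc qx qy; have [N N0 sm] := path_mesh fc.
(* The given ends replace the values of the section, which may be different points of the same
   fibres. *)
pose v i := if i == 0%N then x else if i == N then y else e (f (grid N i)).
have qv i : q (v i) = f (grid N i).
  rewrite /v; case: eqP => [->|_]; first by rewrite grid0.
  by case: eqP => [->|_]; [rewrite gridN|rewrite (collapse_sec col)].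
have [|g [gc gv gl]] := path_lift col N0 fc sm (v := v).
  by move=> i iN; apply: (lift_lifts_on col) => _ ->; exact: qv.
exists N, g; split => //.
- split; first by rewrite -(grid0 R N) gv.
  by rewrite -(gridN R N0) gv// /v eqxx; case: eqP => // N00; rewrite N00 in N0.
- by move=> i iN; rewrite gv.
Qed.

Lemma collapse_path_connected : path_connected R A -> path_connected R B.
Proof.
move=> [[a _] pA]; split; first by exists (e a).
move=> x y; have [f [fc f0 f1]] := pA (q x) (q y).
by have [N [g [_ gc [g0 g1] _ _]]] := path_lift_ends fc (esym f0) (esym f1); exists g.
Qed.

Lemma collapse_loop (y : B) (g : R -> B) : loop y g -> loop (q y) (q \o g).
Proof.
move=> [gc g0 g1]; split; rewrite /= ?g0 ?g1//.
apply: (within_continuous_compW (B := setT) gc) => //.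
exact/continuous_subspaceT/(collapse_cont col).
Qed.

Lemma collapse_homotopic (y : B) (g h : R -> B) :
  homotopic y g h -> homotopic (q y) (q \o g) (q \o h).
Proof.
move=> [H [Hc H0 H1 Hs]]; exists (q \o H); split.
- apply: (within_continuous_compW (B := setT) Hc) => //.
  exact/continuous_subspaceT/(collapse_cont col).
- by move=> t It /=; rewrite H0.
- by move=> t It /=; rewrite H1.
- by move=> s Is /=; have [-> ->] := Hs _ Is.
Qed.

Definition square_sides (b : bool * bool) : set (R * R) :=
  if b.1 then [set if b.2 then 0 else 1] `*` I
  else I `*` [set if b.2 then 0 else 1].

Lemma square_sides_closed b : closed (square_sides b).
Proof.
have c1 (a : R) : closed [set a].
  exact/accessible_closed_set1/hausdorff_accessible/Rhausdorff.
by rewrite /square_sides; case: b.1; apply: closed_setX => //; exact: closed_itv_cc.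
Qed.

Lemma square_boundary_sides : square_boundary `<=` \bigcup_b square_sides b.
Proof.
case=> s t [[/= Is It]] [] /= est.
- by exists (true, true).
- by exists (true, false).
- by exists (false, true).
- by exists (false, false).
Qed.

(** The boundary data of a based homotopy from [g] to [h]: any extension of [k] over the square is
    such a homotopy. *)
Lemma square_boundary_fill (T : topologicalType) (x : T) (g h : R -> T) :
  loop x g -> loop x h ->
  exists k : R * R -> T, [/\ {within square_boundary, continuous k},
    forall t, I t -> k (0, t) = g t, forall t, I t -> k (1, t) = h t &
    forall s, I s -> k (s, 0) = x /\ k (s, 1) = x].
Proof.
move=> [gc g0 g1] [hc h0 h1].
have n10 : (1 == 0 :> R) = false by apply/negbTE; rewrite oner_eq0.
pose w (b : bool * bool) : R * R -> T :=
  if b.1 then (if b.2 then g else h) \o snd else cst x.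
have [||k [kc kw]] := @glue_exists _ _ _ square_boundary square_sides w (cst x)
   square_sides_closed square_boundary_sides.
- move=> -[[] b]; rewrite /w /square_sides /=; last first.
    by apply: continuous_subspaceT => p; exact: cvg_cst.
  have bc : {within I, continuous (if b then g else h)} by case: b.
  by apply: (within_continuous_compW (@snd_within R _) bc) => p [].
- move=> [[] b] [[] b'] [s t]; rewrite /w /square_sides /=.
  - move=> [-> _] [+ _]; case: b; case: b' => // /eqP; rewrite ?n10// eq_sym n10//.
  - by move=> [_ _] [_ ->]; case: b; case: b'; rewrite ?g0 ?g1 ?h0 ?h1.
  - by move=> [_ ->] [_ _]; case: b; case: b'; rewrite ?g0 ?g1 ?h0 ?h1.
  - by [].
exists k; split => //.
- by move=> t It; rewrite (kw (true, true)).
- by move=> t It; rewrite (kw (true, false)).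
- by move=> s Is; rewrite (kw (false, true)) ?(kw (false, false)).
Qed.

Lemma square_boundary_side (k : R) (t : R) : k = 0 \/ k = 1 -> I t ->
  square_boundary (k, t) /\ square_boundary (t, k).
Proof.
have I0 := @I01_0 R; have I1 := @I01_1 R.
case=> -> It; split; (split; first by split);
  [exact: Or41|exact: Or43|exact: Or42|exact: Or44].
Qed.

(** On the boundary of the square, [g], [h] and the base point lift the given homotopy exactly, so
    it lifts with these boundary values. *)
Lemma collapse_homotopic_inj (y : B) (g h : R -> B) :
  loop y g -> loop y h -> homotopic (q y) (q \o g) (q \o h) -> homotopic y g h.
Proof.
move=> lg lh [H [Hc H0 H1 Hs]].
have [k [kc kg kh ks]] := square_boundary_fill lg lh.
have [|G [Gc Gk]] := homotopy_lift Hc kc.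
  case=> s t [[/= Is It]] [] /= -> .
  - by rewrite kg ?H0.
  - by rewrite kh ?H1.
  - by have [-> _] := ks _ Is; have [-> _] := Hs _ Is.
  - by have [_ ->] := ks _ Is; have [_ ->] := Hs _ Is.
exists G; split => //.
- by move=> t It; rewrite Gk ?kg//; have [] := square_boundary_side (or_introl erefl) It.
- by move=> t It; rewrite Gk ?kh//; have [] := square_boundary_side (or_intror erefl) It.
- move=> s Is; have [_ b0] := square_boundary_side (or_introl erefl) Is.
  have [_ b1] := square_boundary_side (or_intror erefl) Is.
  by rewrite !Gk//; exact: ks.
Qed.

(** Inside the patches [q \o g] and [f] may differ. The stationary square [f \o snd] is lifted along
    the identity collapse, with [q \o g] and [f] prescribed on two opposite sides; the weak
    condition on [g] is exactly what [square_lift] accepts there. *)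
Lemma collapse_homotopic_surj (y : B) (f : R -> A) : loop (q y) f ->
  exists g, loop y g /\ homotopic (q y) (q \o g) f.
Proof.
move=> lf; have [fc f0 f1] := lf.
have [N [g [[N0 sm] gc [g0 g1] qg gl]]] := path_lift_ends fc (esym f0) (esym f1).
have lg : loop y g by [].
exists g; split => //.
have [k [kc kg kh ks]] := square_boundary_fill (collapse_loop lg) lf.
have fc2 : {within square, continuous (f \o snd)}.
  by apply: (within_continuous_compW (@snd_within R _) fc) => p [].
have [|||G [Gc Gk]] := square_lift colA N0 fc2 _ kc.
- move=> i j _ jN; case: (sm _ jN) => [h|[l h]]; [left|right; exists l] => p [_ pj];
    exact: h.
- move=> i j b; apply: (lift_lifts_on colA) => _ -> /=.
  case: b => -[/= Ii Ij] [] /= E; rewrite ?E.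
  + have jN : (j <= N)%N by move: Ij => /I01P/andP[_]; rewrite -{1}(gridN R N0) ler_grid.
    by rewrite kg//= qg.
  + by rewrite kh.
  + by have [-> _] := ks _ Ii; rewrite f0.
  + by have [_ ->] := ks _ Ii; rewrite f1.
- move=> l i l0N iN; split.
    case: l0N => ->; rewrite ?grid0 ?gridN//.
      have [h1 h2] := gl _ iN; split=> [nP|m Vm] t ct; have It := gridcell_sub iN ct.
        rewrite kg//= h1// (collapse_sec col)//.
      by rewrite kg//=; exact: h2.
    apply: (lift_lifts_on colA) => t ct; rewrite /= kh//; exact: gridcell_sub ct.
  apply: (lift_lifts_on colA) => t ct; have It := gridcell_sub iN ct.
  have [k0 k1] := ks _ It.
  by case: l0N => ->; rewrite /= ?grid0 ?gridN//= ?k0 ?k1 ?f0 ?f1.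
exists G; split => //.
- by move=> t It; rewrite Gk ?kg//; have [] := square_boundary_side (or_introl erefl) It.
- by move=> t It; rewrite Gk ?kh//; have [] := square_boundary_side (or_intror erefl) It.
- move=> s Is; have [_ b0] := square_boundary_side (or_introl erefl) Is.
  have [_ b1] := square_boundary_side (or_intror erefl) Is.
  by rewrite !Gk//; exact: ks.
Qed.

Lemma collapse_pi1_iso_int (y : B) :
  pi1_iso_int R (q y) -> pi1_iso_int R y.
Proof.
move=> [phi [[_ inj surj] hom]].
(* A representative of each class, with the constant loop as default for sets that are no
   classes. *)
have rep (c : set (R -> B)) : exists g : R -> B, pi1 y c -> loop y g /\ pi1_class y g = c.
  have [[g lg <-]|n] := pselect (pi1 y c); first by exists g.
  by exists (cst y) => /n.
have {rep} /choice [rep repP] := rep.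
pose psi c := phi (pi1_class (q y) (q \o rep c)).
have psiE (g : R -> B) : loop y g -> psi (pi1_class y g) = phi (pi1_class (q y) (q \o g)).
  move=> lg; rewrite /psi; congr phi; apply: pi1_class_eq; apply: collapse_homotopic.
  have [|lr] := repP (pi1_class y g); first by exists g.
  exact: pi1_class_inj.
have pi1q (g : R -> B) : loop y g -> pi1 (q y) (pi1_class (q y) (q \o g)).
  by move=> lg; exists (q \o g) => //; apply: collapse_loop lg.
exists psi; split; first split => //.
- move=> _ _ /set_mem[g lg <-] /set_mem[h lh <-]; rewrite !psiE// => E.
  have {E} := inj _ _ (mem_set (pi1q _ lg)) (mem_set (pi1q _ lh)) E.
  move=> /(pi1_class_inj (collapse_loop lh)) gh.
  by apply: pi1_class_eq; exact: collapse_homotopic_inj.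
- move=> z _; have [_ [f lf <-] <-] := surj z Logic.I.
  have [g [lg gf]] := collapse_homotopic_surj lf.
  exists (pi1_class y g); first by exists g.
  by rewrite psiE// (pi1_class_eq gf).
- move=> _ _ [g lg <-] [h lh <-].
  rewrite pi1_mul_class// psiE; last exact: loop_concat_loop.
  rewrite !psiE// -hom; [|exact: pi1q|exact: pi1q].
  rewrite pi1_mul_class; [|exact: collapse_loop|exact: collapse_loop].
  congr (phi (pi1_class _ _)); apply/funext => t; rewrite /loop_concat /=.
  by case: ifP.
Qed.

End CollapseFundamentalGroup.

(** * Collars *)

Section Charts.
Variables (R : realType) (T : topologicalType) (bd : set T).

Lemma chart_to n (c : chart R bd n) x :
  dom c x -> cod c (to c x) /\ halfspace (to c x).
Proof. by move=> dx; apply: to_cod; exists x. Qed.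

Lemma chart_from n (c : chart R bd n) v :
  cod c v -> halfspace v -> dom c (from c v).
Proof. by move=> cv hv; apply: from_dom; exists v. Qed.

Lemma chart_toK n (c : chart R bd n) x : dom c x -> from c (to c x) = x.
Proof. by move=> dx; apply: (toK (c := c)); rewrite inE. Qed.

Lemma chart_fromK n (c : chart R bd n) v :
  cod c v -> halfspace v -> to c (from c v) = v.
Proof. by move=> cv hv; apply: (fromK (c := c)); rewrite inE. Qed.

Lemma halfspaceP n (v : 'rV[R]_n.+1) : halfspace v <-> 0 <= v ord0 ord0.
Proof.
split=> [|v0 i i0]; first exact.
by rewrite (_ : i = ord0)//; apply: val_inj.
Qed.

Lemma bounding_hyperplaneP n (v : 'rV[R]_n.+1) :
  bounding_hyperplane v <-> v ord0 ord0 = 0.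
Proof.
split=> [|v0 i i0]; first exact.
by rewrite (_ : i = ord0)//; apply: val_inj.
Qed.

Lemma chart_bd n (c : chart R bd n.+1) x :
  dom c x -> bd x <-> to c x ord0 ord0 = 0.
Proof.
move=> dx; split=> [bx|t0].
  apply/bounding_hyperplaneP.
  have : (to c @` (dom c `&` bd)) (to c x) by exists x.
  by rewrite to_bd => -[].
have : (cod c `&` @bounding_hyperplane R n.+1) (to c x).
  by split; [exact: (chart_to dx).1|exact/bounding_hyperplaneP].
rewrite -to_bd => -[x' [dx' bx'] E].
by rewrite -(chart_toK dx) -E chart_toK.
Qed.

End Charts.

Section Collars.
Variables (R : realType) (X : topologicalType) (bd : set X).

(* The range of an outer collar is X with a collar of variable height added
   along its boundary, drawn inside the product of X and the line. *)
Definition outer_collar (F : X -> X * R) : Prop :=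
  [/\ continuous F, injective F, forall b, bd b -> (F b).1 = b &
    forall p, range F p <->
      p.2 = 0 \/ bd p.1 /\ 0 <= p.2 <= (F p.1).2].

Lemma outer_collar_id : outer_collar (fun x => (x, 0)).
Proof.
split=> //.
- by apply: continuous_pair; [exact: continuous_idfun|exact: continuous_cst].
- by move=> x y [].
- case=> x t; split=> /=.
    by case=> y _ [_ <-]; left.
  case=> [->|[_]]; first by exists x.
  by rewrite -eq_le => /eqP <-; exists x.
Qed.

Lemma outer_collar_ge0 F x : outer_collar F -> 0 <= (F x).2.
Proof.
move=> [_ _ _ rF]; have : range F (F x) by exists x.
by move=> /rF [->//|[_ /andP[]]].
Qed.

(** The collar of [F] is stacked on top of that of [G]: at height zero of [F] the map is [G], and
    over a boundary point, which [G] sends to the top of its own collar, the height of [F] is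
    added. *)
Lemma outer_collar_comp F G : outer_collar F -> outer_collar G ->
  let H x := ((G (F x).1).1, (G (F x).1).2 + (F x).2) in
  outer_collar H /\ forall b, bd b -> (H b).2 = (G b).2 + (F b).2.
Proof.
move=> oF oG H; have F0 x := outer_collar_ge0 x oF.
have G0 x := outer_collar_ge0 x oG.
move: oF oG => [Fc Fi Fb rF] [Gc Gi Gb rG].
have Hb b : bd b -> (H b).2 = (G b).2 + (F b).2.
  by move=> bb; rewrite /H /= Fb.
split=> //.
have up x : (F x).2 = 0 \/ bd (F x).1 /\ 0 <= (F x).2 <= (F (F x).1).2.
  by apply/rF; exists x.
have Gup x : (G x).2 = 0 \/ bd (G x).1 /\ 0 <= (G x).2 <= (G (G x).1).2.
  by apply/rG; exists x.
split.
- have F1c : continuous (fun x => (F x).1).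
    exact: (continuousT_comp Fc (@fst_continuous _ _)).
  have F2c : continuous (fun x => (F x).2).
    exact: (continuousT_comp Fc (@snd_continuous _ _)).
  have G1c : continuous (fun x => (G x).1).
    exact: (continuousT_comp Gc (@fst_continuous _ _)).
  have G2c : continuous (fun x => (G x).2).
    exact: (continuousT_comp Gc (@snd_continuous _ _)).
  apply: continuous_pair; first exact: (continuousT_comp F1c G1c).
  by move=> x; apply: cvgD; [exact: (continuousT_comp F1c G2c)|exact: F2c].
(* Points of the upper storey lie strictly above the collar of [G], where no point that comes from
   [G] alone can lie. *)
- have sep x y : (F x).2 = 0 -> bd (F y).1 -> 0 < (F y).2 -> H x <> H y.
    rewrite /H => x0 by1 y0 [e1 e2].
    rewrite (Gb _ by1) in e1; rewrite x0 addr0 in e2.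
    case: (Gup (F x).1) => [z|[_ /andP[_ le]]].
      by rewrite z in e2; have := G0 (F y).1; lra.
    by rewrite e1 in le; lra.
  move=> x y Hxy.
  case: (up x) => [x0|[bx /andP[x0 _]]]; case: (up y) => [y0|[b_y /andP[y0 _]]].
  + apply: Fi; rewrite [LHS]surjective_pairing [RHS]surjective_pairing x0 y0.
    congr pair; apply: Gi; move: Hxy; rewrite /H x0 y0 !addr0 => -[e1 e2].
    by rewrite [LHS]surjective_pairing [RHS]surjective_pairing e1 e2.
  + have [y1|ny] := eqVneq (F y).2 0; last first.
      by case: (sep x y x0 b_y _ Hxy); rewrite lt_neqAle eq_sym ny.
    apply: Fi; rewrite [LHS]surjective_pairing [RHS]surjective_pairing x0 y1.
    congr pair; apply: Gi; move: Hxy; rewrite /H x0 y1 !addr0 => -[e1 e2].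
    by rewrite [LHS]surjective_pairing [RHS]surjective_pairing e1 e2.
  + have [x1|nx] := eqVneq (F x).2 0; last first.
      by case: (sep y x y0 bx _ (esym Hxy)); rewrite lt_neqAle eq_sym nx.
    apply: Fi; rewrite [LHS]surjective_pairing [RHS]surjective_pairing x1 y0.
    congr pair; apply: Gi; move: Hxy; rewrite /H x1 y0 !addr0 => -[e1 e2].
    by rewrite [LHS]surjective_pairing [RHS]surjective_pairing e1 e2.
  + move: Hxy; rewrite /H !Gb// => -[e1]; rewrite e1 => /addrI e2.
    by apply: Fi; rewrite [LHS]surjective_pairing [RHS]surjective_pairing e1 e2.
- by move=> b bb; rewrite /H /= Fb// Gb.
- case=> z u /=; split.
    case=> x _ [<- <-].
    case: (up x) => [x0|[bx /andP[x0 x1]]].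
      rewrite x0 addr0; case: (Gup (F x).1) => [->|[bz /andP[h1 h2]]]; first by left.
      right; split => //; rewrite h1 /= (Fb _ bz).
      by apply: (le_trans h2); rewrite lerDl.
    by right; rewrite (Gb _ bx) (Fb _ bx); split => //; rewrite addr_ge0// lerD2l.
  case=> [->|[bz]].
    have [y _ ey] : range G (z, 0) by apply/rG; left.
    have [x _ ex] : range F (y, 0) by apply/rF; left.
    by exists x => //; rewrite /H ex /= ey /= addr0.
  rewrite (Fb _ bz) => /andP[u0 uh].
  have [uz|/ltW zu] := leP u (G z).2.
    have [y _ ey] : range G (z, u) by apply/rG; right; rewrite /= u0.
    have [x _ ex] : range F (y, 0) by apply/rF; left.
    by exists x => //; rewrite /H ex /= ey /= addr0.
  have [x _ ex] : range F (z, u - (G z).2).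
    by apply/rF; right; split => //=; rewrite subr_ge0 zu /=; lra.
  by exists x => //; rewrite /H ex /= Gb//; congr pair; lra.
Qed.

(** In place of a finite subcover, compactness is used along the filter generated by the collars at
    least as high as a given one. It is a filter because stacking adds heights, and positivity at a
    point passes to nearby points and to higher collars. *)
Lemma outer_collar_exists : compact bd ->
  (forall b, bd b -> exists F, outer_collar F /\ 0 < (F b).2) ->
  exists F, outer_collar F /\ forall b, bd b -> 0 < (F b).2.
Proof.
move=> /compact_near_coveringP/near_covering_withinP cbd ex.
pose FF := filter_from outer_collar (fun F => [set G | outer_collar G /\
  forall b, bd b -> (F b).2 <= (G b).2]).
have fFF : Filter FF.
  apply: filter_from_filter; first by eexists; exact: outer_collar_id.
  move=> F G oF oG; have [oH HE] := outer_collar_comp oF oG.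
  eexists; first exact: oH.
  move=> K [oK HK]; split; split => // b bb; apply: le_trans (HK b bb);
    rewrite HE// ?lerDl ?lerDr; exact: outer_collar_ge0.
have : \forall F \near FF, bd `<=` [set b | 0 < (F b).2].
  apply: (cbd _ FF (fun F b => 0 < (F b).2)) => b bb.
  have [F [oF Fb]] := ex _ bb; have [Fc _ _ _] := oF.
  exists ([set b' | 0 < (F b').2],
    [set G | outer_collar G /\ forall b, bd b -> (F b).2 <= (G b).2]) => /=.
    split; last by exists F.
    have F2 : (F x).2 @[x --> b] --> (F b).2.
      exact: (continuousT_comp Fc (@snd_continuous _ _)).
    exact: (cvgr_gt _ F2).
  by case=> b' G /= [h1 [_ h2]] bb'; apply: lt_le_trans (h2 _ bb').
move=> [F oF HF]; exists F; split => //.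
by apply: HF; split.
Qed.

End Collars.

(** * An outer collar supported in one boundary chart *)

Section LocalCollar.
Variables (R : realType) (X : topologicalType) (bd : set X) (n : nat).
Hypothesis hX : hausdorff_space X.
Variables (c : chart R bd n.+1) (x0 : X).
Hypothesis dx0 : dom c x0.
Hypothesis bx0 : bd x0.

Local Notation V := 'rV[R]_n.+1.
Local Notation depth v := ((v : V) ord0 ord0).

Definition normal_vector : V := delta_mx 0 0.
Local Notation e0 := normal_vector.

Definition base (v : V) : V := v - depth v *: e0.

Lemma depth_normal s : depth (s *: e0) = s.
Proof. by rewrite !mxE !eqxx mulr1. Qed.

Lemma depth_base v : depth (base v) = 0.
Proof. by rewrite mxE [X in _ + X]mxE depth_normal subrr. Qed.

Lemma depth_baseD v s : depth (base v + s *: e0) = s.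
Proof. by rewrite mxE depth_base depth_normal add0r. Qed.

Lemma base_baseD v s : base (base v + s *: e0) = base v.
Proof. by rewrite /base depth_baseD addrK. Qed.

Lemma base_depthK v : base v + depth v *: e0 = v.
Proof. by rewrite subrK. Qed.

Lemma depth_continuous : continuous (fun v : V => depth v).
Proof. exact: coord_continuous. Qed.

Lemma base_continuous : continuous base.
Proof.
apply: continuous_funB; first exact: continuous_idfun.
by apply: continuous_funZ; [exact: depth_continuous|exact: continuous_cst].
Qed.

Definition pospart (d : R) : R := (d + `|d|) / 2.

Lemma pospart_ge0 d : 0 <= d -> pospart d = d.
Proof. by move=> d0; rewrite /pospart ger0_norm//; lra. Qed.

Lemma pospart_le0 d : d <= 0 -> pospart d = 0.
Proof. by move=> d0; rewrite /pospart ler0_norm//; lra. Qed.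

Lemma pospart_continuous : continuous pospart.
Proof.
move=> d; apply: cvgM; last exact: cvg_cst.
by apply: cvgD; [exact: cvg_id|exact: norm_continuous].
Qed.

Let v0 := to c x0.

Lemma depth_center : depth v0 = 0.
Proof. exact/(chart_bd dx0). Qed.

Lemma base_center : base v0 = v0.
Proof. by rewrite /base depth_center scale0r subr0. Qed.

Definition box (r : R) : set V :=
  [set v | 0 <= depth v <= r /\ `|base v - v0| <= r].

Lemma box_exists : exists2 r, 0 < r & box r `<=` cod c.
Proof.
have cv0 : cod c v0 := (chart_to dx0).1.
have /nbhs_ballP[rho /= rho0 sub] : nbhs v0 (cod c).
  by apply: open_nbhs_nbhs; split => //; exact: cod_open.
have k0 : 0 < 1 + `|e0| by rewrite ltr_pwDl.
(* A point of a box of size [r] is within [r * (1 + |e0|)] of the centre; the extra factor 1/2 makes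
   this strictly less than [rho]. *)
exists (rho / (1 + `|e0|) / 2); first by rewrite !divr_gt0.
move=> v [/andP[d0 d1] b1]; apply: sub; rewrite -ball_normE /ball_ /= distrC.
rewrite -(base_depthK v) addrAC; apply: le_lt_trans (ler_normD _ _) _.
rewrite normrZ (ger0_norm d0).
apply: (@le_lt_trans _ _ (rho / (1 + `|e0|) / 2 * (1 + `|e0|))).
  by rewrite mulrDr mulr1 lerD// ler_wpM2r.
rewrite mulrAC divfK ?gt_eqF//; lra.
Qed.

Variable r : R.
Hypothesis r0 : 0 < r.
Hypothesis rcod : box r `<=` cod c.

Lemma box_compact : compact (box r).
Proof.
have c1 : continuous (fun v : V => `|base v - v0|).
  apply/continuous_fun_norm/continuous_funB; last exact: continuous_cst.
  exact: base_continuous.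
apply: bounded_closed_compact.
  exists (r + r * `|e0| + `|v0|); split; first exact: num_real.
  move=> M ltM v [/andP[d0 d1] b1]; apply: le_trans (ltW ltM).
  rewrite -(base_depthK v) -(subrK v0 (base v)).
  apply: le_trans (ler_normD _ _) _; rewrite normrZ (ger0_norm d0) (addrAC r).
  apply: lerD; last by rewrite ler_wpM2r.
  by apply: le_trans (ler_normD _ _) _; rewrite lerD2r.
rewrite (_ : box r = (fun v : V => depth v) @^-1` [set s | 0 <= s] `&`
  ((fun v : V => depth v) @^-1` [set s | s <= r] `&`
   (fun v : V => `|base v - v0|) @^-1` [set s | s <= r])); last first.
  apply/seteqP; split=> [v [/andP[? ?] ?]|v [? [? ?]]]; split => //.
  exact/andP.
apply: closedI; first by apply: closed_comp => [v _|];
  [exact: depth_continuous|exact: closed_ge].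
apply: closedI; first by apply: closed_comp => [v _|];
  [exact: depth_continuous|exact: closed_le].
by apply: closed_comp => [v _|]; [exact: c1|exact: closed_le].
Qed.

Lemma box_from_continuous : {within box r, continuous (from c)}.
Proof.
have sub : box r `<=` cod c `&` @halfspace R n.+1.
  by move=> v bv; split; [exact: rcod|apply/halfspaceP; case: bv => /andP[]].
exact: continuous_subspaceW sub (@from_continuous _ _ _ _ c).
Qed.

Definition box_dom : set X := [set x | dom c x /\ box r (to c x)].

Lemma box_halfspace v : box r v -> halfspace v.
Proof. by move=> [/andP[d0 _] _]; exact/halfspaceP. Qed.

Lemma from_box v : box r v -> box_dom (from c v) /\ to c (from c v) = v.
Proof.
move=> bv; have hv := box_halfspace bv; have cv := rcod bv.
split; last exact: chart_fromK.
by split; [exact: chart_from|rewrite chart_fromK].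
Qed.

Lemma box_domE : box_dom = from c @` box r.
Proof.
apply/seteqP; split=> [x [dx bx]|_ [v bv <-]]; last exact: (from_box bv).1.
by exists (to c x) => //; exact: chart_toK.
Qed.

Lemma box_dom_closed : closed box_dom.
Proof.
rewrite box_domE; apply: compact_closed => //.
exact: continuous_compact box_from_continuous box_compact.
Qed.

(** The face at depth zero is kept: it lies on the boundary of [X] and does not belong to the
    frontier of the box in [X]. *)
Definition box_interior : set X :=
  [set x | dom c x /\ (depth (to c x) < r /\ `|base (to c x) - v0| < r)].

Lemma box_interior_open : open box_interior.
Proof.
have c1 : continuous (fun v : V => `|base v - v0|).
  apply/continuous_fun_norm/continuous_funB; last exact: continuous_cst.
  exact: base_continuous.
pose W : set V := (fun v : V => depth v) @^-1` [set s | s < r] `&`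
  (fun v : V => `|base v - v0|) @^-1` [set s | s < r].
have oW : open W.
  apply: openI.
    by apply: open_comp => [v _|]; [exact: depth_continuous|exact: open_lt].
  by apply: open_comp => [v _|]; [exact: c1|exact: open_lt].
have tc := @to_continuous _ _ _ _ c.
rewrite (continuous_open_subspace _ (dom_open c)) in tc.
exact: (iffLR (continuous_inP _ (dom_open c)) tc W oW).
Qed.

Lemma box_interior_sub : box_interior `<=` box_dom.
Proof.
move=> x [dx [h1 h2]]; split => //; split; last exact: ltW.
by rewrite (ltW h1) andbT; apply/halfspaceP; exact: (chart_to dx).2.
Qed.

(** Equal to 1 on the normal through the centre, and to 0 on the lateral wall of the box, where the
    added collar has to vanish. *)
Definition bump (v : V) : R := 1 - `|base v - v0| / r.
(* The normal segment [0, r] over a base point is stretched affinely onto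
   [- r * bump, r]; negative depths go to the outer collar. *)
Definition signed_depth (v : V) : R := depth v * (1 + bump v) - bump v * r.

Lemma bump_box v : box r v -> 0 <= bump v <= 1.
Proof.
move=> [_ h]; rewrite /bump subr_ge0 ler_pdivrMr// mul1r h /=.
by rewrite lerBlDr lerDl divr_ge0// ltW.
Qed.

Lemma bump_baseD v s : bump (base v + s *: e0) = bump v.
Proof. by rewrite /bump base_baseD. Qed.

Lemma box_baseD v s : box r v -> 0 <= s <= r -> box r (base v + s *: e0).
Proof. by move=> [_ h] sr; split; rewrite ?depth_baseD ?base_baseD. Qed.

Lemma signed_depth_le v : box r v -> signed_depth v <= r.
Proof.
move=> bv; have /andP[b0 b1] := bump_box bv; case: bv => /andP[d0 d1] _.
rewrite /signed_depth lerBlDr (_ : r + bump v * r = r * (1 + bump v)); last by ring.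
by rewrite ler_wpM2r// addr_ge0.
Qed.

Definition push (x : X) : X * R :=
  let v := to c x in
  (from c (base v + pospart (signed_depth v) *: e0), pospart (- signed_depth v)).

Definition local_collar (x : X) : X * R :=
  if pselect (box_dom x) then push x else (x, 0).

Lemma local_collar_in x : box_dom x -> local_collar x = push x.
Proof. by rewrite /local_collar; case: pselect. Qed.

Lemma local_collar_out x : ~ box_dom x -> local_collar x = (x, 0).
Proof. by rewrite /local_collar; case: pselect. Qed.

Lemma push_box x : box_dom x ->
  box r (base (to c x) + pospart (signed_depth (to c x)) *: e0).
Proof.
move=> [_ bx]; apply: box_baseD => //; have := signed_depth_le bx.
have [h|/ltW h] := leP 0 (signed_depth (to c x)).
  by rewrite pospart_ge0// h.
by move=> _; rewrite pospart_le0// lexx /=; exact: ltW.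
Qed.

(** The stretching fixes depth [r] and is trivial where the bump vanishes. Hence [push] is the
    inclusion on the frontier of the box and pastes with the inclusion outside. *)
Lemma signed_depth_frontier v : depth v = r \/ `|base v - v0| = r ->
  signed_depth v = depth v.
Proof.
rewrite /signed_depth => -[->|h]; first by ring.
rewrite /bump h divff ?gt_eqF//; ring.
Qed.

Lemma local_collar_continuous : continuous local_collar.
Proof.
have bc : continuous bump.
  apply: continuous_funB; first exact: continuous_cst.
  apply: continuous_funM; last exact: continuous_cst.
  apply/continuous_fun_norm/continuous_funB; last exact: continuous_cst.
  exact: base_continuous.
have sc : continuous signed_depth.
  apply: continuous_funB.
    apply: continuous_funM; first exact: depth_continuous.
    by apply: continuous_funD; [exact: continuous_cst|exact: bc].
  by apply: continuous_funM; [exact: bc|exact: continuous_cst].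
have pc : continuous (fun v : V => base v + pospart (signed_depth v) *: e0).
  apply: continuous_funD; first exact: base_continuous.
  apply: continuous_funZ; last exact: continuous_cst.
  exact: (continuousT_comp sc pospart_continuous).
have qc : continuous (fun v : V => pospart (- signed_depth v)).
  exact: (continuousT_comp (continuous_funN sc) pospart_continuous).
have tc : {within box_dom, continuous (to c)}.
  have sub : box_dom `<=` dom c by move=> x [].
  exact: continuous_subspaceW sub (@to_continuous _ _ _ _ c).
suff : {within [set: X], continuous local_collar}.
  by move=> h x; have := h x; rewrite /continuous_at nbhs_subspaceT.
pose C (b : bool) := if b then box_dom else ~` box_interior.
apply: (within_cover_continuous (C := C)
  (g := fun b => if b then push else fun x => (x, 0))).
- by case; [exact: box_dom_closed|exact: (open_closedC box_interior_open)].
- move=> x _; have [h|h] := pselect (box_dom x); first by exists true.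
  by exists false => // /box_interior_sub.
- case; last first.
    by apply: continuous_subspaceT; apply: continuous_pair;
      [exact: continuous_idfun|exact: continuous_cst].
  apply: within_continuous_pair.
    apply: (@within_continuous_compW _ _ _ box_dom (box r)
      (fun x => base (to c x) + pospart (signed_depth (to c x)) *: e0) (from c)).
    + exact: (within_continuousT_comp tc pc).
    + exact: box_from_continuous.
    + exact: push_box.
  exact: (within_continuousT_comp tc qc).
- case=> x /= h; first exact: local_collar_in.
  have [dx|] := pselect (box_dom x); last exact: local_collar_out.
  rewrite local_collar_in// /push.
  case: (dx) => [dcx [/andP[d0 d1] b1]].
  rewrite signed_depth_frontier; last first.
    have [e|ne] := eqVneq (depth (to c x)) r; [by left|right].
    apply/eqP; rewrite eq_le b1 /= leNgt; apply/negP => b2; apply: h.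
    by split => //; split => //; rewrite lt_neqAle ne.
  rewrite pospart_ge0// pospart_le0 ?oppr_le0// base_depthK.
  by rewrite chart_toK.
Qed.

Lemma push_in x : box_dom x -> box_dom (push x).1 /\
  to c (push x).1 = base (to c x) + pospart (signed_depth (to c x)) *: e0.
Proof. by move=> /push_box; exact: from_box. Qed.

Lemma pospart_inj d d' :
  pospart d = pospart d' -> pospart (- d) = pospart (- d') -> d = d'.
Proof.
have E a : a = pospart a - pospart (- a).
  by rewrite /pospart normrN; lra.
by move=> h1 h2; rewrite (E d) (E d') h1 h2.
Qed.

Lemma local_collar_injective : injective local_collar.
Proof.
have H x y : box_dom x -> ~ box_dom y -> local_collar x <> local_collar y.
  move=> bx nby; rewrite local_collar_in// local_collar_out// => e.
  by have [] := push_in bx; rewrite e.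
move=> x y; have [bx|nbx] := pselect (box_dom x);
    have [b_y|nby] := pselect (box_dom y).
- rewrite !local_collar_in// => exy.
  have [_ tx] := push_in bx; have [_ ty] := push_in b_y.
  have e1 : base (to c x) + pospart (signed_depth (to c x)) *: e0 =
      base (to c y) + pospart (signed_depth (to c y)) *: e0 by rewrite -tx exy ty.
  have eb : base (to c x) = base (to c y).
    by have := congr1 base e1; rewrite !base_baseD.
  have ep : pospart (signed_depth (to c x)) = pospart (signed_depth (to c y)).
    by have := congr1 (fun v : V => depth v) e1; rewrite !depth_baseD.
  have en := congr1 snd exy; rewrite /push /= in en.
  have es := pospart_inj ep en.
  have ebump : bump (to c x) = bump (to c y) by rewrite /bump eb.
  have /andP[b0 _] := bump_box b_y.2.
  (* Over a fixed base point the signed depth is affine in the depth, with slope [1 + bump > 0]. *)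
  have ed : depth (to c x) = depth (to c y).
    move: es; rewrite /signed_depth ebump => /addIr/mulIf; apply.
    by rewrite gt_eqF// ltr_pwDl.
  have et : to c x = to c y.
    by rewrite -(base_depthK (to c x)) eb ed base_depthK.
  by rewrite -(chart_toK bx.1) et (chart_toK b_y.1).
- by move=> e; case: (H x y).
- by move=> e; case: (H y x).
- by rewrite !local_collar_out// => -[].
Qed.

Lemma local_collar_bd b : bd b -> (local_collar b).1 = b /\
  (box_dom b -> (local_collar b).2 = bump (to c b) * r).
Proof.
move=> bb; have [bx|nbx] := pselect (box_dom b); last by rewrite local_collar_out.
have d0 : depth (to c b) = 0 by exact/(chart_bd bx.1).
have /andP[b0 _] := bump_box bx.2.
have sE : signed_depth (to c b) = - (bump (to c b) * r).
  by rewrite /signed_depth d0 mul0r sub0r.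
have br : 0 <= bump (to c b) * r by rewrite mulr_ge0// ltW.
rewrite local_collar_in// /push sE opprK /= pospart_le0 ?oppr_le0//.
by rewrite pospart_ge0// -{1}d0 base_depthK (chart_toK bx.1).
Qed.

Lemma local_collar_outer : outer_collar bd local_collar /\ 0 < (local_collar x0).2.
Proof.
have bx0' : box_dom x0.
  split=> //; split; rewrite -/v0; first by rewrite depth_center lexx ltW.
  by rewrite base_center subrr normr0 ltW.
split; last first.
  have [_ ->//] := local_collar_bd bx0.
  by rewrite /bump -/v0 base_center subrr normr0 mul0r subr0 mul1r.
split.
- exact: local_collar_continuous.
- exact: local_collar_injective.
- by move=> b /local_collar_bd[].
have onto y u : box_dom y -> 0 <= u -> u = 0 \/ depth (to c y) = 0 ->
    u <= bump (to c y) * r + depth (to c y) -> range local_collar (y, u).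
  move=> bY u0 du uh; set v := to c y in du uh *.
  have /andP[b0 b1] := bump_box bY.2; case: (bY) => dy [/andP[d0 d1] _].
  have k0 : 0 < 1 + bump v by rewrite ltr_pwDl.
  (* The depth at which, over the base point of [v], the signed depth equals [depth v - u]. *)
  pose s := (depth v - u + bump v * r) / (1 + bump v).
  have sr : 0 <= s <= r.
    rewrite /s ler_pdivlMr// ler_pdivrMr// mul0r; apply/andP; split; first by lra.
    by rewrite mulrDr mulr1 (mulrC r) lerD2r; lra.
  have bs : box r (base v + s *: e0) by exact: (box_baseD bY.2 sr).
  have [bx tx] := from_box bs.
  exists (from c (base v + s *: e0)) => //.
  rewrite local_collar_in// /push tx base_baseD.
  have -> : signed_depth (base v + s *: e0) = depth v - u.
    by rewrite /signed_depth depth_baseD bump_baseD /s divfK ?gt_eqF//; ring.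
  case: du => du.
    by rewrite du subr0 pospart_ge0// pospart_le0 ?oppr_le0// base_depthK chart_toK.
  rewrite du sub0r opprK pospart_le0 ?oppr_le0// pospart_ge0// -{1}du base_depthK.
  by rewrite chart_toK.
case=> y u; split=> /=.
  case=> x _; have [bx|nbx] := pselect (box_dom x); last first.
    by rewrite local_collar_out// => -[_ <-]; left.
  rewrite local_collar_in// => e; have [bp tp] := push_in bx.
  have [h|h] := leP 0 (signed_depth (to c x)).
    by left; rewrite -[u]/((y, u).2) -e /push /= pospart_le0 ?oppr_le0.
  right; move: bp tp; rewrite e /= (pospart_le0 (ltW h)) => b_y ty.
  have bdy : bd y.
    by apply/(chart_bd b_y.1); rewrite ty depth_baseD.
  have [_ ->//] := local_collar_bd bdy.
  have -> : u = - signed_depth (to c x).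
    by rewrite -[u]/((y, u).2) -e /push /= pospart_ge0// oppr_ge0 ltW.
  split=> //; rewrite oppr_ge0 (ltW h) /= ty bump_baseD /signed_depth opprB.
  have /andP[b0 _] := bump_box bx.2; case: bx => _ [/andP[d0 _] _].
  by rewrite lerBlDr lerDl mulr_ge0// addr_ge0.
have [bY|nbY] := pselect (box_dom y).
  have /andP[b0 b1] := bump_box bY.2; case: (bY) => dy [/andP[d0 d1] _].
  have br : 0 <= bump (to c y) * r by rewrite mulr_ge0// ltW.
  case=> [->|[bdy]].
    by apply: onto => //; [left|rewrite addr_ge0].
  have [_ ->//] := local_collar_bd bdy => /andP[u0 u1].
  have dy0 : depth (to c y) = 0 by exact/(chart_bd dy).
  by apply: onto => //; [right|rewrite dy0 addr0].
case=> [->|[_]]; first by exists y => //; rewrite local_collar_out.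
rewrite local_collar_out//= -eq_le => /eqP <-.
by exists y => //; rewrite local_collar_out.
Qed.

End LocalCollar.

Lemma compact_collar (R : realType) (X : topologicalType) (bd : set X) (n : nat) :
  hausdorff_space X -> compact bd ->
  (forall b, bd b -> exists c : chart R bd n.+1, dom c b) ->
  exists F : X -> X * R, outer_collar bd F /\ forall b, bd b -> 0 < (F b).2.
Proof.
move=> hX cbd ch; apply: outer_collar_exists => // b bb.
have [c db] := ch _ bb; have [r r0 rcod] := box_exists db.
by exists (local_collar c b r); exact: (local_collar_outer hX db bb r0 rcod).
Qed.

(** * The collapse onto the disk *)

Lemma prod_hausdorff (S T : topologicalType) :
  hausdorff_space S -> hausdorff_space T -> hausdorff_space (S * T)%type.
Proof.
move=> hS hT [p1 p2] [q1 q2] cl; congr pair.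
  apply: hS => A B nA nB.
  have [||[x y] /= [[? ?] [? ?]]] := cl (A `*` setT) (B `*` setT); last by exists x.
    by exists (A, setT) => //; split => //; exact: filterT.
  by exists (B, setT) => //; split => //; exact: filterT.
apply: hT => A B nA nB.
have [||[x y] /= [[? ?] [? ?]]] := cl (setT `*` A) (setT `*` B); last by exists y.
  by exists (setT, A) => //; split => //; exact: filterT.
by exists (setT, B) => //; split => //; exact: filterT.
Qed.

Section Subtypes.
Variables (X : topologicalType) (A : set X).

Lemma set_val_continuous : continuous (set_val : A -> X).
Proof. exact: initial_continuous. Qed.

Lemma set_val_inj : injective (set_val : A -> X).
Proof. exact: val_inj. Qed.

Lemma subtype_continuous (T : topologicalType) (f : T -> A) :
  continuous (set_val \o f) -> continuous f.
Proof. exact: continuous_comp_initial. Qed.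

Lemma subtype_within_continuous (T : topologicalType) (B : set T) (f : T -> A) :
  {within B, continuous (set_val \o f)} -> {within B, continuous f}.
Proof. exact: continuous_comp_initial. Qed.

Lemma subtype_hausdorff : hausdorff_space X -> hausdorff_space A.
Proof. exact: (injective_hausdorff set_val_continuous set_val_inj). Qed.

Lemma subtype_compact : compact A -> compact [set: A].
Proof.
move=> cA; have [[x0 _]|/forallNP n] := pselect (exists x : A, True); last first.
  rewrite (_ : [set: A] = set0); first exact: compact0.
  by apply/seteqP; split => // x; have := n x.
pose g (x : X) : A := insubd x0 x.
have gK (x : A) : g (set_val x) = x by rewrite /g valKd.
have gc : {within A, continuous g}.
  apply/subspace_sigL_continuousP; rewrite (_ : sigL A g = id).
    exact: continuous_idfun.
  by apply/funext => x; exact: gK.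
rewrite (_ : [set: A] = g @` A); first exact: continuous_compact gc cA.
by apply/seteqP; split => // x _; exists (set_val x); [exact: set_valP|exact: gK].
Qed.

End Subtypes.

Lemma embedding_left_inverse (S T : topologicalType) (f : S -> T) :
  hausdorff_space T -> compact [set: S] -> continuous f -> injective f ->
  [set: S] !=set0 ->
  exists g : T -> S, cancel f g /\ {within range f, continuous g}.
Proof.
move=> hT cS fc fi [s0 _].
pose g t := if pselect (exists s, f s = t) is left w then sval (cid w) else s0.
have fK : cancel f g.
  move=> s; rewrite /g; case: pselect => [w|[]]; last by exists s.
  by case: cid => s' /= /fi.
exists g; split => //.
apply: left_inverse_continuous => //; exact: continuous_subspaceT.
Qed.

(** * Rays from an interior point of the ball *)

Section Rays.
Variables (R : realType) (n : nat).
Implicit Types (p v w b : 'rV[R]_n).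

Definition dot v w : R := \sum_i v ord0 i * w ord0 i.

Lemma diskP v : disk R n v <-> dot v v <= 1.
Proof. by rewrite /disk /= /dot. Qed.

Lemma sphereP v : sphere R n v <-> dot v v = 1.
Proof. by rewrite /sphere /= /dot. Qed.

Lemma dot_ge0 v : 0 <= dot v v.
Proof. by apply: sumr_ge0 => i _; rewrite -expr2 sqr_ge0. Qed.

Lemma dot_eq0 v : dot v v = 0 -> v = 0.
Proof.
move=> v0; apply/rowP => i; rewrite mxE; apply/eqP; rewrite -sqrf_eq0 expr2.
have /psumr_eq0P/(_ _) : forall i, true -> 0 <= v ord0 i * v ord0 i.
  by move=> j _; rewrite -expr2 sqr_ge0.
by move=> /(_ v0) H; apply/eqP; exact: H.
Qed.

Lemma dot_ray p w (l : R) :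
  dot (p + l *: w) (p + l *: w) = dot p p + 2 * l * dot p w + l ^+ 2 * dot w w.
Proof.
rewrite /dot !mulr_sumr -!big_split /=; apply: eq_bigr => i _.
by rewrite !mxE; ring.
Qed.

Lemma disk_segment p b (u : R) : disk R n p -> disk R n b -> 0 <= u <= 1 ->
  disk R n (p + u *: (b - p)).
Proof.
move=> /diskP dp /diskP db /andP[u0 u1]; apply/diskP.
apply: (@le_trans _ _ ((1 - u) * dot p p + u * dot b b)); last by nra.
rewrite /dot !mulr_sumr -big_split /=; apply: ler_sum => i _; rewrite !mxE.
rewrite -subr_ge0; set x := p _ _; set y := b _ _.
rewrite (_ : _ - _ = u * (1 - u) * (x - y) ^+ 2); last by ring.
by rewrite mulr_ge0 ?sqr_ge0// mulr_ge0// subr_ge0.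
Qed.

(** On the line through [p] and [b'] the equation of the sphere is quadratic with root 1. The
    product of its roots has the sign of [dot p p - 1], so the other root is negative and does not
    lie on the ray. *)
Lemma ray_unique p b b' (u u' : R) : dot p p < 1 ->
  sphere R n b -> sphere R n b' -> 0 < u -> 0 < u' ->
  u *: (b - p) = u' *: (b' - p) -> u = u' /\ b = b'.
Proof.
move=> p1 /sphereP sb /sphereP sb' u0 u0' e.
pose l := u^-1 * u'.
have l0 : 0 < l by rewrite mulr_gt0// invr_gt0.
have bE : b = p + l *: (b' - p).
  by rewrite /l -scalerA -e scalerA mulVf ?gt_eqF// scale1r addrC subrK.
have b'E : b' = p + 1 *: (b' - p) by rewrite scale1r addrC subrK.
have C0 := dot_ge0 (b' - p).
rewrite bE dot_ray in sb; move: sb'; rewrite {1 2}b'E dot_ray => sb'.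
have l1 : l = 1.
  have : (1 - l) * (dot p p - l * dot (b' - p) (b' - p) - 1) = 0.
    move: sb sb'; set A := dot p p; set B := dot p (b' - p); set C := dot (b' - p) _.
    move=> sb sb'.
    rewrite (_ : _ * _ = (A + 2 * l * B + l ^+ 2 * C - 1) -
      l * (A + 2 * 1 * B + 1 ^+ 2 * C - 1)); last by ring.
    by rewrite sb sb' subrr mulr0 subr0.
  move/eqP; rewrite mulf_eq0 => /orP[/eqP|/eqP]; first by lra.
  by have := mulr_ge0 (ltW l0) C0; lra.
split; last by rewrite bE l1 -b'E.
have : u * l = u * 1 by rewrite l1.
by rewrite /l mulVKf ?gt_eqF// mulr1 => ->.
Qed.

Lemma ray_exists p d : dot p p < 1 -> disk R n d -> d != p ->
  exists b u, [/\ sphere R n b, 0 < u <= 1 & d = p + u *: (b - p)].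
Proof.
move=> p1 /diskP d1 dp; pose w := d - p.
have C0 : 0 < dot w w.
  rewrite lt_neqAle dot_ge0 andbT eq_sym; apply: contra_neq dp => /dot_eq0 w0.
  by apply/eqP; rewrite -subr_eq0 -/w w0.
have dE : d = p + 1 *: w by rewrite scale1r addrC subrK.
move: d1; rewrite {1 2}dE dot_ray.
set A := dot p p in p1 *; set C := dot w w in C0 *; set B := dot p w => d1.
have D0 : 0 <= B ^+ 2 + C * (1 - A) by rewrite addr_ge0 ?sqr_ge0// mulr_ge0 ?ltW ?subr_gt0.
pose s := Num.sqrt (B ^+ 2 + C * (1 - A)).
have s0 : 0 <= s by exact: sqrtr_ge0.
have s2 : s ^+ 2 = B ^+ 2 + C * (1 - A) by rewrite sqr_sqrtr.
have sl : C + B <= s by nra.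
(* The positive root of [A + 2 l B + l^2 C = 1]. As [d], at parameter 1, lies in the disk, this root
   is at least 1, and its inverse is the required [u]. *)
pose l := (s - B) / C.
have l1 : 1 <= l by rewrite /l ler_pdivlMr// mul1r; lra.
have l0 : 0 < l by lra.
exists (p + l *: w), l^-1; split.
- apply/sphereP; rewrite dot_ray -/A -/B -/C.
  have : l * C = s - B by rewrite /l divfK ?gt_eqF.
  move=> lC; have E : C * (A + 2 * l * B + l ^+ 2 * C) = C.
    rewrite !mulrDr [C * (2 * l * B)](_ : _ = 2 * (l * C) * B); last by ring.
    rewrite [C * (l ^+ 2 * C)](_ : _ = (l * C) ^+ 2); last by ring.
    rewrite lC sqrrB s2; ring.
  by apply: (mulfI (lt0r_neq0 C0)); rewrite E mulr1.
- by rewrite invr_gt0 l0 /= invf_le1.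
- rewrite (_ : p + l *: w - p = l *: w); last by rewrite addrAC subrr add0r.
  by rewrite scalerA mulVf ?gt_eqF// scale1r addrC subrK.
Qed.

Lemma dot_continuous : continuous (fun v : 'rV[R]_n => dot v v).
Proof.
rewrite /dot; move: (index_enum _) => r; elim: r => [|i r ih].
  under eq_fun do rewrite big_nil; exact: continuous_cst.
under eq_fun do rewrite big_cons; apply: continuous_funD => //.
by apply: continuous_funM; exact: coord_continuous.
Qed.

Lemma disk_compact : compact (disk R n).
Proof.
have cubec : compact [set v : 'rV[R]_n | forall i, `[-1, 1]%classic (v ord0 i)].
  by apply: (@rV_compact R n (fun=> `[-1, 1]%classic)) => i; exact: segment_compact.
rewrite (_ : disk R n = [set v : 'rV[R]_n | forall i, `[-1, 1]%classic (v ord0 i)]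
  `&` (fun v => dot v v) @^-1` [set t | t <= 1]).
  apply: compact_closedI => //.
  by apply: closed_comp => [v _|]; [exact: dot_continuous|exact: closed_le].
apply/seteqP; split=> [v /diskP dv|v [_ /diskP//]]; split => // i.
have h : v ord0 i * v ord0 i <= 1.
  apply: le_trans dv; rewrite /dot (bigD1 i)//= lerDl.
  by apply: sumr_ge0 => j _; rewrite -expr2 sqr_ge0.
by rewrite /= in_itv /=; apply/andP; split; nra.
Qed.

Lemma sphere_compact : compact (sphere R n).
Proof.
rewrite (_ : sphere R n = disk R n `&` (fun v => dot v v) @^-1` [set t | 1 <= t]).
  apply: compact_closedI; first exact: disk_compact.
  by apply: closed_comp => [v _|]; [exact: dot_continuous|exact: closed_ge].
apply/seteqP; split=> [v /sphereP sv|v [/diskP h1 h2]].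
  by split; [apply/diskP|]; rewrite /= sv.
by apply/sphereP/eqP; rewrite eq_le h1.
Qed.

End Rays.

Section DiskCollapse.
Variables (R : realType) (n : nat) (X : topologicalType) (h : sphere R n -> X).
Variables (F : X -> X * R) (p : 'rV[R]_n).
Hypothesis hX : hausdorff_space X.
Hypothesis cX : compact [set: X].
Hypothesis X0 : [set: X] !=set0.
Hypothesis S0 : [set: sphere R n] !=set0.
Hypothesis hc : continuous h.
Hypothesis hi : injective h.
Hypothesis oF : outer_collar (range h) F.
Hypothesis F0 : forall b, range h b -> 0 < (F b).2.
Hypothesis p1 : dot p p < 1.

Let disk_center : disk R n p.
Proof. by apply/diskP; exact: ltW. Qed.

Let sphere_disk (b : sphere R n) : disk R n (set_val b).
Proof. by apply: sphere_sub_disk; exact: set_valP. Qed.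

Definition ray_point (b : sphere R n) (u : R) : 'rV[R]_n :=
  p + u *: (set_val b - p).

Lemma collar_polar_exists (b : sphere R n) (u : R) : 0 <= u <= 1 ->
  exists x, F x = (h b, u * (F (h b)).2).
Proof.
move=> /andP[u0 u1]; have [_ _ _ rF] := oF.
have hb := F0 (ex_intro2 _ _ b Logic.I erefl).
have [x _ e] : range F (h b, u * (F (h b)).2).
  apply/rF; right; split; first by exists b.
  by rewrite /= mulr_ge0 ?(ltW hb)//= ler_piMl// ltW.
by exists x.
Qed.

Lemma collar_zero_exists (y : X) : exists x, F x = (y, 0).
Proof.
have [_ _ _ rF] := oF; have [x _ e] : range F (y, 0) by apply/rF; left.
by exists x.
Qed.

Variables (H : X -> sphere R n).
Hypothesis hK : cancel h H.
Hypothesis Hc : {within range h, continuous H}.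

(** [F] presents [X] as a copy of itself with an outer collar. The copy goes to [p], and the collar
    over [h b] goes to the segment from [p] to [b], with the relative height as parameter, so that
    the top of the collar goes to the sphere. *)
Definition collapse_vec (x : X) : 'rV[R]_n :=
  if (F x).2 == 0 then p
  else ray_point (H (F x).1) ((F x).2 / (F (F x).1).2).

Lemma collapse_vec_polar (x : X) (b : sphere R n) (u : R) : 0 <= u ->
  F x = (h b, u * (F (h b)).2) -> collapse_vec x = ray_point b u.
Proof.
move=> u0 e; have hb := F0 (ex_intro2 _ _ b Logic.I erefl).
rewrite /collapse_vec e /= mulf_eq0 (gt_eqF hb) orbF hK (mulfK (lt0r_neq0 hb)).
by have [->|//] := eqVneq u 0; rewrite /ray_point scale0r addr0.
Qed.

Lemma collar_polar (x : X) :
  ((F x).2 = 0 /\ collapse_vec x = p) \/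
  exists b u, [/\ 0 < u <= 1, F x = (h b, u * (F (h b)).2) &
    collapse_vec x = ray_point b u].
Proof.
have [_ _ _ rF] := oF.
have : range F (F x) by exists x.
move=> /rF[x0|]; first by left; rewrite /collapse_vec x0 eqxx.
case=> -[b _ eb] /andP[t0 t1]; have hb := F0 (ex_intro2 _ _ b Logic.I erefl).
have [x0|nx0] := eqVneq (F x).2 0; first by left; rewrite /collapse_vec x0 eqxx.
rewrite -eb in t1.
have u0 : 0 < (F x).2 / (F (h b)).2.
  by rewrite divr_gt0// lt_neqAle eq_sym nx0.
have e : F x = (h b, (F x).2 / (F (h b)).2 * (F (h b)).2).
  by rewrite divfK ?gt_eqF// eb -surjective_pairing.
right; exists b, ((F x).2 / (F (h b)).2); split => //.
  by rewrite u0 ler_pdivrMr// mul1r.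
by apply: collapse_vec_polar => //; exact: ltW.
Qed.

Lemma collapse_vec_disk x : disk R n (collapse_vec x).
Proof.
case: (collar_polar x) => [[_ ->//]|[b [u [/andP[u0 u1] _ ->]]]].
by apply: disk_segment => //; rewrite ltW.
Qed.

Lemma collapse_vec_continuous : continuous collapse_vec.
Proof.
have [Fc _ Fb rF] := oF.
have F1c := continuousT_comp Fc (@fst_continuous _ _).
have F2c := continuousT_comp Fc (@snd_continuous _ _).
have bdc : closed (range h).
  apply: compact_closed => //; apply: continuous_compact.
    exact: continuous_subspaceT.
  exact/subtype_compact/sphere_compact.
(* The two closed pieces overlap at height zero over the boundary, where the parameter on the ray is
   0 and both formulas give [p]. *)
pose C (c : bool) : set X :=
  if c then [set x | (F x).2 = 0] else [set x | range h (F x).1].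
suff : {within [set: X], continuous collapse_vec}.
  by move=> k x; have := k x; rewrite /continuous_at nbhs_subspaceT.
apply: (within_cover_continuous (C := C) (g := fun c => if c then cst p
  else fun x => ray_point (H (F x).1) ((F x).2 / (F (F x).1).2))).
- case.
    have -> : C true = (fun x => (F x).2) @^-1` [set 0] by [].
    apply: closed_comp => [x _|]; first exact: F2c.
    exact/accessible_closed_set1/hausdorff_accessible/Rhausdorff.
  have -> : C false = (fun x => (F x).1) @^-1` (range h) by [].
  by apply: closed_comp => [x _|//]; exact: F1c.
- move=> x _; have : range F (F x) by exists x.
  by move=> /rF[x0|[bx _]]; [exists true|exists false].
- case; first by apply: continuous_subspaceT => x; exact: cvg_cst.
  have HFc : {within C false, continuous (fun x => set_val (H (F x).1))}.
    have c1 : {within C false, continuous (fun x => (F x).1)}.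
      exact: continuous_subspaceT.
    have c2 := within_continuous_compW c1 Hc (fun x (k : C false x) => k).
    exact: (within_continuousT_comp c2 (@set_val_continuous _ _)).
  have FFc : {within C false, continuous (fun x => (F (F x).1).2)}.
    by apply: continuous_subspaceT; exact: (continuousT_comp F1c F2c).
  have F2c' : {within C false, continuous (fun x => (F x).2)}.
    exact: continuous_subspaceT.
  apply/subspace_continuousP => x Cx.
  move/subspace_continuousP : HFc => /(_ _ Cx) HFc.
  move/subspace_continuousP : FFc => /(_ _ Cx) FFc.
  move/subspace_continuousP : F2c' => /(_ _ Cx) F2c'.
  apply: cvgD; first exact: cvg_cst.
  apply: cvgZ; last by apply: cvgB; [exact: HFc|exact: cvg_cst].
  apply: cvgM; first exact: F2c'.
  by apply: cvgV; [rewrite gt_eqF//; exact: F0|exact: FFc].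
- case=> x /= Cx; first by rewrite /collapse_vec Cx eqxx.
  rewrite /collapse_vec; have [->|//] := eqVneq (F x).2 0.
  by rewrite mul0r /ray_point scale0r addr0.
Qed.

Lemma ray_point_eq (b b' : sphere R n) (u u' : R) : 0 < u -> 0 < u' ->
  ray_point b u = ray_point b' u' -> u = u' /\ b = b'.
Proof.
move=> u0 u0' /addrI /(ray_unique p1 (set_valP b) (set_valP b') u0 u0') [-> e].
by split => //; exact: set_val_inj.
Qed.

Lemma ray_point_neq (b : sphere R n) (u : R) : 0 < u -> ray_point b u <> p.
Proof.
move=> u0 /eqP; rewrite -subr_eq0 addrAC subrr add0r scaler_eq0 gt_eqF//=.
rewrite subr_eq0 => /eqP e.
have e1 : dot (set_val b) (set_val b) = 1 by exact: (iffLR (sphereP _) (set_valP b)).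
by move: (p1); rewrite -{1}e -{1}e e1 ltxx.
Qed.

Lemma collapse_vec_inj x y :
  collapse_vec x = collapse_vec y -> collapse_vec x <> p -> x = y.
Proof.
have [_ Fi _ _] := oF.
case: (collar_polar x) => [[_ ->//]|[b [u [/andP[u0 _] ex ->]]]].
case: (collar_polar y) => [[_ ->//]|[b' [u' [/andP[u0' _] ey ->]]]].
by move=> /(ray_point_eq u0 u0')[eu eb] _; apply: Fi; rewrite ex ey eu eb.
Qed.

Lemma collapse_vec_surj d : disk R n d -> exists x, collapse_vec x = d.
Proof.
move=> dd; have [->|dp] := eqVneq d p.
  have [y _] := X0; have [x ex] := collar_zero_exists y.
  by exists x; rewrite /collapse_vec ex eqxx.
have [b [u [sb /andP[u0 u1] ->]]] := ray_exists p1 dd dp.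
pose b' : sphere R n := SigSub (mem_set sb).
have [|x ex] := @collar_polar_exists b' u; first by rewrite ltW.
by exists x; rewrite (collapse_vec_polar (ltW u0) ex).
Qed.

(** Multiplying the collar heights by [a] preserves the range of [F], so it defines an embedding of
    [X] in itself, which the collapse turns into scaling towards [p]. The preimage of a scaled disk
    is thus a copy of [X]. *)
Lemma collapse_shrink (a : R) : 0 < a <= 1 ->
  exists th : X -> X, [/\ continuous th, injective th &
    forall x, range th x <->
      exists2 d, disk R n d & collapse_vec x = p + a *: (d - p)].
Proof.
move=> /andP[a0 a1]; have [Fc Fi Fb rF] := oF.
have hXR : hausdorff_space (X * R)%type.
  by apply: prod_hausdorff => //; exact: Rhausdorff.
have [G [FK Gc]] := embedding_left_inverse hXR cX Fc Fi X0.
pose m x := ((F x).1, a * (F x).2).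
have rm x : range F (m x).
  apply/rF; have : range F (F x) by exists x.
  move=> /rF [x0|[bx /andP[x0 x1]]]; first by left; rewrite /= x0 mulr0.
  right; split => //; rewrite /= mulr_ge0 ?(ltW a0)//=.
  by apply: le_trans x1; rewrite ler_piMl.
have FGm x : F (G (m x)) = m x by have [z _ <-] := rm x; rewrite FK.
have mc : continuous m.
  apply: continuous_pair; first exact: (continuousT_comp Fc (@fst_continuous _ _)).
  apply: continuous_funM; first exact: continuous_cst.
  exact: (continuousT_comp Fc (@snd_continuous _ _)).
have mi : injective m.
  move=> x y [e1 e2]; apply: Fi.
  rewrite [LHS]surjective_pairing [RHS]surjective_pairing e1.
  by congr pair; apply: (mulfI (lt0r_neq0 a0)).
exists (G \o m); split.
- suff : {within [set: X], continuous (G \o m)}.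
    by move=> k x; have := k x; rewrite /continuous_at nbhs_subspaceT.
  exact: (within_continuous_compW (continuous_subspaceT mc) Gc (fun x _ => rm x)).
- by move=> x y /(congr1 F) /=; rewrite !FGm; exact: mi.
- move=> x; split.
    case=> y _ <-; exists (collapse_vec y); first exact: collapse_vec_disk.
    have Fe := FGm y; case: (collar_polar y) => [[y0 ->]|[b [u [/andP[u0 u1] ey ->]]]].
      by rewrite subrr scaler0 addr0 /collapse_vec /= Fe /= y0 mulr0 eqxx.
    rewrite (@collapse_vec_polar (G (m y)) b (a * u)).
    + by rewrite /ray_point addrAC subrr add0r scalerA.
    + by rewrite mulr_ge0// ltW.
    + by rewrite Fe /m ey /= mulrA.
  case=> d dd e; case: (collar_polar x) => [[x0 _]|[b [u [/andP[u0 u1] ex e']]]].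
    exists x => //=; rewrite -[RHS]FK; congr G.
    by rewrite /m x0 mulr0 [RHS]surjective_pairing x0.
  have dp : d != p.
    apply/eqP => dp; move: e; rewrite dp subrr scaler0 addr0 e'.
    exact: ray_point_neq.
  have [b' [u' [sb' /andP[u0' u1'] de]]] := ray_exists p1 dd dp.
  pose b1 : sphere R n := SigSub (mem_set sb').
  have [] := @ray_point_eq b b1 u (a * u') u0 (mulr_gt0 a0 u0').
    by rewrite -e' e de /ray_point addrAC subrr add0r scalerA.
  move=> eu eb; have [|y ey] := @collar_polar_exists b u'; first by rewrite ltW.
  exists y => //=; rewrite -[RHS]FK; congr G.
  by rewrite /m ey ex /= eu mulrA.
Qed.

End DiskCollapse.

Lemma disk_collapse_exists (R : realType) (n : nat) (X : topologicalType)
    (h : sphere R n -> X) (F : X -> X * R) (p : 'rV[R]_n) :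
  hausdorff_space X -> compact [set: X] -> [set: X] !=set0 ->
  [set: sphere R n] !=set0 -> continuous h -> injective h ->
  outer_collar (range h) F -> (forall b, range h b -> 0 < (F b).2) ->
  dot p p < 1 ->
  exists k : X -> disk R n,
    [/\ continuous k, forall s, k (h s) = sphere_in_disk R n s,
      forall d, exists x, k x = d,
      forall x y, k x = k y -> set_val (k x) <> p -> x = y &
      forall a, 0 < a <= 1 -> exists th : X -> X,
        [/\ continuous th, injective th & forall x, range th x <->
          exists d : disk R n, set_val (k x) = p + a *: (set_val d - p)]].
Proof.
move=> hX cX X0 S0 hc hi oF F0 p1.
have cS : compact [set: sphere R n] by exact/subtype_compact/sphere_compact.
have [H [hK Hc]] := embedding_left_inverse hX cS hc hi S0.
pose k x : disk R n := SigSub (mem_set (collapse_vec_disk oF F0 p1 hK x)).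
have kE x : set_val (k x) = collapse_vec F p H x by [].
exists k; split.
- apply: subtype_continuous.
  exact: (collapse_vec_continuous hX hc oF F0 Hc).
- move=> s; apply: set_val_inj; rewrite kE.
  have [_ _ Fb _] := oF.
  rewrite (collapse_vec_polar p F0 hK (u := 1) (b := s))//.
    by rewrite /ray_point scale1r addrC subrK.
  by rewrite mul1r [LHS]surjective_pairing Fb//; exists s.
- move=> d; have [x ex] := collapse_vec_surj X0 oF F0 p1 hK (set_valP d).
  by exists x; exact: set_val_inj.
- move=> x y e; apply: (collapse_vec_inj oF F0 p1 hK).
  by rewrite -!kE e.
- move=> a a01; have [th [thc thi thr]] := collapse_shrink hX cX X0 oF F0 p1 hK a01.
  exists th; split => // x; rewrite thr; split=> [[d dd e]|[d e]].
    by exists (SigSub (mem_set dd)).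
  by exists (set_val d) => //; exact: set_valP.
Qed.

(** * Pulling surfaces back *)

(** The maps are inverse to each other only over [O], and [W] is the trace of [O] in the coordinates
    of the chart. With [O] the complement of a point, this transports charts along the collapse,
    which is no homeomorphism over [p]. *)
Lemma chart_pull (R : realType) (T T' : topologicalType) (bd : set T)
    (bd' : set T') (n : nat) (al : T' -> T) (be : T -> T') (O : set T)
    (c : chart R bd n) (W : set 'rV[R]_n) :
  continuous al -> open O -> (forall z, O z -> {for z, continuous be}) ->
  (forall y, O (al y) -> be (al y) = y) -> (forall z, O z -> al (be z) = z) ->
  (forall y, O (al y) -> bd' y <-> bd (al y)) ->
  open W -> (forall v, cod c v -> halfspace v -> W v <-> O (from c v)) ->
  exists c' : chart R bd' n, [/\ dom c' = al @^-1` (dom c `&` O),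
    cod c' = cod c `&` W, to c' = to c \o al & from c' = be \o from c].
Proof.
move=> alc oO bec beK alK bdE oW WO.
have h1 : open (al @^-1` (dom c `&` O)).
  apply: open_comp; first by move=> x _; exact: alc.
  by apply: openI => //; exact: dom_open.
have h2 : open (cod c `&` W) by apply: openI => //; exact: cod_open.
have h3 : (to c \o al) @` (al @^-1` (dom c `&` O)) `<=`
    (cod c `&` W) `&` @halfspace R n.
  move=> _ [x [dx Ox] <-] /=; have [k1 k2] := chart_to dx.
  by split => //; split => //; apply/(WO _ k1 k2); rewrite chart_toK.
have h4 : (be \o from c) @` ((cod c `&` W) `&` @halfspace R n) `<=`
    al @^-1` (dom c `&` O).
  move=> _ [v [[cv Wv] hv] <-] /=; have Ov := iffLR (WO _ cv hv) Wv.
  by rewrite /preimage /= alK//; split => //; exact: chart_from.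
have h5 : {in al @^-1` (dom c `&` O), cancel (to c \o al) (be \o from c)}.
  by move=> x /set_mem [dx Ox] /=; rewrite chart_toK// beK.
have h6 : {in (cod c `&` W) `&` @halfspace R n, cancel (be \o from c) (to c \o al)}.
  move=> v /set_mem [[cv Wv] hv] /=; have Ov := iffLR (WO _ cv hv) Wv.
  by rewrite alK// chart_fromK.
have h7 : {within al @^-1` (dom c `&` O), continuous (to c \o al)}.
  apply: (within_continuous_compW (B := dom c) (continuous_subspaceT alc)).
    exact: to_continuous.
  by move=> x [].
have h8 : {within (cod c `&` W) `&` @halfspace R n, continuous (be \o from c)}.
  have fc : {within (cod c `&` W) `&` @halfspace R n, continuous (from c)}.
    have sub : (cod c `&` W) `&` @halfspace R n `<=` cod c `&` @halfspace R n.
      by move=> v [[]].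
    exact: continuous_subspaceW sub (@from_continuous _ _ _ _ c).
  apply: within_continuous_comp fc => z /set_mem [v [[cv Wv] hv] <-].
  by apply: bec; exact/(WO _ cv hv).
have h9 : (to c \o al) @` (al @^-1` (dom c `&` O) `&` bd') =
    (cod c `&` W) `&` @bounding_hyperplane R n.
  have tb := to_bd c.
  apply/seteqP; split.
    move=> _ [x [[dx Ox] bx] <-] /=.
    have : (to c @` (dom c `&` bd)) (to c (al x)).
      by exists (al x) => //; split => //; apply/bdE.
    rewrite tb => -[cv bv]; split => //; split => //.
    by have [k1 k2] := chart_to dx; apply/(WO _ k1 k2); rewrite chart_toK.
  move=> v [[cv Wv] bv].
  have : (cod c `&` @bounding_hyperplane R n) v by [].
  rewrite -tb => -[z [dz bz] ez].
  have Oz : O z.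
    by have [k1 k2] := chart_to dz; rewrite -(chart_toK dz) ; apply/WO => //; rewrite ez.
  have ez' := alK _ Oz; exists (be z); last by rewrite /= ez'.
  split; last by apply/bdE; rewrite ez'.
  by rewrite /preimage /= ez'.
by exists (@Chart R T' bd' n _ _ _ _ h1 h2 h3 h4 h5 h6 h7 h8 h9).
Qed.

Section Homeomorphisms.
Variables (R : realType) (T T' : topologicalType) (bd : set T) (bd' : set T').
Variables (al : T' -> T) (be : T -> T').
Hypotheses (alc : continuous al) (bec : continuous be).
Hypotheses (alK : cancel al be) (beK : cancel be al).
Hypothesis bdE : forall y, bd' y <-> bd (al y).

Lemma genus_homeo : (genus R bd' <= genus R bd)%E.
Proof.
apply: ereal_sup_le.
move=> _ [k [c [sc cb tc co]] <-]; exists k => //.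
exists (fun i => al \o c i); split.
- move=> i; have [cc ci] := sc i; split.
    exact: (continuousT_comp cc alc).
  by apply: inj_comp => //; exact: can_inj alK.
- move=> i _ [s _ <-] /= b; apply: (cb i (c i s)); first by exists s.
  exact/bdE.
- apply/trivIsetP => i j _ _ ij; apply/seteqP; split => // z [[s _ <-] [s' _ /=]].
  move=> /(can_inj alK) e; have /trivIsetP/(_ i j) := tc; move=> /(_ _ _ ij) => D.
  have : (range (c i) `&` range (c j)) (c i s).
    by split; [exists s|exists s'].
  by rewrite D.
- rewrite (_ : ~` _ = al @` (~` \bigcup_i range (c i))).
    apply: connected_continuous_connected => //; exact: continuous_subspaceT.
  apply/seteqP; split=> [z nz|_ [y ny <-] [i _ [s _ /= /(can_inj alK) e]]].
    exists (be z); last exact: beK.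
    by move=> [i _ [s _ e]]; apply: nz; exists i => //; exists s => //=; rewrite e.
  by apply: ny; exists i => //; exists s.
Qed.

Lemma chart_homeo (c : chart R bd 2) : exists c' : chart R bd' 2,
  [/\ dom c' = al @^-1` dom c, cod c' = cod c, to c' = to c \o al &
    from c' = be \o from c].
Proof.
have [||||||||c' [e1 e2 e3 e4]] := @chart_pull R T T' bd bd' 2 al be setT c setT.
- exact: alc.
- exact: openT.
- by move=> z _; exact: bec.
- by move=> y _; exact: alK.
- by move=> z _; exact: beK.
- by move=> y _; exact: bdE.
- exact: openT.
- by [].
by exists c'; split; rewrite ?e1 ?e2 ?setIT.
Qed.

Lemma orientable_homeo : orientable_surface R bd -> orientable_surface R bd'.
Proof.
move=> [atlas [cov comp]].
exists [set c' | exists2 c, atlas c & [/\ dom c' = al @^-1` dom c,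
  to c' = to c \o al & from c' = be \o from c]]; split.
  move=> y; have [c ac dc] := cov (al y); have [c' [e1 _ e2 e3]] := chart_homeo c.
  by exists c'; [exists c|rewrite e1].
move=> c' d' x [c ac [ec1 ec2 ec3]] [d ad [ed1 ed2 ed3]].
rewrite ec1 ed1 => dx dx' nbx.
have nb : ~ bd (al x) by move=> b; apply: nbx; exact/bdE.
have := comp c d (al x) ac ad dx dx' nb.
rewrite ec2 ec3 ed2.
(* The transported charts have the transition maps of the original ones, on the same sets. *)
rewrite (_ : (to d \o al) \o (be \o from c) = to d \o from c); last first.
  by apply/funext => v /=; rewrite beK.
rewrite (_ : (to c \o al) @` (al @^-1` dom c `&` al @^-1` dom d) =
  to c @` (dom c `&` dom d)) //.
apply/seteqP; split=> [_ [y [h1 h2] <-]|_ [z [h1 h2] <-]].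
  by exists (al y).
by exists (be z); rewrite /= ?beK//; split; rewrite /preimage /= beK.
Qed.

End Homeomorphisms.

Section Pullback.
Variables (R : realType) (D X : topologicalType) (bd : set D) (bd' : set X).
Variables (k : X -> D) (e : D -> X) (p : D) (F : set D).
Hypothesis kc : continuous k.
Hypothesis ke : cancel e k.
Hypothesis ek : forall x, k x <> p -> e (k x) = x.
Hypothesis ec : forall d, d <> p -> {for d, continuous e}.
Hypothesis kbd : forall x, k x <> p -> bd' x <-> bd (k x).
Hypothesis clp : closed [set p].
Hypothesis Fp : ~ F p.

Let Fnp d : F d -> d <> p. Proof. by move=> Fd dp; apply: Fp; rewrite -dp. Qed.

Lemma section_within_surface : {within F, continuous e}.
Proof.
by apply: continuous_in_subspaceT => d /set_mem /Fnp; exact: ec.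
Qed.

Lemma preimage_surface_image : k @^-1` F = e @` F.
Proof.
apply/seteqP; split=> [x Fx|_ [d Fd <-]]; last by rewrite /preimage /= ke.
by exists (k x) => //; rewrite ek//; exact: Fnp.
Qed.

Lemma preimage_connected : connected F -> connected (k @^-1` F).
Proof.
move=> cF; rewrite preimage_surface_image.
by apply: connected_continuous_connected => //; exact: section_within_surface.
Qed.

Lemma preimage_locally_flat (n m : nat) :
  locally_flat R bd n m F -> locally_flat R bd' n m (k @^-1` F).
Proof.
move=> lf x Fx; have [c [dx cF]] := lf _ Fx.
(* The flat chart is punctured at [p]. This removes no point of [F]; if [p] is outside the chart,
   [W] is everything. *)
pose W : set 'rV[R]_n := [set v | ~ (dom c p /\ v = to c p)].
have oW : open W.
  have [dp|ndp] := pselect (dom c p); last first.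
    rewrite (_ : W = setT); first exact: openT.
    by apply/seteqP; split => // v _ [].
  rewrite (_ : W = ~` [set to c p]).
    apply: closed_openC; apply/accessible_closed_set1/hausdorff_accessible.
    exact: norm_hausdorff.
  by apply/seteqP; split=> v /= nv; [move=> ev; apply: nv|move=> [_]; exact: nv].
have [||||||||c' [e1 e2 e3 e4]] := @chart_pull R D X bd bd' n k e (~` [set p]) c W.
- exact: kc.
- exact: closed_openC.
- exact: ec.
- exact: ek.
- by move=> z _; exact: ke.
- exact: kbd.
- exact: oW.
- move=> v cv hv.
  have dv := chart_from cv hv; have tv := chart_fromK cv hv.
  split=> [nW /= ep|np [dp ev]]; first by apply: nW; rewrite -ep tv.
  by apply: np; rewrite ev; exact: chart_toK.
exists c'; rewrite e1 e2 e3; split.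
  by split => //; exact: Fnp.
apply/seteqP; split.
  move=> _ [y [[dy npy] Fy] <-] /=.
  have : (to c @` (dom c `&` F)) (to c (k y)) by exists (k y).
  rewrite cF => -[[cv hv] pv]; split => //; split => //; split => // -[dp ep].
  by apply: npy; rewrite /= -(chart_toK dy) ep chart_toK.
move=> v [[[cv Wv] hv] pv].
have : (cod c `&` @halfspace R n `&` @coordinate_plane R m n) v by [].
rewrite -cF => -[z [dz Fz] <-]; exists (e z); last by rewrite /= ke.
by split; rewrite /preimage /= ke //; split => //; exact: Fnp.
Qed.

Let G : set X := k @^-1` F.

Definition surface_down (y : G) : F :=
  SigSub (mem_set (set_valP y : F (k (set_val y)))).

Lemma surface_up_subproof (z : F) : G (e (set_val z)).
Proof. by have : F (k (e (set_val z))) by rewrite ke; exact: set_valP. Qed.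

Definition surface_up (z : F) : G := SigSub (mem_set (surface_up_subproof z)).

Lemma surface_down_continuous : continuous surface_down.
Proof.
apply: subtype_continuous.
exact: (continuousT_comp (@set_val_continuous _ _) kc).
Qed.

Lemma surface_up_continuous : continuous surface_up.
Proof.
apply: subtype_continuous => z.
apply: (@continuous_comp _ _ _ set_val e); first exact: set_val_continuous.
by apply: ec; apply: Fnp; exact: set_valP.
Qed.

Lemma surface_downK : cancel surface_down surface_up.
Proof.
move=> y; apply: set_val_inj; rewrite [LHS]/=; apply: ek.
by apply: Fnp; exact: (set_valP y).
Qed.

Lemma surface_upK : cancel surface_up surface_down.
Proof. by move=> z; apply: set_val_inj; exact: ke. Qed.

Lemma surface_bd (y : G) : (set_val @^-1` bd' : set (G : Type)) y <->
  (set_val @^-1` bd : set (F : Type)) (surface_down y).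
Proof. by apply: kbd; apply: Fnp; exact: (set_valP y). Qed.

Lemma preimage_genus :
  (genus R (set_val @^-1` bd' : set (G : Type)) <=
   genus R (set_val @^-1` bd : set (F : Type)))%E.
Proof.
exact: (genus_homeo R surface_down_continuous surface_downK surface_upK surface_bd).
Qed.

Lemma preimage_orientable :
  orientable_surface R (set_val @^-1` bd : set (F : Type)) ->
  orientable_surface R (set_val @^-1` bd' : set (G : Type)).
Proof.
exact: (orientable_homeo surface_down_continuous surface_up_continuous
  surface_downK surface_upK surface_bd).
Qed.

Lemma preimage_spanning (K : set D) (K' : set X) :
  hausdorff_space D -> compact [set: X] ->
  (forall x, k x <> p -> K' x <-> K (k x)) -> (forall x, K' x -> k x <> p) ->
  spanning_surface R bd K F -> spanning_surface R bd' K' G.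
Proof.
move=> hD cX KK Kp [cF coF lf Fb orF]; split.
- apply: (subclosed_compact _ cX) => //; apply: closed_comp => [x _|].
    exact: kc.
  exact: compact_closed.
- exact: preimage_connected.
- exact: preimage_locally_flat.
- apply/seteqP; split=> [x [Fx bx]|x Kx].
    have np := Fnp Fx; apply/(KK _ np); rewrite -Fb; split => //.
    exact/(kbd np).
  have np := Kp _ Kx.
  have : (F `&` bd) (k x) by rewrite Fb; exact/(KK _ np).
  by move=> [? ?]; split => //; exact/(kbd np).
- exact: preimage_orientable.
Qed.

End Pullback.

(* A point of the chart pushed off the coordinate plane and into the interior. *)
Lemma locally_flat_interior_point (R : realType) (T : topologicalType)
    (bd F : set T) (n m : nat) :
  (0 < m <= n)%N -> locally_flat R bd n.+1 m F -> F !=set0 ->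
  exists d, ~ F d /\ ~ bd d.
Proof.
move=> /andP[m0 mn] lf [x Fx]; have [c [dx cF]] := lf _ Fx.
have [cv hv] := chart_to dx; set v := to c x in cv hv.
have := cF; have : (to c @` (dom c `&` F)) v by exists x.
rewrite cF => -[_ pv] _.
pose w : 'rV[R]_n.+1 := delta_mx ord0 ord0 + delta_mx ord0 ord_max.
have /nbhs_ballP[r /= r0 sub] : nbhs v (cod c).
  by apply: open_nbhs_nbhs; split => //; exact: cod_open.
pose t := r / (1 + `|w|) / 2.
have w1 : 0 < 1 + `|w| by rewrite ltr_pwDl.
have t0 : 0 < t by rewrite /t !divr_gt0.
pose v' := v + t *: w.
have cv' : cod c v'.
  apply: sub; rewrite -ball_normE /ball_ /= /v' opprD addrA subrr add0r normrN.
  rewrite normrZ (gtr0_norm t0) /t -!mulrA.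
  rewrite gtr_pMr//; rewrite mulrCA mulrC -mulrA.
  have : (1 + `|w|)^-1 * `|w| <= 1.
    by rewrite ler_pdivrMl// mulr1 lerDr.
  by rewrite mulrC; lra.
have n0 : (ord_max == ord0 :> 'I_n.+1) = false.
  by apply/negbTE; rewrite -val_eqE /= -lt0n (leq_trans m0).
have v0' : v' ord0 ord0 = v ord0 ord0 + t.
  by rewrite !mxE !eqxx /= eq_sym n0 addr0 mulr1.
have vm' : v' ord0 ord_max = t.
  by rewrite !mxE !eqxx /= n0 (pv ord_max) ?add0r ?mulr1 //= .
have hv' : halfspace v'.
  by apply/halfspaceP; rewrite v0' addr_ge0 ?(ltW t0)//; exact/halfspaceP.
have dd := chart_from cv' hv'; have td := chart_fromK cv' hv'.
exists (from c v'); split.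
  move=> Fd; have : (to c @` (dom c `&` F)) v' by exists (from c v').
  rewrite cF => -[_ /(_ ord_max mn)]; rewrite vm' => E.
  by rewrite E ltxx in t0.
move/(chart_bd dd); rewrite td v0'; have := iffLR (halfspaceP _) hv; lra.
Qed.

Local Open Scope quotient_scope.

(** * Doubles *)

Section Doubles.
Variables (X : topologicalType) (bd : set X).
Local Notation DX := (double_space bd).

Definition double_pt (x : X) (b : bool) : DX := \pi_DX (x, b).

Lemma double_pt_eq x y b c :
  double_pt x b = double_pt y c <-> x = y /\ (b = c \/ bd x).
Proof.
rewrite /double_pt; split.
  by move=> /eqmodP /asboolP.
by move=> H; apply/eqmodP/asboolP.
Qed.

Lemma double_pt_surj (z : DX) : exists x b, z = double_pt x b.
Proof.
exists (repr z).1, (repr z).2; rewrite /double_pt -surjective_pairing.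
by rewrite reprK.
Qed.

Lemma bool_slice_continuous (T : topologicalType) (f : X * bool -> T) :
  (forall b, continuous (fun x => f (x, b))) -> continuous f.
Proof.
move=> fc [x b] O nO; have := fc b x O nO; rewrite /nbhs /= => nx.
exists ([set x' | O (f (x', b))], [set b]) => /=.
  by split => //; exact: discrete_set1.
by case=> x' b' /= [Ox' ->].
Qed.

Lemma double_pt_continuous b : continuous (double_pt^~ b).
Proof.
have pc : continuous (fun x : X => (x, b)).
  by apply: continuous_pair; [exact: continuous_idfun|exact: continuous_cst].
exact: (continuousT_comp pc (@pi_continuous _ _)).
Qed.

Lemma double_continuous (T : topologicalType) (f : DX -> T) :
  (forall b, continuous (fun x => f (double_pt x b))) -> continuous f.
Proof.
by move=> fc; apply/quotient_continuous; apply: bool_slice_continuous => b; exact: fc.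
Qed.

Definition double_fold (z : DX) : X := (repr z).1.

Lemma double_repr x b : (repr (double_pt x b)).1 = x /\
  ((repr (double_pt x b)).2 = b \/ bd x).
Proof.
have : double_pt (repr (double_pt x b)).1 (repr (double_pt x b)).2 = double_pt x b.
  by rewrite {1}/double_pt -surjective_pairing reprK.
move=> /double_pt_eq [e1 e2]; split => //.
by rewrite -{2}e1.
Qed.

Lemma double_foldE x b : double_fold (double_pt x b) = x.
Proof. by have [] := double_repr x b. Qed.

Lemma double_fold_continuous : continuous double_fold.
Proof.
apply: double_continuous => b; under eq_fun do rewrite double_foldE.
exact: continuous_idfun.
Qed.

Lemma double_subsetE (F : set X) x b :
  (double_subset F : set DX) (double_pt x b) <-> F x.
Proof.
split; last by move=> Fx; exists (x, b).
by case=> -[y c] /= [Fy _] /double_pt_eq [<-].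
Qed.

Lemma double_compact : compact [set: X] -> compact [set: DX].
Proof.
move=> cX.
rewrite (_ : [set: DX] = (double_pt^~ true @` setT) `|` (double_pt^~ false @` setT)).
  by apply: compactU; apply: continuous_compact => //;
    apply: continuous_subspaceT; exact: double_pt_continuous.
apply/seteqP; split => // z _; have [x [b ->]] := double_pt_surj z.
by case: b; [left|right]; exists x.
Qed.

(** A function vanishing exactly on the boundary gives a continuous injection of the double into
    [X * R]: the sign of the second coordinate tells the sheets apart. *)
Lemma double_hausdorff (R : realType) (phi : X -> R) :
  hausdorff_space X -> continuous phi -> (forall x, 0 <= phi x) ->
  (forall x, phi x = 0 <-> bd x) -> hausdorff_space DX.
Proof.
move=> hX pc p0 pbd.
pose g (z : DX) : X * R := (double_fold z,
  if (repr z).2 then phi (double_fold z) else - phi (double_fold z)).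
have gE x b : g (double_pt x b) = (x, if b then phi x else - phi x).
  rewrite /g double_foldE; have [_ [->//|/pbd px]] := double_repr x b.
  by rewrite px oppr0 !if_same.
apply: (@injective_hausdorff _ _ g).
- apply: double_continuous => b; under eq_fun do rewrite gE.
  apply: continuous_pair; first exact: continuous_idfun.
  by case: b => //; exact: continuous_funN.
- move=> z z'; have [x [b ->]] := double_pt_surj z.
  have [y [c ->]] := double_pt_surj z'; rewrite !gE => -[-> e].
  apply/double_pt_eq; split => //; have := p0 y.
  case: b c e => -[] e py; try by left.
  + by right; apply/pbd; lra.
  + by right; apply/pbd; lra.
- by apply: prod_hausdorff => //; exact: Rhausdorff.
Qed.

Section Chunks.
Variables (R : realType) (T : topologicalType) (F : set X).
Variables (th : T -> X) (rho : X -> T).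
Hypothesis scT : simply_connected R T.
Hypothesis thc : continuous th.
Hypothesis thK : cancel th rho.
Hypothesis rhoc : {within range th, continuous rho}.
Hypothesis thF : forall t, ~ F (th t).

Lemma double_chunk_subproof b t : (~` double_subset F : set DX) (double_pt (th t) b).
Proof. by move/double_subsetE; exact: thF. Qed.

Definition double_chunk b (t : T) : (~` double_subset F : set DX) :=
  SigSub (mem_set (@double_chunk_subproof b t)).

(** Folding the double and applying [rho] inverts the chunk continuously, so the simple connectivity
    of [T] carries over to its copy in one sheet. *)
Lemma double_chunk_sc b :
  path_joined R (range (double_chunk b)) /\ fillable R (range (double_chunk b)).
Proof.
apply: (@simply_connected_image _ _ _ _ (rho \o (double_fold \o set_val))) => //.
- by apply: subtype_continuous; exact: (continuousT_comp thc (@double_pt_continuous b)).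
- have fc : continuous (double_fold \o (set_val : (~` double_subset F : set DX) -> DX)).
    exact: (continuousT_comp (@set_val_continuous _ _) double_fold_continuous).
  have fcw := @continuous_subspaceT _ _ (range (double_chunk b)) _ fc.
  apply: (within_continuous_compW fcw rhoc) => _ [t _ <-].
  by exists t => //; rewrite /= double_foldE.
- by move=> t; rewrite /= double_foldE thK.
Qed.

End Chunks.

End Doubles.

Section DoubleMap.
Variables (X D : topologicalType) (bdX : set X) (bdD : set D).
Variable k : X -> D.
Hypothesis kbd : forall x, bdX x -> bdD (k x).

Definition double_map (z : double_space bdX) : double_space bdD :=
  double_pt bdD (k (repr z).1) (repr z).2.

Lemma double_mapE x b : double_map (double_pt bdX x b) = double_pt bdD (k x) b.
Proof.
have [e1 e2] := double_repr bdX x b; apply/double_pt_eq; rewrite e1.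
by split => //; case: e2 => [->|/kbd]; [left|right].
Qed.

Lemma double_map_continuous : continuous k -> continuous double_map.
Proof.
move=> kc; apply: double_continuous => b; under eq_fun do rewrite double_mapE.
exact: (continuousT_comp kc (@double_pt_continuous _ _ b)).
Qed.

End DoubleMap.

Lemma subtype_continuous_at (X : topologicalType) (A : set X)
    (T : topologicalType) (f : T -> A) (t : T) :
  {for t, continuous (set_val \o f)} -> {for t, continuous f}.
Proof.
move=> cf U [? /= [[W oW <-]]] /= Wft /filterS; apply; apply: cf.
exact: open_nbhs_nbhs.
Qed.

Section DiskSimplyConnected.
Variables (R : realType) (n : nat).

(** Paths are total functions on the line, hence the clamped parameter, which keeps every value in
    the disk. *)
Definition disk_mix (x y : disk R n) (u : R) : disk R n :=
  SigSub (mem_set (disk_segment (set_valP x) (set_valP y) (clamp_in u))).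

Lemma disk_mixE x y u :
  set_val (disk_mix x y u) = set_val x + clamp u *: (set_val y - set_val x).
Proof. by []. Qed.

Lemma disk_mix0 x y : disk_mix x y 0 = x.
Proof. by apply: set_val_inj; rewrite disk_mixE clamp_le0// scale0r addr0. Qed.

Lemma disk_mix1 x y : disk_mix x y 1 = y.
Proof. by apply: set_val_inj; rewrite disk_mixE clamp_ge1// scale1r addrC subrK. Qed.

Lemma disk_mixx x u : disk_mix x x u = x.
Proof. by apply: set_val_inj; rewrite disk_mixE subrr scaler0 addr0. Qed.

Lemma disk_simply_connected : simply_connected R (disk R n).
Proof.
have z : disk R n 0.
  by apply/diskP; rewrite /dot big1// => i _; rewrite mxE mul0r.
split; first split.
- by exists (SigSub (mem_set z)).
- move=> x y; exists (disk_mix x y); split.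
  + apply: continuous_subspaceT; apply: subtype_continuous.
    apply: continuous_funD; first exact: continuous_cst.
    by apply: continuous_funZ; [exact: clamp_continuous|exact: continuous_cst].
  + exact: disk_mix0.
  + exact: disk_mix1.
- move=> x g [gc g0 g1].
  exists (fun p => disk_mix (g p.2) x p.1); split.
  + apply: subtype_within_continuous.
    have vc : {within @square R, continuous (fun p : R * R => set_val (g p.2))}.
      have gc2 : {within @square R, continuous (g \o snd)}.
        by apply: (within_continuous_compW (@snd_within R _) gc) => q [].
      exact: (within_continuousT_comp gc2 (@set_val_continuous _ _)).
    have cc : {within @square R, continuous (fun p : R * R => clamp p.1)}.
      apply: continuous_subspaceT.
      exact: (continuousT_comp (@fst_continuous _ _) (@clamp_continuous R)).
    apply/subspace_continuousP => q sq.
    move/subspace_continuousP : vc => /(_ _ sq) vc.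
    move/subspace_continuousP : cc => /(_ _ sq) cc.
    apply: cvgD; first exact: vc.
    by apply: cvgZ; [exact: cc|apply: cvgB; [exact: cvg_cst|exact: vc]].
  + by move=> t _; exact: disk_mix0.
  + by move=> t _; exact: disk_mix1.
  + by move=> s _; rewrite /= g0 g1 disk_mixx.
Qed.

Lemma closed_disk_radius (F : set (disk R n)) (p : disk R n) :
  closed F -> ~ F p ->
  exists2 a : R, 0 < a < 1 & forall d d' : disk R n,
    set_val d = set_val p + a *: (set_val d' - set_val p) -> ~ F d.
Proof.
move=> cF nFp; have /closed_openC [W oW WF] := cF.
have Wp : W (set_val p) by have : (~` F) p := nFp; rewrite -WF.
have /nbhs_ballP[r /= r0 sub] : nbhs (set_val p) W by exact: open_nbhs_nbhs.
have /compact_bounded/ex_strict_bound_gt0 [M /= M0 MD] := @disk_compact R n.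
set v0 := set_val p in Wp sub *.
pose C := M + `|v0|.
have C0 : 0 < C by rewrite /C ltr_pwDl.
have k0 : 0 < 2 * r + C by rewrite addr_gt0// mulr_gt0.
(* All points of the disk are within [C] of [p], so scaling by this ratio moves them into the ball
   of radius [r]; the term [2 * r] keeps the ratio below 1. *)
exists (r / (2 * r + C)).
  by rewrite divr_gt0//= ltr_pdivrMr// mul1r; lra.
move=> d d' e; have : (set_val @^-1` W) d; last by rewrite WF.
apply: sub; rewrite -ball_normE /ball_ /= distrC e addrAC subrr add0r.
rewrite normrZ ger0_norm ?divr_ge0 ?ltW// mulrAC ltr_pdivrMr// ltr_pM2l//.
have h : `|set_val d'| < M by apply: MD; exact: set_valP.
have := ler_normB (set_val d') v0; rewrite /C in C0 k0 *; lra.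
Qed.

End DiskSimplyConnected.

Local Open Scope quotient_scope.

(** Nothing is identified off the boundary, so the preimage of the sheet in [D * bool] is the
    product of [O] with one point. *)
Lemma double_sheet_open (D : topologicalType) (bd : set D) (O : set D) (b : bool) :
  open O -> (forall d, O d -> ~ bd d) ->
  open ((fun d => double_pt bd d b) @` O).
Proof.
move=> oO Obd.
have E : (\pi_(double_space bd) : D * bool -> double_space bd) @^-1`
    ((fun d => double_pt bd d b) @` O) = fst @^-1` O `&` snd @^-1` [set b].
  apply/seteqP; split=> [[x c] [d Od] e|[x c] [/= Ox ->]]; last by exists x.
  have : double_pt bd d b = double_pt bd x c by exact: e.
  move=> /double_pt_eq [dx bc]; rewrite -dx; split => //=.
  by case: bc => // /(Obd _ Od).
suff : open (fst @^-1` O `&` snd @^-1` [set b] : set (D * bool)) by rewrite -E.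
apply: openI; apply: open_comp => //.
- by move=> x _; exact: cvg_fst.
- by move=> x _; exact: cvg_snd.
- exact: discrete_open.
Qed.

(** Here [u], [v], [w] stand for the scalar products of [p] and [d - p]: scaling a point [d] of the
    disk towards an interior [p] gives an interior point. The left side equals [a (u + 2 v + w) + (1
    - a) u - a (1 - a) w]. *)
Lemma chord_interior (R : realType) (a u v w : R) : 0 < a < 1 -> u < 1 ->
  0 <= w -> u + 2 * v + w <= 1 -> u + 2 * a * v + a ^+ 2 * w < 1.
Proof.
move=> /andP[a0 a1] u1 w0 h.
have h1 : a * (u + 2 * v + w) <= a by rewrite ger_pMr.
have h2 : 0 <= a * (1 - a) * w
    by apply: mulr_ge0 => //; apply: mulr_ge0; rewrite ?subr_ge0 ltW.
have h3 : 0 < (1 - a) * (1 - u) by rewrite mulr_gt0// subr_gt0.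
nra.
Qed.

(** * The doubled collapse on the complements of the doubled surfaces *)

Section DoubleCollapse.
Variables (R : realType) (n : nat) (X : topologicalType) (h : sphere R n -> X).
Variables (k : X -> disk R n) (p : disk R n) (F : set (disk R n)) (a : R).
Hypothesis cX : compact [set: X].
Hypothesis hX : hausdorff_space X.
Hypothesis scX : simply_connected R X.
Hypothesis kc : continuous k.
Hypothesis kh : forall s, k (h s) = sphere_in_disk R n s.
Hypothesis ksurj : forall d, exists x, k x = d.
Hypothesis kinj : forall x y, k x = k y -> k x <> p -> x = y.
Hypothesis a01 : 0 < a < 1.
Hypothesis Fa : forall d d' : disk R n,
    set_val d = set_val p + a *: (set_val d' - set_val p) -> ~ F d.
Hypothesis p1 : dot (set_val p) (set_val p) < 1.
Hypothesis kshrink : exists th : X -> X,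
  [/\ continuous th, injective th & forall x, range th x <->
    exists d : disk R n, set_val (k x) = set_val p + a *: (set_val d - set_val p)].

Local Notation D := (disk R n).
Local Notation bdD := (range (sphere_in_disk R n)).
Local Notation bdX := (range h).
Local Notation G := (k @^-1` F).
Local Notation A := (~` double_subset F : set (double_space bdD)).
Local Notation B := (~` double_subset G : set (double_space bdX)).

Definition shrunk_disk : set D :=
  [set d | exists d' : D, set_val d = set_val p + a *: (set_val d' - set_val p)].

Lemma disk_bd (d : D) : bdD d <-> dot (set_val d) (set_val d) = 1.
Proof.
split=> [[s _ <-]|d1].
  exact: (iffLR (sphereP _) (set_valP s)).
exists (SigSub (mem_set (iffRL (sphereP _) d1))) => //.
exact: set_val_inj.
Qed.

Lemma disk_le1 (d : D) : dot (set_val d) (set_val d) <= 1.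
Proof. exact: (iffLR (diskP _) (set_valP d)). Qed.

Lemma shrunk_disk_interior d : shrunk_disk d -> ~ bdD d.
Proof.
move=> [d' e] /disk_bd; rewrite e dot_ray.
have := disk_le1 d'; rewrite -{1 2}[set_val d'](subrKC (set_val p)).
rewrite -[set_val d' - _]scale1r dot_ray scale1r => h1 h2.
have /andP[a0 a1] := a01; have c0 := dot_ge0 (set_val d' - set_val p).
move: h1 h2 p1 c0; set u := dot _ _; set v := dot (set_val p) _; set w := dot _ _.
rewrite mulr1 expr1n mul1r => h1 h2 p1' c0.
by have := chord_interior a01 p1' c0 h1; rewrite h2 ltxx.
Qed.

Lemma center_shrunk : shrunk_disk p.
Proof. by exists p; rewrite subrr scaler0 addr0. Qed.

Lemma center_interior : ~ bdD p.
Proof. exact: shrunk_disk_interior center_shrunk. Qed.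

(** Injectivity of [k] away from [p] leaves a real choice only over [p], which is interior; so
    sphere points go back to the boundary of [X], as is required for doubling the section. *)
Lemma collapse_section : exists e : D -> X,
  [/\ cancel e k, forall x, k x <> p -> e (k x) = x &
    forall d, bdD d -> bdX (e d)].
Proof.
have /choice[e ke] := ksurj; exists e; split => //.
  by move=> x np; apply: kinj; rewrite ke.
move=> _ [s _ <-]; exists s => //; apply: kinj; rewrite ?ke ?kh//.
by move=> sp; apply: center_interior; rewrite -sp; exists s.
Qed.

Lemma collapse_bd x : bdX x -> bdD (k x).
Proof. by move=> [s _ <-]; rewrite kh; exists s. Qed.

Lemma double_disk_hausdorff : hausdorff_space (double_space bdD).
Proof.
apply: (@double_hausdorff _ _ R (fun d : D => 1 - dot (set_val d) (set_val d))).
- by apply: subtype_hausdorff; exact: norm_hausdorff.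
- apply: continuous_funB; first exact: continuous_cst.
  exact: (continuousT_comp (@set_val_continuous _ _) (@dot_continuous R n)).
- by move=> d; rewrite subr_ge0 disk_le1.
- move=> d; split=> [/eqP|/disk_bd ->]; last by rewrite subrr.
  by rewrite subr_eq0 eq_sym => /eqP /disk_bd.
Qed.

Lemma shrunk_nbhs (b : bool) :
  exists2 O : set (double_space bdD), open O /\ O (double_pt bdD p b) &
    forall z, O z -> exists2 d, shrunk_disk d & z = double_pt bdD d b.
Proof.
have /andP[a0 a1] := a01.
(* The open scaled disk: points whose magnification by [1 / a] from [p] is interior. *)
pose S : set D := [set d | dot (set_val p + a^-1 *: (set_val d - set_val p))
  (set_val p + a^-1 *: (set_val d - set_val p)) < 1].
have Ssub d : S d -> shrunk_disk d.
  move=> Sd; have Sd' := iffRL (diskP _) (ltW Sd); exists (SigSub (mem_set Sd')).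
  rewrite [X in _ = _ + a *: (X - _)](_ : _ = set_val p + a^-1 *: (set_val d - set_val p))//.
  rewrite [X in a *: X]addrAC subrr add0r scalerA.
  by rewrite mulfV ?gt_eqF// scale1r addrC subrK.
have oS : open S.
  have c1 : continuous (fun d : D => set_val p + a^-1 *: (set_val d - set_val p)).
    apply: continuous_funD; first exact: continuous_cst.
    apply: continuous_funZ; first exact: continuous_cst.
    apply: continuous_funB; last exact: continuous_cst.
    exact: set_val_continuous.
  have c2 := continuousT_comp c1 (@dot_continuous R n).
  have -> : S = (fun d : D => dot (set_val p + a^-1 *: (set_val d - set_val p))
    (set_val p + a^-1 *: (set_val d - set_val p))) @^-1` [set t | t < 1] by [].
  by apply: open_comp => [d _|]; [exact: c2|exact: open_lt].
exists ((fun d => double_pt bdD d b) @` S).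
  split; last by exists p => //; rewrite /S /= subrr scaler0 addr0.
  by apply: double_sheet_open => // d /Ssub; exact: shrunk_disk_interior.
by move=> _ [d /Ssub Sd <-]; exists d.
Qed.

Definition bad_points : set A := [set z | exists b, set_val z = double_pt bdD p b].
Definition patch (b : bool) : set A :=
  [set z | exists2 d, shrunk_disk d & set_val z = double_pt bdD d b].

Lemma patch_disj b c (z : A) : patch b z -> patch c z -> b = c.
Proof.
move=> [d sd e] [d' _]; rewrite e => /double_pt_eq [_ [//|bd']].
by case: (shrunk_disk_interior sd).
Qed.

Lemma patch_cov (z : A) : (\forall z' \near nbhs z, ~ bad_points z') \/
  exists b, \forall z' \near nbhs z, patch b z'.
Proof.
have [x [b xb]] := double_pt_surj (set_val z).
have svc := @set_val_continuous _ A.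
have [xp|nxp] := eqVneq x p.
  right; exists b; have [U [oU Up] US] := shrunk_nbhs b.
  have : \forall z' \near nbhs z, U (set_val z').
    apply: (svc z); apply: open_nbhs_nbhs; split => //.
    by rewrite xb xp.
  by apply: filterS => z' /US [d sd e]; exists d.
left.
have hD : hausdorff_space D by apply: subtype_hausdorff; exact: norm_hausdorff.
have fc := continuousT_comp svc (@double_fold_continuous D bdD).
have oN : open (~` [set p]).
  exact/closed_openC/accessible_closed_set1/hausdorff_accessible.
have : \forall z' \near nbhs z, (~` [set p]) ((@double_fold D bdD \o set_val) z').
  apply: (fc z); apply: open_nbhs_nbhs; split => //=.
  by rewrite xb double_foldE; exact/eqP.
by apply: filterS => z' np [c ec]; apply: np; rewrite /= ec double_foldE.
Qed.

Lemma double_collapse : exists (q : B -> A) (s : A -> B),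
  collapse R q s bad_points patch.
Proof.
have [e [ke ek ebd]] := collapse_section.
have [th [thc thi thr]] := kshrink.
have X0 : [set: X] !=set0 by case: scX => -[].
have [rho [thK rhoc]] := embedding_left_inverse hX cX thc thi X0.
have thF t : ~ G (th t).
  have [d dE] : exists d : D, set_val (k (th t)) =
      set_val p + a *: (set_val d - set_val p) by apply/thr; exists t.
  exact: (Fa dE).
pose Dk := @double_map _ _ bdX bdD k; pose De := @double_map _ _ bdD bdX e.
have DkE x b : Dk (double_pt bdX x b) = double_pt bdD (k x) b.
  exact: (double_mapE collapse_bd).
have DeE d b : De (double_pt bdD d b) = double_pt bdX (e d) b.
  exact: (double_mapE ebd).
have qP (y : B) : A (Dk (set_val y)).
  have [x [b xb]] := double_pt_surj (set_val y).
  have : ~ double_subset G (set_val y) := set_valP y.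
  rewrite xb DkE => nG; move/double_subsetE => Fx; apply: nG.
  exact/double_subsetE.
have sP (z : A) : B (De (set_val z)).
  have [d [b db]] := double_pt_surj (set_val z).
  have : ~ double_subset F (set_val z) := set_valP z.
  rewrite db DeE => nF; move/double_subsetE => Fx; apply: nF.
  by apply/double_subsetE; move: Fx; rewrite /preimage /= ke.
pose q (y : B) : A := SigSub (mem_set (qP y)).
pose s (z : A) : B := SigSub (mem_set (sP z)).
have qE y : set_val (q y) = Dk (set_val y) by [].
have sE z : set_val (s z) = De (set_val z) by [].
have DkK : cancel De Dk.
  by move=> z; have [d [b ->]] := double_pt_surj z; rewrite DeE DkE ke.
have DeK x b : k x <> p -> De (Dk (double_pt bdX x b)) = double_pt bdX x b.
  by move=> np; rewrite DkE DeE ek.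
have Dkc : continuous Dk := double_map_continuous collapse_bd kc.
(* The preimage of a patch is a copy of [X] inside one sheet, through which the simple connectivity
   of [X] is used. *)
have patchE b : q @^-1` patch b = range (@double_chunk X bdX X G th thF b).
  apply/seteqP; split=> [y [d sd]|_ [t _ <-]].
    have [x [c xc]] := double_pt_surj (set_val y).
    rewrite qE xc DkE => /double_pt_eq [kxd cb].
    have {}cb : c = b.
      by case: cb => // bdk; case: (shrunk_disk_interior sd); rewrite -kxd.
    have [t _ tx] : range th x by apply/thr; case: sd => d' e'; exists d'; rewrite kxd.
    by exists t => //; apply: set_val_inj; rewrite xc cb -tx.
  have : range th (th t) by exists t.
  move=> /thr [d dE]; exists (k (th t)); first by exists d.
  by rewrite qE -DkE.
exists q, s; split.
- apply: subtype_continuous.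
  exact: (continuousT_comp (@set_val_continuous _ _) Dkc).
- by move=> z; apply: set_val_inj; rewrite qE sE DkK.
- move=> y nb; apply: set_val_inj; rewrite sE qE.
  have [x [b xb]] := double_pt_surj (set_val y); rewrite xb DeK// => kxp.
  by apply: nb; exists b; rewrite qE xb DkE kxp.
- move=> z nb; apply: subtype_continuous_at.
  (* Away from the two copies of [p] the fibres of [Dk] are points, so compactness of the double
     makes the chosen section continuous there. *)
  have Dec : {for set_val z, continuous De}.
    apply: (section_continuous_at double_disk_hausdorff _ Dkc DkK).
      exact: double_compact.
    move=> w; have [x [b ->]] := double_pt_surj w => ew.
    rewrite -ew DeK// => kxp; apply: nb; exists b.
    by rewrite -ew DkE kxp.
  apply: (@continuous_comp _ _ _ set_val De) => //.
  exact: set_val_continuous.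
- exact: patch_disj.
- exact: patch_cov.
- move=> b; rewrite patchE.
  by have [] := @double_chunk_sc X bdX R X G th rho scX thc thK rhoc thF b.
- move=> b; rewrite patchE.
  by have [] := @double_chunk_sc X bdX R X G th rho scX thc thK rhoc thF b.
Qed.

(** A patch is a scaled copy of the convex disk in one sheet. This makes the identity a collapse
    with the same patches. *)
Lemma patch_sc b : path_joined R (patch b) /\ fillable R (patch b).
Proof.
have /andP[a0 a1] := a01.
have sp (d : D) : disk R n (set_val p + a *: (set_val d - set_val p)).
  by apply: disk_segment; [exact: set_valP|exact: set_valP|rewrite !ltW].
pose th (d : D) : D := SigSub (mem_set (sp d)).
have thE d : set_val (th d) = set_val p + a *: (set_val d - set_val p) by [].
have thc : continuous th.
  apply: subtype_continuous.
  apply: continuous_funD; first exact: continuous_cst.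
  apply: continuous_funZ; first exact: continuous_cst.
  apply: continuous_funB; last exact: continuous_cst.
  exact: set_val_continuous.
have thi : injective th.
  move=> d d' /(congr1 set_val); rewrite !thE => /addrI.
  move=> /(scalerI (lt0r_neq0 a0))/addIr; exact: set_val_inj.
have hD : hausdorff_space D by apply: subtype_hausdorff; exact: norm_hausdorff.
have cD : compact [set: D] by exact/subtype_compact/disk_compact.
have D0 : [set: D] !=set0 by exists p.
have [rho [thK rhoc]] := embedding_left_inverse hD cD thc thi D0.
have thF d : ~ F (th d) by exact: (Fa (thE d)).
have -> : patch b = range (@double_chunk D bdD D F th thF b).
  apply/seteqP; split=> [z [d [d' dd'] zd]|_ [t _ <-]].
    by exists d' => //; apply: set_val_inj; rewrite zd; congr double_pt; exact: set_val_inj.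
  by exists (th t) => //; exists t.
exact: (@double_chunk_sc D bdD R D F th rho (@disk_simply_connected R n)).
Qed.

Lemma double_collapse_Zsurface :
  Zsurface R (double_subset F : set (double_space bdD)) ->
  Zsurface R (double_subset G : set (double_space bdX)).
Proof.
move=> [pA zA]; have [q [s col]] := double_collapse.
have colA := collapse_id col patch_sc.
split; first exact: (collapse_path_connected col pA).
by move=> y; apply: (collapse_pi1_iso_int col colA); exact: zA.
Qed.

End DoubleCollapse.

Theorem theorem8p1 (R : realType) (K : set (sphere R 4))
    (X : topologicalType) (h : sphere R 4 -> X) :
  is_knot K ->
  continuous h -> injective h ->
  manifold R (range h) 4 ->
  simply_connected R X ->
  (superslice_genus h K <= superslice_genus (sphere_in_disk R 4) K)%E.
Proof.
move=> [[c _ cK] _] hc hi [hX _ cX _ ch] scX.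
have c0 : [set: sphere R 2] !=set0.
  have sv : sphere R 2 (delta_mx ord0 ord0).
    apply/sphereP; rewrite /dot (bigD1 ord0)//= big1 ?addr0 => [|i i0].
      by rewrite mxE !eqxx mulr1.
    by rewrite mxE (negbTE i0) andbF mul0r.
  by exists (SigSub (mem_set sv)).
have [s0 Ks0] : K !=set0 by rewrite -cK; case: c0 => z _; exists (c z); exists z.
have S0 : [set: sphere R 4] !=set0 by exists s0.
have X0 : [set: X] !=set0 by case: scX => -[].
have cS : compact [set: sphere R 4] by exact/subtype_compact/sphere_compact.
have cbd : compact (range h).
  by apply: continuous_compact => //; exact: continuous_subspaceT.
have [E [oE E0]] : exists E : X -> X * R, outer_collar (range h) E /\
    forall b, range h b -> 0 < (E b).2.
  by apply: (compact_collar hX cbd) => b _; exact: ch.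
(* Both sides are infima, so each competitor [F] in the disk only has to yield one in [X] of no
   larger genus. *)
apply: le_ereal_inf_tmp => _ [F [spF zF] <-].
have [cF _ lfF Fb _] := spF.
have hD : hausdorff_space (disk R 4) by apply: subtype_hausdorff; exact: norm_hausdorff.
(* [F] contains the nonempty knot, hence has a flat chart, in which such a point is found. *)
have [p [nFp nbp]] : exists p, ~ F p /\ ~ range (sphere_in_disk R 4) p.
  apply: (locally_flat_interior_point _ lfF) => //.
  have : (sphere_in_disk R 4 @` K) (sphere_in_disk R 4 s0) by exists s0.
  by rewrite -Fb => -[? _]; exists (sphere_in_disk R 4 s0).
have p1 : dot (set_val p) (set_val p) < 1.
  rewrite lt_neqAle disk_le1 andbT; apply/eqP => /disk_bd; exact: nbp.
have [a a01 Fa] := closed_disk_radius (compact_closed hD cF) nFp.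
have [k [kc kh ksurj kinj ksh]] :=
  disk_collapse_exists hX cX X0 S0 hc hi oE E0 p1.
have kinj' x y : k x = k y -> k x <> p -> x = y.
  by move=> e np; apply: kinj e _ => /set_val_inj.
have [a0 a1] := andP a01.
have ksh' := ksh a (introT andP (conj a0 (ltW a1))).
have [e [ke ek ebd]] := collapse_section kh ksurj kinj' a01 p1.
have ec d : d <> p -> {for d, continuous e}.
  move=> dp; apply: (section_continuous_at hD cX kc ke) => x kx.
  by rewrite -kx ek// kx.
have kbd x : k x <> p -> range h x <-> range (sphere_in_disk R 4) (k x).
  move=> np; split; first exact: (collapse_bd kh).
  by move=> /ebd; rewrite ek.
have clp : closed [set p] by exact/accessible_closed_set1/hausdorff_accessible.
apply: (le_trans _ (preimage_genus R kc ke ek kbd nFp)).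
apply: ereal_inf_lbound; exists (k @^-1` F) => //; split.
- apply: (preimage_spanning kc ke ek ec kbd clp nFp hD cX _ _ spF).
    move=> x np; split=> [[s Ks <-]|[s Ks ks]]; first by exists s.
    by exists s => //; apply: esym; apply: kinj' => //; rewrite kh.
  by move=> _ [s _ <-] sp; apply: nbp; rewrite -sp kh; exists s.
- exact: (double_collapse_Zsurface cX hX scX kc kh ksurj kinj' a01 Fa p1 ksh').
Qed.
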